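(* Let $\mathbb{B}^3$ be the open unit ball of $\mathbb{R}^3$. Suppose $f:\mathbb{B}^3\to\mathbb{B}^3$ is a harmonic quasiconformal mapping of $\mathbb{B}^3$ onto itself which is also a gradient mapping, that is, $f=\nabla u$ for some function $u$ harmonic in $\mathbb{B}^3$. Then $f$ is a bi-Lipschitz mapping, i.e. there is a constant $1\le L<\infty$ such that $$\frac1L|x-y|\le |f(x)-f(y)|\le L|x-y|\qquad\text{for all } x,y\in\mathbb{B}^3 .$$
   Context: A mapping $f=(f^1,\dots,f^n)$ is harmonic if each coordinate function $f^j$ is a real-valued harmonic function. A quasiconformal mapping $f:\Omega\to\Omega'$ between domains of $\mathbb{R}^n$ is a homeomorphism of $\Omega$ onto $\Omega'$ with $f\in W^{1,n}_{loc}(\Omega;\mathbb{R}^n)$ for which there is a $K<\infty$ with $|Df(x)|^n\le K\,|\det Df(x)|$ for almost every $x\in\Omega$, where $|Df(x)|$ is the operator norm. The unit ball is $\mathbb{B}^3=\{x\in\mathbb{R}^3:|x|<1\}$. *)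

(* Defs.v *)
From HB Require Import structures.
From mathcomp Require Import all_boot all_order all_algebra.
From mathcomp Require Import all_classical all_reals all_analysis.
Set Implicit Arguments.
Unset Strict Implicit.
Unset Printing Implicit Defensive.
Import Order.TTheory GRing.Theory Num.Theory.
Import numFieldNormedType.Exports.
Local Open Scope classical_set_scope.
Local Open Scope ring_scope.

(* Points of R^n are row vectors. The library norm on 'rV[R]_n is the sup norm:
   it supplies the topology and the derivatives, while all metric statements
   use the Euclidean norm [enorm]. Mappings and functions on a set Omega are
   total functions of which only the values on Omega matter. *)

Section Euclidean.
Context {R : realType} {n : nat}.

Definition basis_vec (i : 'I_n) : 'rV[R]_n := delta_mx ord0 i.

Definition enorm (v : 'rV[R]_n) : R := Num.sqrt (\sum_(i < n) v ord0 i ^+ 2).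

Definition opnorm (A : 'M[R]_n) : R :=
  sup [set enorm (v *m A) | v in [set v : 'rV[R]_n | enorm v <= 1]].

Definition unit_ball : set 'rV[R]_n := [set x | enorm x < 1].

Definition is_domain (Omega : set 'rV[R]_n) : Prop :=
  [/\ open Omega, connected Omega & Omega !=set0].

Definition partial (i : 'I_n) (u : 'rV[R]_n -> R) : 'rV[R]_n -> R :=
  fun x => 'D_(basis_vec i) u x.

(* For Omega open. *)
Fixpoint C_on (k : nat) (Omega : set 'rV[R]_n) (u : 'rV[R]_n -> R) : Prop :=
  match k with
  | 0%N => forall x, Omega x -> {for x, continuous u}
  | k'.+1 => forall i, (forall x, Omega x -> derivable u x (basis_vec i)) /\
                       C_on k' Omega (partial i u)
  end.

Definition gradient (u : 'rV[R]_n -> R) (x : 'rV[R]_n) : 'rV[R]_n :=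
  \row_(i < n) partial i u x.

Definition laplacian (u : 'rV[R]_n -> R) (x : 'rV[R]_n) : R :=
  \sum_(i < n) partial i (partial i u) x.

Definition harmonic_on (Omega : set 'rV[R]_n) (u : 'rV[R]_n -> R) : Prop :=
  C_on 2 Omega u /\ forall x, Omega x -> laplacian u x = 0.

Definition harmonic_map_on (Omega : set 'rV[R]_n) (f : 'rV[R]_n -> 'rV[R]_n) :=
  forall j, harmonic_on Omega (fun x => f x ord0 j).

Definition homeomorphism_onto (Omega Omega' : set 'rV[R]_n)
    (f : 'rV[R]_n -> 'rV[R]_n) : Prop :=
  [/\ set_bij Omega Omega' f, {within Omega, continuous f} &
      exists g : 'rV[R]_n -> 'rV[R]_n,
        {in Omega, cancel f g} /\ {within Omega', continuous g}].

Definition bi_lipschitz_on (Omega : set 'rV[R]_n) (f : 'rV[R]_n -> 'rV[R]_n) :=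
  exists2 L : R, 1 <= L & forall x y, Omega x -> Omega y ->
    L^-1 * enorm (x - y) <= enorm (f x - f y) <= L * enorm (x - y).

Definition test_function (Omega : set 'rV[R]_n) (phi : 'rV[R]_n -> R) : Prop :=
  (forall k, C_on k setT phi) /\
  exists K, [/\ compact K, K `<=` Omega & forall x, ~ K x -> phi x = 0].

End Euclidean.

Arguments unit_ball R n : clear implicits.

(* The library has a measurable structure on n.-tuple R but none on 'rV[R]_n;
   Lebesgue measure lives on the former and [rV_of_tuple] is the identification. *)

Definition rV_of_tuple {R : realType} {n : nat}
    (t : n.-tuple (measurableTypeR R)) : 'rV[R]_n :=
  \row_(i < n) tnth t i.

Section Lebesgue_tuple.
Variable R : realType.
Local Notation T := (measurableTypeR R).

Definition cons_pair n (p : T * n.-tuple T) : n.+1.-tuple T :=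
  [tuple of p.1 :: p.2].

Lemma measurable_cons_pair n : measurable_fun setT (@cons_pair n).
Proof. exact: (measurable_cons measurable_fst measurable_snd). Qed.

Lemma measurable_uncons n :
  measurable_fun setT (fun t : n.+1.-tuple T => (thead t, [tuple of behead t])).
Proof.
apply/measurable_fun_pairP; split=> /=.
  exact: (@measurable_tnth _ T n.+1 ord0).
exact: measurable_behead.
Qed.

Lemma uncons_cons_pair n (p : T * n.-tuple T) :
  (thead (cons_pair p), [tuple of behead (cons_pair p)]) = p.
Proof. by case: p => x t; rewrite theadE; congr pair; exact: val_inj. Qed.

Section product_step.
Variables (n : nat) (mu : {sigma_finite_measure set (n.-tuple T) -> \bar R}).

Definition lebesgue_step : set (n.+1.-tuple T) -> \bar R :=
  pushforward (@lebesgue_measure R \x mu)%E (@cons_pair n).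

Let step0 : lebesgue_step set0 = 0%E.
Proof. by rewrite /lebesgue_step /pushforward preimage_set0 measure0. Qed.

Let step_ge0 A : (0 <= lebesgue_step A)%E.
Proof. by rewrite /lebesgue_step /pushforward measure_ge0. Qed.

Let step_sigma_additive : semi_sigma_additive lebesgue_step.
Proof.
move=> F mF tF mUF; rewrite /lebesgue_step /pushforward preimage_bigcup.
apply: measure_semi_sigma_additive.
- by move=> k; rewrite -[X in measurable X]setTI; exact: measurable_cons_pair.
- apply/trivIsetP => /= i j _ _ ij; rewrite -preimage_setI.
  by move/trivIsetP : tF => /(_ _ _ _ _ ij) ->//; rewrite preimage_set0.
- rewrite -preimage_bigcup -[X in measurable X]setTI.
  exact: measurable_cons_pair.
Qed.

HB.instance Definition _ := isMeasure.Build _ _ _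
  lebesgue_step step0 step_ge0 step_sigma_additive.

Let step_sigma_finite : sigma_finite setT lebesgue_step.
Proof.
have /sigma_finiteP[F [FT ndF Foo]] := sigma_finiteT (@lebesgue_measure R).
have /sigma_finiteP[G [GT ndG Goo]] := sigma_finiteT mu.
pose un (t : n.+1.-tuple T) := (thead t, [tuple of behead t]).
exists (fun k => un @^-1` (F k `*` G k)).
  rewrite -preimage_bigcup; apply/esym; rewrite -subTset => t _.
  have [i _ Fi] : (\bigcup_k F k) (un t).1 by rewrite -FT.
  have [j _ Gj] : (\bigcup_k G k) (un t).2 by rewrite -GT.
  exists (maxn i j) => //; split.
    by move: Fi; exact/subsetPset/ndF/leq_maxl.
  by move: Gj; exact/subsetPset/ndG/leq_maxr.
move=> k; have [mF fF] := Foo k; have [mG fG] := Goo k.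
have mFG : measurable (F k `*` G k) by exact: measurableX.
split.
  by rewrite -[X in measurable X]setTI; exact: measurable_uncons.
rewrite /lebesgue_step /pushforward -comp_preimage.
have -> : un \o @cons_pair n = id by apply/funext => p; exact: uncons_cons_pair.
rewrite preimage_id product_measure1E//.
by rewrite lte_mul_pinfty// ge0_fin_numE.
Qed.

HB.instance Definition _ := Measure_isSigmaFinite.Build _ _ _
  lebesgue_step step_sigma_finite.

End product_step.

Fixpoint lebesgue_tuple (n : nat) :
    {sigma_finite_measure set (n.-tuple T) -> \bar R} :=
  match n with
  | 0%N => dirac [tuple]
  | k.+1 => lebesgue_step (lebesgue_tuple k)
  end.

End Lebesgue_tuple.

Arguments lebesgue_tuple R n : clear implicits.

Section Sobolev.
Context {R : realType} {n : nat}.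
Local Notation mu := (lebesgue_tuple R n).

Definition Lp_loc (p : nat) (Omega : set 'rV[R]_n) (u : 'rV[R]_n -> R) : Prop :=
  measurable_fun (rV_of_tuple @^-1` Omega) (u \o rV_of_tuple) /\
  forall K, compact K -> K `<=` Omega ->
    (\int[mu]_(t in rV_of_tuple @^-1` K)
       (`|u (rV_of_tuple t)| ^+ p)%:E < +oo)%E.

Definition weak_partial (i : 'I_n) (Omega : set 'rV[R]_n)
    (u v : 'rV[R]_n -> R) : Prop :=
  forall phi, test_function Omega phi ->
    \int[mu]_(t in rV_of_tuple @^-1` Omega)
      (u (rV_of_tuple t) * partial i phi (rV_of_tuple t)) =
    - \int[mu]_(t in rV_of_tuple @^-1` Omega)
      (v (rV_of_tuple t) * phi (rV_of_tuple t)).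

(* f is in W^{1,p}_loc(Omega; R^n) with weak differential Df. As for the
   library's jacobian, vectors act on the left: (Df x) i j is the i-th partial
   derivative of the j-th coordinate of f. *)
Definition W1p_loc (p : nat) (Omega : set 'rV[R]_n)
    (f : 'rV[R]_n -> 'rV[R]_n) (Df : 'rV[R]_n -> 'M[R]_n) : Prop :=
  (forall j, Lp_loc p Omega (fun x => f x ord0 j)) /\
  forall i j, Lp_loc p Omega (fun x => Df x i j) /\
    weak_partial i Omega (fun x => f x ord0 j) (fun x => Df x i j).

Definition quasiconformal (Omega Omega' : set 'rV[R]_n)
    (f : 'rV[R]_n -> 'rV[R]_n) : Prop :=
  [/\ is_domain Omega, is_domain Omega', homeomorphism_onto Omega Omega' f &
    exists2 Df, W1p_loc n Omega f Df &
      exists K : R, {ae mu, forall t, Omega (rV_of_tuple t) ->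
        opnorm (Df (rV_of_tuple t)) ^+ n <= K * `|\det (Df (rV_of_tuple t))|}].

End Sobolev.

(* Main.v *)
(* Write H = Df, the Hessian of u, w = 1 - |f|^2 and rho = 1 - |x|^2.  Harmonicity makes f
   smooth, so that the weak differential is the classical one and the distortion inequality
   |H|^3 <= C |det H| holds everywhere.  The function ln |det H| is superharmonic off the
   zeros of det H (an identity for harmonic functions of three variables).  There are no
   zeros: at a zero of H the leading homogeneous term p of H inherits the distortion
   inequality, vanishes only at 0 (blow up once more at another zero), and then
   ln |det p| - 3 deg(p) ln |x|, homogeneous of degree 0 and strictly superharmonic,
   contradicts the minimum principle.  By the maximum principle for exp (A w) - 1 - M rho,
   w <= C rho, and the gradient estimate for the positive harmonic functions 1 - <f, nu>
   then bounds H.  Hopf's lemma gives w >= c rho, and the minimum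
   principle for ln (det H)^2 - 6 ln w + 6 ln rho bounds |det H| from below.  Hence f and
   its inverse, defined on a convex set, are Lipschitz. *)

Require Import Defs.
From mathcomp Require Import all_boot all_order all_algebra.
From mathcomp Require Import all_classical all_reals all_analysis.
From mathcomp Require Import measurable_realfun.
From mathcomp Require Import ring lra.
Import Order.TTheory GRing.Theory Num.Theory.
Import numFieldNormedType.Exports.
Local Open Scope classical_set_scope.
Local Open Scope ring_scope.

Set Implicit Arguments.
Unset Strict Implicit.
Unset Printing Implicit Defensive.

(** * Calculus in one and several variables *)

Section OneVariable.
Context {R : realType}.
Implicit Types (phi : R -> R) (a b c t : R).

(** Because f is a gradient, its second derivatives form a totally symmetric, trace-free tensor;
    this is what makes the trace form of [adj0_form_ge0] nonnegative. Superharmonicity of ln |D|,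
    with D the determinant, is carried in the form D ΔD <= |∇D|^2, which keeps a meaning at the
    zeros of D. Harmonic functions are handled without integral formulas: derivative estimates come
    from a barrier, and the later bounds from second order expansions at a maximum, where the
    coordinate axes suffice to read off the Laplacian. The map f has no boundary values, so maxima
    are sought on compact sets such as {|f|^2 <= r} with r < 1, compact because f is a homeomorphism
    of the ball; r is chosen according to the point under study. The exponent 6 is dictated by the
    distortion inequality: the extremal point yields w^2 <= |H|^2 rho^2 for a slightly decreased w,
    and the cube of |H|^2 is bounded by C (det H)^2. The inverse map is never differentiated: a
    segment of the image ball is pulled back and infinitesimal estimates are chained along it. *)

Lemma is_derive_eps {V : normedModType R} (u : V -> R) (x v : V) (d : R) :
  is_derive x v u d <-> forall e : R, 0 < e -> exists2 D : R, 0 < D &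
    forall h : R, `|h| < D -> `|u (x + h *: v) - u x - d * h| <= e * `|h|.
Proof.
have E (h : R) : h != 0 -> `|d - h^-1 *: (u (h *: v + x) - u x)| * `|h| =
    `|u (x + h *: v) - u x - d * h|.
  move=> h0; rewrite -normrM distrC [h *: v + x]addrC; congr `| _ |.
  by rewrite mulrBl [_ *: _]mulrC mulfVK.
split=> [[dv dd] e e0|H].
  have /cvgrPdist_le /(_ e e0) [D /= D0 HD] :
    h^-1 *: (u (h *: v + x) - u x) @[h --> 0^'] --> d.
    by rewrite -dd; exact: dv.
  exists D => // h hD; have [->|h0] := eqVneq h 0.
    by rewrite scale0r addr0 !mulr0 subrr subr0 normr0 mulr0.
  rewrite -E// ler_pM2r ?normr_gt0//.
  by apply: HD => //=; rewrite sub0r normrN.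
have L : h^-1 *: (u (h *: v + x) - u x) @[h --> 0^'] --> d.
  apply/cvgrPdist_le => e e0; have [D D0 HD] := H e e0.
  exists D => //= h hD h0; rewrite /= sub0r normrN in hD.
  by rewrite -(@ler_pM2r _ `|h|) ?normr_gt0// E// HD.
split; first by apply/cvg_ex; exists d.
exact/cvg_lim.
Qed.

Lemma is_derive_continuous phi t d : is_derive t 1 phi d -> {for t, continuous phi}.
Proof. by move=> [dp _]; exact/differentiable_continuous/derivable1_diffP. Qed.

Lemma mvt_pos phi phi' h : 0 < h ->
  (forall t, 0 <= t <= h -> is_derive t 1 phi (phi' t)) ->
  exists2 c, 0 < c < h & phi h - phi 0 = phi' c * h.
Proof.
move=> h0 H; have [| |c] := @MVT R phi phi' 0 h h0.
- by move=> x; rewrite in_itv/= => /andP[/ltW x0 /ltW xh]; apply: H; rewrite x0.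
- apply: continuous_in_subspaceT => x; rewrite inE/= in_itv/= => xh.
  by have := H _ xh; exact: is_derive_continuous.
- by rewrite in_itv/= => ch; rewrite subr0; exists c.
Qed.

Lemma is_derive_comp_opp phi t d : is_derive (- t) 1 phi d ->
  is_derive t 1 (fun s => phi (- s)) (- d).
Proof.
move=> /is_derive_eps H; apply/is_derive_eps => e e0.
have [D D0 HD] := H e e0; exists D => // h hD.
have := HD (- h); rewrite normrN => /(_ hD).
by rewrite !scaler1 opprD mulrN mulNr.
Qed.

Lemma mvt_abs phi phi' h :
  (forall t, `|t| <= `|h| -> is_derive t 1 phi (phi' t)) ->
  exists2 c, `|c| <= `|h| & phi h - phi 0 = phi' c * h.
Proof.
move=> H; have [h0|h0|->] := ltgtP h 0.
- have [||c] := @mvt_pos (fun t => phi (- t)) (fun t => - phi' (- t)) (- h).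
  + by rewrite oppr_gt0.
  + move=> t /andP[t0 th]; apply: is_derive_comp_opp; apply: H.
    by rewrite normrN ger0_norm// ltr0_norm.
  + move=> /andP[c0 ch]; rewrite opprK oppr0 mulrNN => ->; exists (- c) => //.
    by rewrite normrN gtr0_norm// ltr0_norm// ltW.
- have [||c] := @mvt_pos phi phi' h => //.
    by move=> t /andP[t0 th]; apply: H; rewrite !ger0_norm// ltW.
  by move=> /andP[c0 ch] ->; exists c => //; rewrite !gtr0_norm// ltW.
- by exists 0 => //; rewrite subrr mulr0.
Qed.

(* [jet2 phi b c]: [phi] is twice differentiable at 0 (once in a neighbourhood)
   with first and second derivatives [b] and [c] there. *)
Definition jet2 phi b c := exists phi' : R -> R,
  [/\ \forall t \near (0 : R), is_derive (t : R) 1 phi (phi' t),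
      phi' 0 = b & is_derive (0 : R) 1 phi' c].

Lemma jet2_derive phi b c : jet2 phi b c -> is_derive (0 : R) 1 phi b.
Proof. by move=> [f [/nbhs_singleton + <- _]]. Qed.

Lemma jet2_eq phi b c b' c' : jet2 phi b c -> b = b' -> c = c' -> jet2 phi b' c'.
Proof. by move=> ? <- <-. Qed.

Lemma jet2_cst (k : R) : jet2 (fun=> k) 0 0.
Proof.
exists (fun=> 0); split => //; last exact: is_derive_cst.
by near=> t; exact: is_derive_cst.
Unshelve. all: by end_near. Qed.

Lemma jet2D phi b c psi b' c' : jet2 phi b c -> jet2 psi b' c' ->
  jet2 (fun t => phi t + psi t) (b + b') (c + c').
Proof.
move=> [f [nf f0 fc]] [g [ng g0 gc]]; exists (fun t => f t + g t); split; [|by rewrite f0 g0|exact: is_deriveD].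
by near=> t; apply: is_deriveD; near: t.
Unshelve. all: by end_near. Qed.

Lemma jet2M phi b c psi b' c' : jet2 phi b c -> jet2 psi b' c' ->
  jet2 (fun t => phi t * psi t) (phi 0 * b' + b * psi 0)
    (phi 0 * c' + 2 * b * b' + c * psi 0).
Proof.
move=> Hf Hg; have df := jet2_derive Hf; have dg := jet2_derive Hg.
case: Hf Hg => [f [nf f0 fc]] [g [ng g0 gc]].
exists (fun t => phi t * g t + f t * psi t); split.
- near=> t.
  have : is_derive t 1 phi (f t) by near: t.
  have : is_derive t 1 psi (g t) by near: t.
  move=> ? ?; apply: (@is_derive_eq _ _ _ _ _ _ _ _ (is_deriveM _ _)).
  by rewrite /GRing.scale/=; ring.
- by rewrite f0 g0.
apply: (@is_derive_eq _ _ _ _ _ _ _ _ (is_deriveD (is_deriveM df gc) (is_deriveM fc dg))).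
by rewrite ![_ *: _]mulrC f0 g0 /GRing.scale/=; ring.
Unshelve. all: by end_near. Qed.

Lemma jet2_comp (h h1 : R -> R) (h2 : R) phi b c : jet2 phi b c ->
  (\forall s \near phi 0, is_derive (s : R) 1 h (h1 s)) -> is_derive (phi 0) 1 h1 h2 ->
  jet2 (fun t => h (phi t)) (h1 (phi 0) * b) (h2 * b ^+ 2 + h1 (phi 0) * c).
Proof.
move=> Hf nh h12; have df := jet2_derive Hf.
have cf := is_derive_continuous df.
case: Hf => [f [nf f0 fc]].
have nhp : \forall t \near (0 : R), is_derive (phi t) 1 h (h1 (phi t)).
  exact: (cf _ nh).
exists (fun t => h1 (phi t) * f t); split.
- by near=> t; apply: is_derive1_comp; near: t.
- by rewrite f0.
have h1c : is_derive (0 : R) 1 (fun t => h1 (phi t)) (h2 * b).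
  exact: (@is_derive1_comp _ h1 phi).
apply: (@is_derive_eq _ _ _ _ _ _ _ _ (is_deriveM h1c fc)).
by rewrite f0 /GRing.scale/=; ring.
Unshelve. all: by end_near. Qed.

Lemma lt_two a b : 0 < a -> 0 < b -> exists h, [/\ 0 < h, h < a & h < b].
Proof.
move=> a0 b0; exists (Num.min a b / 2).
have m0 : 0 < Num.min a b by rewrite lt_min a0.
have ma : Num.min a b <= a by rewrite ge_min lexx.
have mb : Num.min a b <= b by rewrite ge_min lexx orbT.
by split; lra.
Qed.

(** Were [c] positive, the first derivative, which vanishes at 0 with slope [c], would be positive
    just to the right of 0, and the mean value theorem would give a value of [phi] above [phi 0]. *)
Lemma jet2_max phi b c : jet2 phi b c ->
  (\forall t \near (0 : R), phi t <= phi 0) -> b = 0 /\ c <= 0.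
Proof.
move=> [f [nf f0 fc]] m.
have : \forall t \near (0 : R), is_derive (t : R) 1 phi (f t) /\ phi t <= phi 0.
  by apply: filterI.
move=> [D /= D0 HD].
have {}HD t : `|t| < D -> is_derive t 1 phi (f t) /\ phi t <= phi 0.
  by move=> tD; apply: HD => /=; rewrite sub0r normrN.
have b0 : f 0 = 0.
  have : is_derive (0 : R) 1 phi 0.
    apply: (@derive1_at_max _ phi (- (D / 2)) (D / 2)).
    - by lra.
    - move=> t; rewrite in_itv/= => /andP[t1 t2].
      by have [|[]] := HD t => //; rewrite ltr_norml; apply/andP; split; lra.
    - by rewrite in_itv/=; apply/andP; split; lra.
    - move=> t; rewrite in_itv/= => /andP[t1 t2].
      by have [|//] := HD t; rewrite ltr_norml; apply/andP; split; lra.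
  have [] := HD 0; first by rewrite normr0.
  by move=> [_ E1] _ [_ E2]; rewrite -E1 E2.
split; first by rewrite -f0.
rewrite leNgt; apply/negP => c0.
have c20 : 0 < c / 2 by lra.
have /is_derive_eps/(_ (c / 2) c20)[D' D'0 HD'] := fc.
have [h [h0 hD hD']] := lt_two D0 D'0.
have [|x /andP[x0 xh]] := @mvt_pos phi f h h0.
  by move=> t /andP[t0 th]; apply: (HD t _).1; rewrite ger0_norm//; lra.
have : phi h <= phi 0 by apply: (HD h _).2; rewrite gtr0_norm.
have := HD' x; rewrite gtr0_norm// => /(_ (lt_trans xh hD')).
rewrite add0r scaler1 b0 subr0 ler_norml => /andP[A _] B E.
have fx : 0 < f x by nra.
by have := mulr_gt0 fx h0; lra.
Qed.

Lemma jet2_exp phi b c : jet2 phi b c ->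
  jet2 (fun t => expR (phi t)) (expR (phi 0) * b)
    (expR (phi 0) * (b ^+ 2 + c)).
Proof.
move=> Hf; rewrite mulrDr; apply: jet2_comp => //.
  by near=> s; exact: is_derive_expR.
Unshelve. all: by end_near. Qed.

Lemma jet2_ln phi b c : jet2 phi b c -> 0 < phi 0 ->
  jet2 (fun t => ln (phi t)) (b / phi 0) (c / phi 0 - (b / phi 0) ^+ 2).
Proof.
move=> Hf p0.
have n0 : phi 0 != 0 by rewrite gt_eqF.
apply: (@jet2_eq _ ((phi 0)^-1 * b) (- (phi 0) ^- 2 * b ^+ 2 + (phi 0)^-1 * c)).
  apply: (@jet2_comp (@ln R) (fun s => s^-1) (- (phi 0) ^- 2)) => //.
    by near=> s; apply: is_derive1_ln; near: s; exact: lt_nbhsr.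
  have := @is_deriveV R id (phi 0) 1 1 n0 (is_derive_id _ _).
  by rewrite [_ *: _]mulr1.
  by rewrite mulrC.
by field.
Unshelve. all: by end_near. Qed.

End OneVariable.

Section SeveralVariables.
Context {R : realType} {n : nat}.
Implicit Types (Omega : set 'rV[R]_n) (u v : 'rV[R]_n -> R) (x y z : 'rV[R]_n).
Local Notation e i := (@basis_vec R n i).

(** The balls of the sup norm, hence a neighbourhood basis of the topology; moving between two of
    their points one coordinate at a time does not leave them. *)
Definition cube x (d : R) : set 'rV[R]_n :=
  [set y | forall i, `|y ord0 i - x ord0 i| < d].

Lemma basis_vecE i j : e i ord0 j = (j == i)%:R.
Proof. by rewrite mxE eqxx. Qed.

Lemma shiftE x i (t : R) j : (x + t *: e i) ord0 j = x ord0 j + t * (j == i)%:R.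
Proof. by rewrite mxE mxE basis_vecE. Qed.

Lemma cube_center x d : 0 < d -> cube x d x.
Proof. by move=> d0 i; rewrite subrr normr0. Qed.

Lemma cube_sub x (d d' : R) : d <= d' -> cube x d `<=` cube x d'.
Proof. by move=> dd y yx i; exact: lt_le_trans dd. Qed.

Lemma cube_trans x y z (d d' : R) : cube x d y -> cube y d' z -> cube x (d + d') z.
Proof.
move=> xy yz i; rewrite -(subrKA (y ord0 i)) addrC.
rewrite (le_lt_trans (ler_normD _ _))// addrC; have := xy i; have := yz i.
by rewrite addrC; lra.
Qed.

Lemma cube_sym x y d : cube x d y -> cube y d x.
Proof. by move=> xy i; rewrite distrC. Qed.

Lemma cube_shift x i (t d : R) : `|t| < d -> cube x d (x + t *: e i).
Proof.
move=> td j; rewrite shiftE addrC addKr normrM.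
case: (j == i); rewrite ?normr1 ?mulr1// normr0 mulr0.
exact: le_lt_trans td.
Qed.

Lemma nbhs_cube x (A : set 'rV[R]_n) :
  nbhs x A <-> exists2 d : R, 0 < d & cube x d `<=` A.
Proof.
split=> [/nbhs_ballP[d /= d0 H]|[d d0 H]].
  exists d => // y yx; apply: H; split => // i j; rewrite (ord1 i) /ball/=.
  by rewrite distrC; exact: yx.
apply/nbhs_ballP; exists d => //= y [_ yx]; apply: H => i.
by rewrite distrC; exact: (yx ord0 i).
Qed.

Lemma open_cube Omega x : open Omega -> Omega x ->
  exists2 d : R, 0 < d & cube x d `<=` Omega.
Proof. by move=> oO Ox; apply/nbhs_cube; rewrite nbhsE; exists Omega. Qed.

Lemma continuous_cube u x : {for x, continuous u} <->
  forall a : R, 0 < a -> exists2 d : R, 0 < d & forall y, cube x d y -> `|u y - u x| < a.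
Proof.
split=> [/cvgrPdist_lt H a a0|H].
  have /nbhs_cube[d d0 Hd] := H a a0.
  by exists d => // y /Hd; rewrite distrC.
move=> A /nbhs_ballP[a /= a0 aA]; have [d d0 Hd] := H a a0.
by apply/nbhs_cube; exists d => // y /Hd h; apply: aA; rewrite /ball/= distrC.
Qed.

Lemma cube_forall x (P : 'I_n -> 'rV[R]_n -> Prop) :
  (forall i, exists2 d : R, 0 < d & forall y, cube x d y -> P i y) ->
  exists2 d : R, 0 < d & forall i y, cube x d y -> P i y.
Proof.
move=> H; have H' i : exists d : R, 0 < d /\ forall y, cube x d y -> P i y.
  by have [d d0 Hd] := H i; exists d.
have [f Hf] := choice H'.
exists (\big[Num.min/1]_i f i).
  by apply/bigmin_gtP; split => // i _; have [] := Hf i.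
move=> i y xy; have [_] := Hf i; apply.
by apply: cube_sub xy; exact: bigmin_le_cond.
Qed.

Lemma line_is_derive u x (w : 'rV[R]_n) (t : R) : derivable u (x + t *: w) w ->
  is_derive t 1 (fun s : R => u (x + s *: w)) ('D_w u (x + t *: w)).
Proof.
move=> dw; have /is_derive_eps H : is_derive (x + t *: w) w u ('D_w u (x + t *: w)).
  by split.
apply/is_derive_eps => a a0; have [d d0 Hd] := H a a0; exists d => // h /Hd.
by rewrite scaler1 scalerDl addrA.
Qed.

Lemma mvt_line u x i (h : R) :
  (forall t, `|t| <= `|h| -> derivable u (x + t *: e i) (e i)) ->
  exists2 c, `|c| <= `|h| & u (x + h *: e i) - u x = partial i u (x + c *: e i) * h.
Proof.
move=> H; have [t th|c ch E] := @mvt_abs _ (fun s => u (x + s *: e i))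
    (fun s => partial i u (x + s *: e i)) h.
  exact/line_is_derive/H.
by exists c => //; rewrite -E scale0r addr0.
Qed.

(** Both points vary here, unlike in ordinary differentiability. Passing from [y] to [z] one
    coordinate at a time and applying the mean value theorem to each move reduces the error to the
    oscillation of the partial derivatives near [x]. *)
Lemma strict_diff Omega u x : open Omega -> C_on 1 Omega u -> Omega x ->
  forall a : R, 0 < a -> exists2 d : R, 0 < d & forall y z, cube x d y -> cube x d z ->
    `|u z - u y - \sum_i partial i u x * (z ord0 i - y ord0 i)|
      <= a * \sum_i `|z ord0 i - y ord0 i|.
Proof.
move=> oO C1 Ox a a0.
have [D D0 DO] := open_cube oO Ox.
have [d d0 Hd] : exists2 d : R, 0 < d & forall y, cube x d y ->
    Omega y /\ forall i, `|partial i u y - partial i u x| < a.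
  have [d d0 Hd] : exists2 d : R, 0 < d & forall i y, cube x d y ->
      `|partial i u y - partial i u x| < a.
    apply: cube_forall => i; have [_ /(_ _ Ox)/continuous_cube/(_ a a0)] := C1 i.
    by [].
  have [h [h0 hd hD]] := lt_two d0 D0.
  exists h => // y xy; split; first exact/DO/(cube_sub (ltW hD)).
  by move=> i; exact/Hd/(cube_sub (ltW hd)).
exists (d / 3) => [|y z yx zx]; first by rewrite divr_gt0.
(* [p k] takes its first [k] coordinates from [z] and the others from [y]. With both points within
   d/3 of [x], each move is shorter than 2d/3 and stays in the cube of radius [d]. *)
pose p (k : nat) : 'rV[R]_n := \row_i (if (i < k)%N then z ord0 i else y ord0 i).
have p0 : p 0%N = y by apply/rowP => i; rewrite mxE.
have pn : p n = z by apply/rowP => i; rewrite mxE ltn_ord.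
have pS (k : 'I_n) : p k.+1 = p k + (z ord0 k - y ord0 k) *: e k.
  apply/rowP => i; rewrite shiftE !mxE ltnS leq_eqVlt -(inj_eq val_inj)/=.
  by case: ltngtP => [ik|ik|/val_inj->]; rewrite ?mulr0 ?addr0// mulr1 addrC subrK.
have px (k : nat) : cube x (d / 3) (p k).
  by move=> i; rewrite mxE; case: ifP => _; [exact: zx|exact: yx].
have -> : u z - u y = \sum_(k < n) (u (p k.+1) - u (p k)).
  by rewrite -(big_mkord xpredT (fun k => u (p k.+1) - u (p k))) telescope_sumr// pn p0.
rewrite -sumrB mulr_sumr (le_trans (ler_norm_sum _ _ _))//.
apply: ler_sum => k _; rewrite pS.
have yz : `|z ord0 k - y ord0 k| < 2 * (d / 3).
  rewrite -(subrKA (x ord0 k)) (le_lt_trans (ler_normD _ _))//.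
  have := zx k; have := yx k; rewrite (distrC (x ord0 k)); lra.
have inD (t : R) : `|t| <= `|z ord0 k - y ord0 k| -> cube x d (p k + t *: e k).
  move=> tz; have -> : d = d / 3 + 2 * (d / 3) by field.
  by apply: cube_trans (px k) _; apply: cube_shift; exact: le_lt_trans yz.
have [t tz|c cz ->] := @mvt_line u (p k) k (z ord0 k - y ord0 k).
  by have [+ _] := C1 k; apply; have [] := Hd _ (inD t tz).
rewrite -mulrBl normrM ler_wpM2r//.
by have [_ /(_ k)/ltW] := Hd _ (inD c cz).
Qed.

Lemma C1_continuous Omega u x : open Omega -> C_on 1 Omega u -> Omega x ->
  {for x, continuous u}.
Proof.
move=> oO C1 Ox; apply/continuous_cube => a a0.
have [d d0 Hd] := strict_diff oO C1 Ox ltr01.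
pose M := \sum_i `|partial i u x| + n%:R.
have M0 : 0 <= M by rewrite addr_ge0// sumr_ge0.
have Ma : 0 < a / (M + 1) by rewrite divr_gt0// ltr_wpDl.
have [d' [d'0 d'd d'a]] := lt_two d0 Ma.
exists d' => // y yx.
have := Hd x y (cube_center x d0) (cube_sub (ltW d'd) yx).
rewrite mul1r => H.
have S0 : \sum_i `|y ord0 i - x ord0 i| <= n%:R * d'.
  rewrite -[n in n%:R]card_ord -sum1_card natr_sum mulr_suml.
  by apply: ler_sum => i _; rewrite mul1r ltW.
have S1 : `|\sum_i partial i u x * (y ord0 i - x ord0 i)| <= (\sum_i `|partial i u x|) * d'.
  rewrite (le_trans (ler_norm_sum _ _ _))// mulr_suml ler_sum// => i _.
  by rewrite normrM ler_wpM2l// ltW.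
have : `|u y - u x| <= M * d'.
  rewrite -(subrK (\sum_i partial i u x * (y ord0 i - x ord0 i)) (u y - u x)).
  rewrite (le_trans (ler_normD _ _))// /M mulrDl addrC lerD//.
  exact: le_trans S0.
move/le_lt_trans; apply.
move: d'a; rewrite ltr_pdivlMr ?ltr_wpDl// mulrDr mulr1 mulrC; lra.
Qed.

Lemma C_onS k Omega u : open Omega -> C_on k.+1 Omega u -> C_on k Omega u.
Proof.
move=> oO; elim: k u => [|k IH] u.
  by move=> C1 x Ox; exact: C1_continuous oO C1 Ox.
by move=> H i; have [H1 H2] := H i; split => //; exact: IH.
Qed.

Lemma C_on_derivable k Omega u i x : C_on k.+1 Omega u -> Omega x ->
  derivable u x (e i).
Proof. by move=> H; have [+ _] := H i; apply. Qed.

Lemma C_on_partial k Omega u i : C_on k.+1 Omega u -> C_on k Omega (partial i u).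
Proof. by move=> H; have [] := H i. Qed.

Lemma C_on_continuous k Omega u x : open Omega -> C_on k Omega u -> Omega x ->
  {for x, continuous u}.
Proof. by move=> oO; elim: k => [|k IH]; [exact|move/(C_onS oO)]. Qed.

Lemma C1_is_derive Omega u x (w : 'rV[R]_n) : open Omega -> C_on 1 Omega u -> Omega x ->
  is_derive x w u (\sum_i w ord0 i * partial i u x).
Proof.
move=> oO C1 Ox; apply/is_derive_eps => a a0.
pose M := \sum_i `|w ord0 i|.
have M0 : 0 <= M by rewrite sumr_ge0.
have Ma : 0 < a / (M + 1) by rewrite divr_gt0// ltr_wpDl.
have [d d0 Hd] := strict_diff oO C1 Ox Ma.
exists (d / (M + 1)) => [|h hd]; first by rewrite divr_gt0// ltr_wpDl.
have wM i : `|w ord0 i| <= M by rewrite /M (bigD1 i)//= lerDl sumr_ge0.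
have xh : cube x d (x + h *: w).
  move=> i; rewrite !mxE [x _ _ + _]addrC addrK normrM.
  move: hd; rewrite ltr_pdivlMr ?ltr_wpDl// => hd.
  apply: le_lt_trans hd; rewrite ler_wpM2l// (le_trans (wM i))// lerDl.
  exact: ler01.
have := Hd _ _ (cube_center x d0) xh.
have -> : \sum_i partial i u x * ((x + h *: w) ord0 i - x ord0 i) =
    (\sum_i w ord0 i * partial i u x) * h.
  by rewrite mulr_suml; apply: eq_bigr => i _; rewrite !mxE; ring.
have -> : \sum_i `|(x + h *: w) ord0 i - x ord0 i| = M * `|h|.
  by rewrite mulr_suml; apply: eq_bigr => i _; rewrite !mxE [x _ _ + _]addrC addrK normrM mulrC.
move=> /le_trans; apply; rewrite mulrA ler_wpM2r//.
by rewrite mulrAC ler_pdivrMr ?ltr_wpDl// ler_pM2l// lerDl.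
Qed.

(** The second difference is symmetric in [i] and [j], so this expansion, read in both orders,
    forces the two mixed derivatives to agree ([partialC]). It follows from the mean value theorem
    in the direction [i] and strict differentiability of [partial i u]. *)
Lemma second_difference Omega u x i j : open Omega -> C_on 2 Omega u -> Omega x ->
  forall a : R, 0 < a -> exists2 d : R, 0 < d & forall t, `|t| < d ->
    `|u (x + t *: e i + t *: e j) - u (x + t *: e i) - u (x + t *: e j) + u x
       - partial j (partial i u) x * t ^+ 2| <= a * t ^+ 2.
Proof.
move=> oO C2 Ox a a0.
have [d d0 Hd] := strict_diff oO (C_on_partial i C2) Ox a0.
have [D D0 DO] := open_cube oO Ox.
have [h [h0 hd hD]] := lt_two d0 D0.
exists (h / 2) => [|t th]; first by rewrite divr_gt0.
have in1 (s r : R) : `|s| <= `|t| -> `|r| <= `|t| -> cube x h (x + s *: e i + r *: e j).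
  move=> st rt; have -> : h = h / 2 + h / 2 by field.
  by apply: (@cube_trans _ (x + s *: e i)); apply: cube_shift; apply: le_lt_trans th.
have t0 : `|0 : R| <= `|t| by rewrite normr0.
have in0 (s : R) : `|s| <= `|t| -> cube x h (x + s *: e i).
  by move=> st; have := in1 s 0 st t0; rewrite scale0r addr0.
have inO y : cube x h y -> Omega y by move=> xy; apply/DO/(cube_sub (ltW hD) xy).
have dl (s r : R) : `|s| <= `|t| -> `|r| <= `|t| ->
  is_derive s 1 (fun s : R => u (x + s *: e i + r *: e j))
    (partial i u (x + s *: e i + r *: e j)).
  move=> st rt; have := @line_is_derive u (x + r *: e j) (e i) s.
  rewrite addrAC => /(_ (C_on_derivable C2 (inO _ (in1 s r st rt)))).
  by under eq_fun do rewrite addrAC.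
have [s st|c ct E] := @mvt_abs _
   (fun s : R => u (x + s *: e i + t *: e j) - u (x + s *: e i + 0 *: e j))
   (fun s : R => partial i u (x + s *: e i + t *: e j) - partial i u (x + s *: e i + 0 *: e j)) t.
  by apply: is_deriveB; apply: dl.
have := Hd _ _ (cube_sub (ltW hd) (in0 _ ct)) (cube_sub (ltW hd) (in1 _ _ ct (lexx _))).
under eq_bigr do rewrite shiftE addrC addKr mulrA.
under [X in _ <= a * X]eq_bigr do rewrite shiftE addrC addKr normrM.
rewrite (bigD1 j)//= big1 ?addr0 => [|k kj]; last by rewrite (negbTE kj) mulr0.
rewrite (bigD1 j)//= big1 ?addr0 => [|k kj]; last by rewrite (negbTE kj) normr0 mulr0.
rewrite eqxx normr1 !mulr1 => H.
move: E; rewrite !scale0r !addr0 => E.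
have -> : u (x + t *: e i + t *: e j) - u (x + t *: e i) - u (x + t *: e j) + u x -
    partial j (partial i u) x * t ^+ 2 =
   (partial i u (x + c *: e i + t *: e j) - partial i u (x + c *: e i)
     - partial j (partial i u) x * t) * t.
  by rewrite mulrBl -E; ring.
by rewrite normrM -[t ^+ 2]real_normK ?num_real// expr2 mulrA ler_wpM2r.
Qed.

Lemma partialC Omega u x i j : open Omega -> C_on 2 Omega u -> Omega x ->
  partial i (partial j u) x = partial j (partial i u) x.
Proof.
move=> oO C2 Ox; apply/eqP; rewrite -subr_eq0 -normr_eq0; apply/eqP.
apply: le_anti; rewrite normr_ge0 andbT; apply/ler_addgt0Pl => a a0.
rewrite addr0.
have a2 : 0 < a / 2 by lra.
have [d1 d10 H1] := second_difference i j oO C2 Ox a2.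
have [d2 d20 H2] := second_difference j i oO C2 Ox a2.
have [t [t0 t1 t2]] := lt_two d10 d20.
have := H1 t; have := H2 t; rewrite gtr0_norm// => /(_ t2) + /(_ t1).
rewrite [x + t *: e j + _]addrAC.
set A := u (x + t *: e i + _); set B := u _; set C := u (x + t *: e i).
move=> h1 h2; have s0 : 0 < t ^+ 2 by rewrite exprn_gt0.
rewrite -(@ler_pM2r _ (t ^+ 2))// -(ger0_norm (ltW s0)) -normrM.
move: h1 h2 => /ler_normlP[h1 h2] /ler_normlP[h3 h4]; rewrite (ger0_norm (ltW s0)).
set p := partial i _ x in h1 h2 *; set q := partial j _ x in h3 h4 *.
set r := t ^+ 2 in h1 h2 h3 h4 *; set k := u x in h1 h2 h3 h4.
by apply/ler_normlP; split; clear -h1 h2 h3 h4; lra.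
Qed.

Lemma partial_eq Omega u v i x : open Omega -> {in Omega, u =1 v} -> Omega x ->
  (derivable u x (e i) -> derivable v x (e i)) /\ partial i u x = partial i v x.
Proof.
move=> oO uv Ox.
have E : \forall y \near x, u y = v y.
  have : nbhs x Omega by rewrite nbhsE; exists Omega.
  by apply: filterS => y Oy; apply: uv; rewrite inE.
split; last exact: near_eq_derive.
exact: near_eq_derivable.
Qed.

Lemma C_on_eq k Omega u v : open Omega -> {in Omega, u =1 v} ->
  C_on k Omega u -> C_on k Omega v.
Proof.
move=> oO; elim: k u v => [|k IH] u v uv.
  move=> cu x Ox; apply/continuous_cube => a a0.
  have /continuous_cube/(_ a a0)[d d0 Hd] := cu x Ox.
  have [D D0 DO] := open_cube oO Ox; have [h [h0 hd hD]] := lt_two d0 D0.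
  exists h => // y xy; rewrite -!uv ?inE//; last exact/DO/(cube_sub (ltW hD)).
  exact/Hd/(cube_sub (ltW hd)).
move=> H i; have [H1 H2] := H i; split.
  by move=> x Ox; apply: (partial_eq i oO uv Ox).1; exact: H1.
apply: IH H2 => x; rewrite inE => Ox; exact: (partial_eq i oO uv Ox).2.
Qed.

Lemma C_on_sub k Omega Omega' u : Omega' `<=` Omega -> C_on k Omega u -> C_on k Omega' u.
Proof.
move=> OO; elim: k u => [|k IH] u H.
  by move=> x /OO; exact: H.
by move=> i; have [H1 H2] := H i; split; [move=> x /OO; exact: H1|exact: IH].
Qed.

Lemma C_on_cst k Omega (a : R) : C_on k Omega (fun=> a).
Proof.
elim: k a => [|k IH] a; first by move=> x _; exact: cst_continuous.
move=> i; split => [x _|]; first exact: derivable_cst.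
suff -> : partial i (fun=> a) = (fun=> 0) by exact: IH.
by apply/funext => x; rewrite /partial derive_cst.
Qed.

Lemma partialD u v i x : derivable u x (e i) -> derivable v x (e i) ->
  partial i (fun y => u y + v y) x = partial i u x + partial i v x.
Proof. by move=> du dv; exact: (@deriveD _ _ _ u v). Qed.

Lemma partialM u v i x : derivable u x (e i) -> derivable v x (e i) ->
  partial i (fun y => u y * v y) x = u x * partial i v x + v x * partial i u x.
Proof. by move=> du dv; exact: (@deriveM _ _ u v). Qed.

Lemma partial_cst (a : R) i x : partial i (fun=> a) x = 0.
Proof. by rewrite /partial derive_cst. Qed.

Lemma partialZ (a : R) u i x : derivable u x (e i) ->
  partial i (fun y => a * u y) x = a * partial i u x.
Proof.
move=> du; rewrite (partialM (derivable_cst a x (e i)) du).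
by rewrite partial_cst mulr0 addr0.
Qed.

Lemma derivableBf u v i x : derivable u x (e i) -> derivable v x (e i) ->
  derivable (fun y => u y - v y) x (e i).
Proof. by move=> du dv; exact: (@derivableB _ _ _ u v). Qed.

Lemma partialB u v i x : derivable u x (e i) -> derivable v x (e i) ->
  partial i (fun y => u y - v y) x = partial i u x - partial i v x.
Proof. by move=> du dv; exact: (@deriveB _ _ _ u v). Qed.

Lemma C_onD k Omega u v : open Omega -> C_on k Omega u -> C_on k Omega v ->
  C_on k Omega (fun x => u x + v x).
Proof.
move=> oO; elim: k u v => [|k IH] u v.
  by move=> cu cv x Ox; apply: continuousD; [exact: cu|exact: cv].
move=> Hu Hv i; split.
  by move=> x Ox; exact: (@derivableD _ _ _ u v _ _ (C_on_derivable Hu Ox) (C_on_derivable Hv Ox)).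
apply: (@C_on_eq _ _ (fun x => partial i u x + partial i v x)) => //.
  move=> x; rewrite inE => Ox.
  by rewrite (partialD (C_on_derivable Hu Ox) (C_on_derivable Hv Ox)).
by apply: IH; exact: C_on_partial.
Qed.

Lemma C_onM k Omega u v : open Omega -> C_on k Omega u -> C_on k Omega v ->
  C_on k Omega (fun x => u x * v x).
Proof.
move=> oO; elim: k u v => [|k IH] u v.
  by move=> cu cv x Ox; apply: continuousM; [exact: cu|exact: cv].
move=> Hu Hv i; split.
  by move=> x Ox; exact: (@derivableM _ _ u v _ _ (C_on_derivable Hu Ox) (C_on_derivable Hv Ox)).
apply: (@C_on_eq _ _ (fun x => u x * partial i v x + v x * partial i u x)) => //.
  move=> x; rewrite inE => Ox.
  by rewrite (partialM (C_on_derivable Hu Ox) (C_on_derivable Hv Ox)).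
by apply: C_onD => //; apply: IH; (exact: C_on_partial) || exact: C_onS.
Qed.

Lemma C_onZ k Omega (a : R) u : open Omega -> C_on k Omega u ->
  C_on k Omega (fun x => a * u x).
Proof. by move=> oO; apply: C_onM => //; exact: C_on_cst. Qed.

Lemma C_on_sum m k Omega (u_ : 'I_m -> 'rV[R]_n -> R) : open Omega ->
  (forall j, C_on k Omega (u_ j)) -> C_on k Omega (fun x => \sum_j u_ j x).
Proof.
move=> oO; elim: m u_ => [|m IH] u_ H.
  by apply: (C_on_eq oO _ (C_on_cst k Omega 0)) => x _; rewrite big_ord0.
pose w := widen_ord (leqnSn m).
apply: (C_on_eq oO _ (C_onD oO (IH (u_ \o w) (fun j => H (w j))) (H ord_max))) => x _.
by rewrite big_ord_recr.
Qed.

Lemma is_derive_coord (x w : 'rV[R]_n) j : is_derive x w (fun y => y ord0 j) (w ord0 j).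
Proof.
apply/is_derive_eps => a a0; exists 1 => // h _.
rewrite !mxE; have -> : x ord0 j + h * w ord0 j - x ord0 j - w ord0 j * h = 0 by ring.
by rewrite normr0 mulr_ge0// ltW.
Qed.

Lemma partial_coord i j x : partial i (fun y => y ord0 j) x = (j == i)%:R.
Proof. by rewrite -basis_vecE; case: (is_derive_coord x (e i) j). Qed.

Lemma C_on_coord k Omega j : open Omega -> C_on k Omega (fun x => x ord0 j).
Proof.
move=> oO; elim: k => [|k _].
  by move=> x _; exact: coord_continuous.
move=> i; split => [x _|]; first by case: (is_derive_coord x (e i) j).
apply: (@C_on_eq _ _ (fun=> (j == i)%:R)) => //; last exact: C_on_cst.
by move=> x _; rewrite partial_coord.
Qed.

Lemma is_derive_shift u (a x w : 'rV[R]_n) d : is_derive (x + a) w u d ->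
  is_derive x w (fun y => u (y + a)) d.
Proof.
move=> /is_derive_eps H; apply/is_derive_eps => b b0; have [D D0 HD] := H b b0.
by exists D => // h /HD; rewrite [x + h *: w + a]addrAC.
Qed.

Lemma derivable_shift u (a x w : 'rV[R]_n) : derivable u (x + a) w ->
  derivable (fun y => u (y + a)) x w.
Proof. by move=> d; have [] : is_derive x w (fun y => u (y + a)) ('D_w u (x + a)) by exact: is_derive_shift. Qed.

Lemma partial_shift u (a : 'rV[R]_n) i x : derivable u (x + a) (e i) ->
  partial i (fun y => u (y + a)) x = partial i u (x + a).
Proof.
move=> d; suff [_ E] : is_derive x (e i) (fun y => u (y + a)) ('D_(e i) u (x + a)) by exact: E.
exact: is_derive_shift.
Qed.

Lemma C_on_shift k Omega Omega' u (a : 'rV[R]_n) :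
  open Omega' -> (forall x, Omega' x -> Omega (x + a)) -> C_on k Omega u ->
  C_on k Omega' (fun y => u (y + a)).
Proof.
move=> oO OO; elim: k u => [|k IH] u H.
  move=> x /OO/H/continuous_cube cu; apply/continuous_cube => b b0.
  have [d d0 Hd] := cu b b0; exists d => // y xy; apply: Hd => j.
  by rewrite !mxE opprD addrACA subrr addr0; exact: xy.
move=> i; have [H1 H2] := H i; split.
  by move=> x /OO/H1; exact: derivable_shift.
apply: (@C_on_eq _ _ (fun y => partial i u (y + a))) => //; last exact: IH.
by move=> x; rewrite inE => /OO/H1/partial_shift ->.
Qed.

End SeveralVariables.

(** * Maximum principle and regularity of harmonic functions *)

Section Jets.
Context {R : realType} {n : nat}.
Implicit Types (Omega : set 'rV[R]_n) (u v : 'rV[R]_n -> R) (x y z : 'rV[R]_n).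
Implicit Types (b c : 'I_n -> R).
Local Notation e i := (@basis_vec R n i).

Lemma near0P (P : R -> Prop) :
  (\forall t \near (0 : R), P t) <-> exists2 d : R, 0 < d & forall t, `|t| < d -> P t.
Proof.
split=> [[d /= d0 H]|[d d0 H]]; exists d => // t.
  by move=> td; apply: H; rewrite /= sub0r normrN.
by rewrite /= sub0r normrN; exact: H.
Qed.

Lemma jet2_opp (phi : R -> R) (b c : R) : jet2 phi b c ->
  jet2 (fun t => phi (- t)) (- b) c.
Proof.
move=> [f [nf f0 fc]]; exists (fun t => - f (- t)); split.
- move/near0P: nf => [d d0 Hd]; apply/near0P; exists d => // t td.
  by apply: is_derive_comp_opp; apply: Hd; rewrite normrN.
- by rewrite oppr0 f0.
- rewrite -[c]opprK; apply: is_deriveN; apply: is_derive_comp_opp.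
  by rewrite oppr0.
Qed.

(* Second order expansions along the coordinate axes only, so that [\sum_i c i] is
   the Laplacian. *)
Definition jet u x b c := forall i, jet2 (fun t => u (x + t *: e i)) (b i) (c i).

Lemma jet_eq u x b c b' c' : jet u x b c -> b =1 b' -> c =1 c' -> jet u x b' c'.
Proof. by move=> H bb cc i; rewrite -bb -cc. Qed.

Lemma line0 u x (w : 'rV[R]_n) : u (x + 0 *: w) = u x.
Proof. by rewrite scale0r addr0. Qed.

Lemma C2_jet Omega u x : open Omega -> C_on 2 Omega u -> Omega x ->
  jet u x (fun i => partial i u x) (fun i => partial i (partial i u) x).
Proof.
move=> oO C2 Ox i; have [d d0 Hd] := open_cube oO Ox.
exists (fun t => partial i u (x + t *: e i)); split.
- near=> t; apply: line_is_derive; apply: (C_on_derivable C2); apply: Hd.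
  by apply: cube_shift; near: t; apply/near0P; exists d.
- by rewrite line0.
- have := @line_is_derive _ _ (partial i u) x (e i) 0.
  rewrite scale0r addr0; apply.
  exact: (C_on_derivable (C_on_partial i C2)).
Unshelve. all: by end_near. Qed.

Lemma jet_cst (a : R) x : jet (fun=> a) x (fun=> 0) (fun=> 0).
Proof. by move=> i; exact: jet2_cst. Qed.

Lemma jetD u x b c v b' c' : jet u x b c -> jet v x b' c' ->
  jet (fun y => u y + v y) x (fun i => b i + b' i) (fun i => c i + c' i).
Proof. by move=> H H' i; apply: jet2D; [exact: H|exact: H']. Qed.

Lemma jetM u x b c v b' c' : jet u x b c -> jet v x b' c' ->
  jet (fun y => u y * v y) x (fun i => u x * b' i + b i * v x)
    (fun i => u x * c' i + 2 * b i * b' i + c i * v x).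
Proof.
by move=> H H' i; have := jet2M (H i) (H' i); rewrite !line0.
Qed.

Lemma jetZ (a : R) u x b c : jet u x b c ->
  jet (fun y => a * u y) x (fun i => a * b i) (fun i => a * c i).
Proof.
move=> H; apply: jet_eq (jetM (jet_cst a x) H) _ _ => i /=; ring.
Qed.

Lemma jetN u x b c : jet u x b c ->
  jet (fun y => - u y) x (fun i => - b i) (fun i => - c i).
Proof.
move=> H; have := jetZ (-1) H; under [X in jet X]eq_fun do rewrite mulN1r.
by move/jet_eq; apply => i; rewrite mulN1r.
Qed.

Lemma jetB u x b c v b' c' : jet u x b c -> jet v x b' c' ->
  jet (fun y => u y - v y) x (fun i => b i - b' i) (fun i => c i - c' i).
Proof. by move=> H H'; apply: jetD => //; exact: jetN. Qed.

Lemma jet_sqr u x b c : jet u x b c ->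
  jet (fun y => u y ^+ 2) x (fun i => 2 * u x * b i)
    (fun i => 2 * u x * c i + 2 * b i ^+ 2).
Proof. by move=> H; apply: jet_eq (jetM H H) _ _ => i /=; ring. Qed.

Lemma jet_sum m (u_ : 'I_m -> 'rV[R]_n -> R) x (b_ c_ : 'I_m -> 'I_n -> R) :
  (forall k, jet (u_ k) x (b_ k) (c_ k)) ->
  jet (fun y => \sum_k u_ k y) x (fun i => \sum_k b_ k i) (fun i => \sum_k c_ k i).
Proof.
elim: m u_ b_ c_ => [|m IH] u_ b_ c_ H.
  move=> i; rewrite !big_ord0; under eq_fun do rewrite big_ord0.
  exact: jet2_cst.
move=> i; rewrite !big_ord_recr/=; under eq_fun do rewrite big_ord_recr/=.
pose w := widen_ord (leqnSn m).
exact: (jet2D (IH (u_ \o w) (b_ \o w) (c_ \o w) (fun k => H (w k)) i) (H ord_max i)).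
Qed.

Lemma jet_exp u x b c : jet u x b c ->
  jet (fun y => expR (u y)) x (fun i => expR (u x) * b i)
    (fun i => expR (u x) * (b i ^+ 2 + c i)).
Proof. by move=> H i; have := jet2_exp (H i); rewrite line0. Qed.

Lemma jet_ln u x b c : jet u x b c -> 0 < u x ->
  jet (fun y => ln (u y)) x (fun i => b i / u x)
    (fun i => c i / u x - (b i / u x) ^+ 2).
Proof. by move=> H u0 i; have := jet2_ln (H i); rewrite line0; exact. Qed.

Lemma jet_coord j x : jet (fun y => y ord0 j) x (fun i => (j == i)%:R) (fun=> 0).
Proof.
move=> i; exists (fun=> (j == i)%:R); split => //; last exact: is_derive_cst.
near=> t; apply/is_derive_eps => a a0; exists 1 => // h _.
rewrite !shiftE scaler1.
set k := (j == i)%:R; have -> : x ord0 j + (t + h) * k - (x ord0 j + t * k) - k * h = 0.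
  ring.
by rewrite normr0 mulr_ge0// ltW.
Unshelve. all: by end_near. Qed.

Lemma jet_max u x b c : jet u x b c ->
  (exists2 d : R, 0 < d & forall y, cube x d y -> u y <= u x) ->
  forall i, b i = 0 /\ c i <= 0.
Proof.
move=> H [d d0 Hd] i; apply: jet2_max (H i) _.
apply/near0P; exists d => // t td.
by rewrite line0; apply: Hd; exact: cube_shift.
Qed.

Lemma jet_max_lap u x b c : jet u x b c ->
  (exists2 d : R, 0 < d & forall y, cube x d y -> u y <= u x) ->
  (forall i, b i = 0) /\ \sum_i c i <= 0.
Proof.
move=> H m; have {}H := jet_max H m; split => [i|]; first by have [] := H i.
by apply: sumr_le0 => i _; have [] := H i.
Qed.

Lemma compact_argmax (K : set 'rV[R]_n) u : compact K -> K !=set0 ->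
  (forall x, K x -> {for x, continuous u}) ->
  exists2 c, K c & forall y, K y -> u y <= u c.
Proof.
move=> cK K0 cu; have [|c cin H] := compact_EVT_max K0 cK (f := u).
  by apply: continuous_in_subspaceT => x; rewrite inE; exact: cu.
by exists c => [|y Ky]; [rewrite inE in cin|apply: H; rewrite inE].
Qed.

Lemma compact_cbox (a b : 'I_n -> R) :
  compact [set y : 'rV[R]_n | forall i, a i <= y ord0 i <= b i].
Proof.
have := @rV_compact R n (fun i => `[a i, b i]%classic) (fun i => @segment_compact _ _ _).
set A := (X in compact X) => cA.
suff E : A = [set y : 'rV[R]_n | forall i, a i <= y ord0 i <= b i] by case: _ / E.
by apply/seteqP; split=> y /= H i; have := H i; rewrite /= in_itv.
Qed.

Lemma cube_is_open x (d : R) : open (cube x d).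
Proof.
rewrite openE => y xy; apply/nbhs_cube.
have [k k0 Hk] : exists2 k : R, 0 < k & forall i z, cube y k z -> `|z ord0 i - x ord0 i| < d.
  apply: cube_forall => i; exists (d - `|y ord0 i - x ord0 i|); first by rewrite subr_gt0; exact: xy.
  move=> z /(_ i) zy; have -> : z ord0 i - x ord0 i = (z ord0 i - y ord0 i) + (y ord0 i - x ord0 i) by ring.
  by rewrite (le_lt_trans (ler_normD _ _))// -ltrBrDr.
by exists k => // z yz i; exact: Hk.
Qed.

End Jets.

Section Harmonic.
Context {R : realType} {n : nat}.
Implicit Types (Omega : set 'rV[R]_n) (u v : 'rV[R]_n -> R) (x y z : 'rV[R]_n).
Local Notation e i := (@basis_vec R n i).

Lemma harmonic_sub Omega Omega' u : Omega' `<=` Omega -> harmonic_on Omega u ->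
  harmonic_on Omega' u.
Proof. by move=> OO [C2 L]; split; [exact: C_on_sub C2|move=> x /OO/L]. Qed.

Lemma harmonic_eq Omega u v : open Omega -> {in Omega, u =1 v} ->
  harmonic_on Omega u -> harmonic_on Omega v.
Proof.
move=> oO uv [C2 L]; split; first exact: C_on_eq C2.
move=> x Ox; rewrite -(L x Ox); apply: eq_bigr => i _.
have puv : {in Omega, partial i u =1 partial i v}.
  by move=> y; rewrite inE => Oy; exact: (partial_eq i oO uv Oy).2.
by rewrite (partial_eq i oO puv Ox).2.
Qed.

Lemma harmonic_cst Omega (a : R) : harmonic_on Omega (fun=> a).
Proof.
split; first exact: C_on_cst.
move=> x _; rewrite /laplacian big1// => i _.
suff -> : partial i (fun=> a) = (fun=> 0) by rewrite partial_cst.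
by apply/funext => y; rewrite partial_cst.
Qed.

Lemma harmonicD Omega u v : open Omega -> harmonic_on Omega u -> harmonic_on Omega v ->
  harmonic_on Omega (fun x => u x + v x).
Proof.
move=> oO [Cu Lu] [Cv Lv]; split; first exact: C_onD.
move=> x Ox; rewrite -[RHS](addr0 0) -[X in X + _](Lu x Ox) -[X in _ + X](Lv x Ox).
rewrite /laplacian -big_split/=; apply: eq_bigr => i _.
have E : {in Omega, partial i (fun y => u y + v y) =1 (fun y => partial i u y + partial i v y)}.
  by move=> y; rewrite inE => Oy; rewrite (partialD (C_on_derivable Cu Oy) (C_on_derivable Cv Oy)).
rewrite (partial_eq i oO E Ox).2 (partialD _ _)//.
  exact: C_on_derivable (C_on_partial i Cu) Ox.
exact: C_on_derivable (C_on_partial i Cv) Ox.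
Qed.

Lemma harmonicZ Omega (a : R) u : open Omega -> harmonic_on Omega u ->
  harmonic_on Omega (fun x => a * u x).
Proof.
move=> oO [Cu Lu]; split; first exact: C_onZ.
move=> x Ox; rewrite -[RHS](mulr0 a) -(Lu x Ox).
rewrite /laplacian mulr_sumr; apply: eq_bigr => i _.
have E : {in Omega, partial i (fun y => a * u y) =1 (fun y => a * partial i u y)}.
  by move=> y; rewrite inE => Oy; rewrite (partialZ a (C_on_derivable Cu Oy)).
rewrite (partial_eq i oO E Ox).2 (partialZ _ _)//.
exact: C_on_derivable (C_on_partial i Cu) Ox.
Qed.

Lemma harmonicB Omega u v : open Omega -> harmonic_on Omega u -> harmonic_on Omega v ->
  harmonic_on Omega (fun x => u x - v x).
Proof.
move=> oO Hu Hv; apply: (harmonic_eq oO _ (harmonicD oO Hu (harmonicZ (-1) oO Hv))).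
by move=> x _; rewrite mulN1r.
Qed.

Lemma harmonic_sum m Omega (u_ : 'I_m -> 'rV[R]_n -> R) : open Omega ->
  (forall k, harmonic_on Omega (u_ k)) -> harmonic_on Omega (fun x => \sum_k u_ k x).
Proof.
move=> oO; elim: m u_ => [|m IH] u_ H.
  by apply: (harmonic_eq oO _ (harmonic_cst _ 0)) => x _; rewrite big_ord0.
have IH' := IH (fun k => u_ (widen_ord (leqnSn m) k)) (fun k => H _).
apply: (harmonic_eq oO _ (harmonicD oO IH' (H ord_max))).
by move=> x _; rewrite big_ord_recr.
Qed.

Lemma harmonic_shift Omega Omega' u (a : 'rV[R]_n) : open Omega' ->
  (forall x, Omega' x -> Omega (x + a)) -> harmonic_on Omega u ->
  harmonic_on Omega' (fun y => u (y + a)).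
Proof.
move=> oO OO [Cu Lu]; split; first exact: C_on_shift Cu.
move=> x Ox; rewrite -(Lu _ (OO _ Ox)); apply: eq_bigr => i _.
have E : {in Omega', partial i (fun y => u (y + a)) =1 (fun y => partial i u (y + a))}.
  by move=> y; rewrite inE => /OO Oy; rewrite (partial_shift (C_on_derivable Cu Oy)).
rewrite (partial_eq i oO E Ox).2 (partial_shift _)//.
exact: C_on_derivable (C_on_partial i Cu) (OO _ Ox).
Qed.

Lemma is_derive_bigsum m (u_ : 'I_m -> 'rV[R]_n -> R) x (w : 'rV[R]_n) (d_ : 'I_m -> R) :
  (forall k, is_derive x w (u_ k) (d_ k)) ->
  is_derive x w (fun y => \sum_k u_ k y) (\sum_k d_ k).
Proof.
elim: m u_ d_ => [|m IH] u_ d_ H.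
  rewrite big_ord0; under eq_fun do rewrite big_ord0; exact: is_derive_cst.
rewrite big_ord_recr/=; under eq_fun do rewrite big_ord_recr/=.
pose p := widen_ord (leqnSn m).
exact: (is_deriveD (IH (u_ \o p) (d_ \o p) (fun k => H (p k))) (H ord_max)).
Qed.

Lemma sum_lin3 (p : R) (a b c : 'I_n -> R) : \sum_k a k = 0 -> \sum_k b k = 0 ->
  \sum_k (p * a k - p * b k - c k) = - \sum_k c k.
Proof.
by move=> a0 b0; rewrite !sumrB -!mulr_sumr a0 b0 !mulr0 subr0 sub0r.
Qed.

(* The odd part of [u] in the direction [i] is compared on a half cube with the
   superharmonic barrier M/d^2 (|y-x|^2 + (n+1) s (d - s)), s = y_i - x_i. *)
Lemma odd_part_bound Omega u x i (d M t : R) : open Omega -> harmonic_on Omega u ->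
  0 < d -> 0 < M ->
  (forall y, (forall j, `|y ord0 j - x ord0 j| <= d) -> Omega y /\ `|u y| <= M) ->
  0 < t <= d ->
  u (x + t *: e i) - u (x - t *: e i) <= 2 * (n.+1%:R * M / d) * t.
Proof.
move=> oO [Cu Lu] d0 M0 H /andP[t0 td].
(* Reflection in the hyperplane through [x] orthogonal to the direction [i]. *)
pose r y := y - (2 * (y ord0 i - x ord0 i)) *: e i.
have rE y j : r y ord0 j - x ord0 j =
    if j == i then - (y ord0 j - x ord0 j) else y ord0 j - x ord0 j.
  by rewrite /r -scaleNr shiftE; case: eqVneq => [->|_]; rewrite /=; ring.
pose psi y := M / d ^+ 2 * (\sum_j (y ord0 j - x ord0 j) ^+ 2 +
   (n.+1%:R * d) * (y ord0 i - x ord0 i) - n.+1%:R * (y ord0 i - x ord0 i) ^+ 2).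
(* Odd part minus barrier. The factor n+1 in [psi] makes the Laplacian of [psi] equal to -2M/d^2, so
   that of [E] is positive. *)
pose E y := 2^-1 * u y - 2^-1 * u (r y) - psi y.
pose K := [set y : 'rV[R]_n | forall j, (if j == i then x ord0 j else x ord0 j - d) <= y ord0 j <= x ord0 j + d].
have Kd y : K y -> forall j, `|y ord0 j - x ord0 j| <= d.
  move=> Ky j; have := Ky j; case: ifP => _ /andP[h1 h2];
  by rewrite ler_norml; apply/andP; split; lra.
have Krd y : K y -> forall j, `|r y ord0 j - x ord0 j| <= d.
  by move=> Ky j; rewrite rE; case: ifP => _; rewrite ?normrN; exact: Kd.
have jpsi y : jet psi y (fun k => M / d ^+ 2 * (2 * (y ord0 k - x ord0 k) +
     (n.+1%:R * d) * (i == k)%:R - n.+1%:R * (2 * (y ord0 i - x ord0 i) * (i == k)%:R)))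
   (fun k => M / d ^+ 2 * (2 - n.+1%:R * 2 * (i == k)%:R)).
  pose cj j := jetB (jet_coord j y) (jet_cst (x ord0 j) y).
  have := jetZ (M / d ^+ 2) (jetB (jetD (jet_sum (fun j => jet_sqr (cj j)))
     (jetZ (n.+1%:R * d) (cj i))) (jetZ (n.+1%:R) (jet_sqr (cj i)))).
  move/jet_eq; apply => k; congr (_ * _).
    rewrite (bigD1 k)//= eqxx big1 ?addr0 => [|j /negbTE ->]; last by rewrite subr0 mulr0.
    by rewrite !subr0 mulr1.
  rewrite (bigD1 k)//= eqxx big1 ?addr0 => [|j /negbTE ->].
    by case: (i == k); rewrite !subr0 /=; ring.
  by rewrite !subr0; ring.
have jE y : K y -> exists b c, jet E y b c /\ \sum_k c k > 0.
  move=> Ky; have [Oy _] := H _ (Kd _ Ky); have [Ory _] := H _ (Krd _ Ky).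
  have jr : jet (fun y => u (r y)) y
      (fun k => if k == i then - partial k u (r y) else partial k u (r y))
      (fun k => partial k (partial k u) (r y)).
    move=> k; have J := C2_jet oO Cu Ory k; case: eqVneq => ki; last first.
      suff -> : (fun s => u (r (y + s *: e k))) = (fun s => u (r y + s *: e k)) by [].
      apply/funext => s; congr u; rewrite /r shiftE eq_sym (negbTE ki) mulr0 addr0.
      by rewrite addrAC.
    suff -> : (fun s => u (r (y + s *: e k))) = (fun s => u (r y + (- s) *: e k)).
      exact: (jet2_opp J).
    apply/funext => s; congr u; rewrite ki /r shiftE eqxx mulr1 -!addrA; congr (_ + _).
    by apply/rowP => j; rewrite !mxE; ring.
  have J := jetB (jetB (jetZ 2^-1 (C2_jet oO Cu Oy)) (jetZ 2^-1 jr)) (jpsi y).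
  eexists; eexists; split; first exact: J.
  rewrite (sum_lin3 _ _ (Lu _ Oy) (Lu _ Ory)).
  rewrite -mulr_sumr oppr_gt0 pmulr_rlt0; last by rewrite divr_gt0// exprn_gt0.
  have E1 : \sum_k (i == k)%:R = 1 :> R.
    by rewrite (bigD1 i)//= eqxx big1 ?addr0// => k; rewrite eq_sym => /negbTE ->.
  rewrite sumrB -mulr_sumr E1 mulr1.
  rewrite sumr_const card_ord -[2 *+ n]mulr_natr.
  by rewrite -natr1; lra.
have cpsi y : {for y, continuous psi}.
  have S : C_on 0 setT psi.
    have oT := @openT 'rV[R]_n.
    have cc j : C_on 0 setT (fun y : 'rV[R]_n => y ord0 j - x ord0 j).
      by apply: C_onD => //; [exact: C_on_coord|exact: C_on_cst].
    have cN (a : R) g : C_on 0 setT g -> C_on 0 setT (fun y : 'rV[R]_n => - (a * g y)).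
      by move=> Hg; apply: (C_on_eq oT _ (C_onZ (- a) oT Hg)) => z _; rewrite mulNr.
    apply: C_onZ => //; apply: C_onD => //; last by apply: cN; apply: C_onM.
    apply: C_onD => //; last exact: C_onZ.
    by apply: C_on_sum => // k; apply: C_onM.
  exact: S.
have cE y : K y -> {for y, continuous E}.
  move=> Ky; have [Oy _] := H _ (Kd _ Ky); have [Ory _] := H _ (Krd _ Ky).
  have cu := C_on_continuous oO Cu Oy; have cru := C_on_continuous oO Cu Ory.
  have cr : {for y, continuous (fun y => u (r y))}.
    apply/continuous_cube => a a0; move/continuous_cube: cru => /(_ a a0)[k k0 Hk].
    exists k => // z yz; apply: Hk => j.
    have -> : r z ord0 j - r y ord0 j = (r z ord0 j - x ord0 j) - (r y ord0 j - x ord0 j) by ring.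
    rewrite !rE; case: ifP => _; have := yz j; last by rewrite opprB subrKA.
    by rewrite -normrN; congr (`| _ | < _); ring.
  apply: continuousB; last exact: cpsi.
  by apply: continuousB; apply: continuousM => //; exact: cst_continuous.
have Kt : K (x + t *: e i).
  by move=> j; rewrite shiftE; case: ifP => ji; rewrite ?mulr1 ?mulr0; apply/andP; split; lra.
have [y Ky ymax] : exists2 y, K y & forall z, K z -> E z <= E y.
  by apply: compact_argmax => //; [exact: compact_cbox|exists (x + t *: e i)].
have psi_ge (z : 'rV[R]_n) : K z -> 0 <= psi z /\
    ((exists j, `|z ord0 j - x ord0 j| = d) -> M <= psi z).
  move=> Kz; pose s := z ord0 i - x ord0 i.
  have sd : 0 <= s <= d by have := Kz i; rewrite eqxx /s => /andP[? ?]; apply/andP; split; lra.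
  have q0 : 0 <= n.+1%:R * d * s - n.+1%:R * s ^+ 2 :> R.
    have -> : n.+1%:R * d * s - n.+1%:R * s ^+ 2 = n.+1%:R * (s * (d - s)) by ring.
    by case/andP: sd => s0 sd; rewrite mulr_ge0// mulr_ge0// subr_ge0.
  have S0 : 0 <= \sum_j (z ord0 j - x ord0 j) ^+ 2 by apply: sumr_ge0 => j _; exact: sqr_ge0.
  have Md : 0 < M / d ^+ 2 by rewrite divr_gt0// exprn_gt0.
  rewrite /psi -/s -addrA; split.
    by apply: mulr_ge0; [exact: ltW|exact: addr_ge0].
  move=> [j zj]; rewrite -[leLHS](@divfK _ (d ^+ 2)) ?gt_eqF ?exprn_gt0//.
  rewrite ler_pM2l// -[leLHS]addr0 lerD// (bigD1 j)//= -[leLHS]addr0 lerD//.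
    by rewrite -zj real_normK// num_real.
  by apply: sumr_ge0 => k _; exact: sqr_ge0.
(* A positive maximum is excluded on the faces at distance [d], where [psi] is at least [M]; on the
   face fixed by [r], where the odd part vanishes; and inside, by the sign of the Laplacian. *)
have Ey0 : E y <= 0.
  rewrite leNgt; apply/negP => Ey.
  have [p0 pM] := psi_ge y Ky.
  have [_ uy] := H _ (Kd _ Ky); have [_ ury] := H _ (Krd _ Ky).
  have yd j : `|y ord0 j - x ord0 j| < d.
    rewrite lt_neqAle (Kd _ Ky) andbT; apply/eqP => yj.
    have Mp : M <= psi y by apply: pM; exists j.
    move: Ey; rewrite /E; move: uy ury => /ler_normlP[? ?] /ler_normlP[? ?]; lra.
  have yi : x ord0 i < y ord0 i.
    have := Ky i; rewrite eqxx => /andP[yi _]; rewrite lt_neqAle yi andbT; apply/eqP => xy.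
    move: Ey; rewrite /E.
    have -> : r y = y by apply/rowP => j; rewrite /r -scaleNr shiftE xy; ring.
    lra.
  have [b [c [J c0]]] := jE y Ky.
  have [|_ cle] := jet_max_lap J; last by move: c0; rewrite ltNge cle.
  have [k k0 Hk] : exists2 k : R, 0 < k & forall j z, cube y k z ->
     (if j == i then x ord0 j else x ord0 j - d) <= z ord0 j <= x ord0 j + d.
    apply: cube_forall => j.
    have h1 : 0 < d - `|y ord0 j - x ord0 j| by rewrite subr_gt0.
    have h2 : 0 < y ord0 i - x ord0 i by rewrite subr_gt0.
    have [k [k0 k1 k2]] := lt_two h1 h2; exists k => // z yz.
    have := yz j; have := ler_norm (y ord0 j - x ord0 j); have := ler_norm (- (y ord0 j - x ord0 j)).
    rewrite normrN => h3 h4; rewrite ltr_norml => /andP[h5 h6].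
    case: eqVneq => ji; last by apply/andP; split; lra.
    by rewrite -ji in k2; apply/andP; split; lra.
  by exists k => // z yz; apply: ymax => j; exact: Hk.
have := le_trans (ymax _ Kt) Ey0; rewrite /E.
have -> : r (x + t *: e i) = x - t *: e i.
  by apply/rowP => j; rewrite /r !mxE !eqxx/=; case: (j == i) => /=; ring.
have -> : psi (x + t *: e i) = M / d ^+ 2 * (n.+1%:R * d * t - n%:R * t ^+ 2).
  rewrite /psi (bigD1 i)//= big1 ?addr0 => [|j /negbTE ji]; last first.
    by rewrite shiftE ji mulr0 addr0 subrr expr0n.
  have -> : (x + t *: e i) ord0 i - x ord0 i = t by rewrite shiftE eqxx mulr1 [_ + t]addrC addrK.
  rewrite -[n.+1%:R]natr1.
  by move: (n%:R) => k; ring.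
move=> h.
have : M / d ^+ 2 * (n.+1%:R * d * t - n%:R * t ^+ 2) <= n.+1%:R * M / d * t.
  have -> : n.+1%:R * M / d * t = M / d ^+ 2 * (n.+1%:R * d * t) by field; rewrite gt_eqF.
  rewrite ler_pM2l ?divr_gt0 ?exprn_gt0// gerBl mulr_ge0// sqr_ge0//.
lra.
Qed.

(** The symmetric difference quotient at [x] tends to the partial derivative, and [odd_part_bound]
    bounds it by (n+1)M/d whatever the step. *)
Lemma gradient_bound Omega u x i (d M : R) : open Omega -> harmonic_on Omega u ->
  0 < d -> 0 < M ->
  (forall y, (forall j, `|y ord0 j - x ord0 j| <= d) -> Omega y /\ `|u y| <= M) ->
  `|partial i u x| <= n.+1%:R * M / d.
Proof.
have main v : open Omega -> harmonic_on Omega v -> 0 < d -> 0 < M ->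
  (forall y, (forall j, `|y ord0 j - x ord0 j| <= d) -> Omega y /\ `|v y| <= M) ->
  partial i v x <= n.+1%:R * M / d.
  move=> oO Hv d0 M0 H; apply/ler_addgt0Pl => a a0.
  have Ox : Omega x by have [] := H x; first by move=> j; rewrite subrr normr0 ltW.
  have := C_on_derivable (i := i) (proj1 Hv) Ox => dv.
  have /is_derive_eps/(_ a a0)[D D0 HD] : is_derive x (e i) v (partial i v x) by [].
  have [t [t0 tD td]] := lt_two D0 d0.
  have := @odd_part_bound _ v x i d M t oO Hv d0 M0 H; rewrite t0 (ltW td) => /(_ isT) h.
  have := HD t; rewrite gtr0_norm// => /(_ tD) /ler_normlP[h1 h2].
  have := HD (- t); rewrite normrN gtr0_norm// => /(_ tD) /ler_normlP[h3 h4].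
  rewrite scaleNr in h3 h4.
  rewrite -(ler_pM2r t0); lra.
move=> oO Hu d0 M0 H; apply/ler_normlP; split; last exact: main.
have Ox : Omega x by have [] := H x; first by move=> j; rewrite subrr normr0 ltW.
rewrite -mulN1r -(partialZ (-1) (C_on_derivable (proj1 Hu) Ox)).
apply: (main _ oO (harmonicZ (-1) oO Hu) d0 M0).
by move=> y /H[Oy uy]; rewrite mulN1r normrN.
Qed.

(** At this stage the first derivatives of [u] are not known to be twice differentiable, so the
    gradient bound is applied to difference quotients of [u], which are harmonic. Two applications
    with radius d/4 produce the factor (4(n+1))^2/d^2. *)
Lemma hessian_bound Omega u x i j (d M : R) : open Omega -> harmonic_on Omega u ->
  0 < d -> 0 < M -> (forall y, cube x d y -> Omega y /\ `|u y| <= M) ->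
  `|partial i (partial j u) x| <= (4 * n.+1%:R) ^+ 2 * M / d ^+ 2.
Proof.
move=> oO Hu d0 M0 H; have [Cu _] := Hu.
have M'0 : 0 < n.+1%:R * M / (d / 4) by rewrite divr_gt0 ?mulr_gt0// divr_gt0.
have pj y : cube x (d / 2) y -> `|partial j u y| <= n.+1%:R * M / (d / 4).
  move=> xy; apply: (gradient_bound _ oO Hu) => //; first by rewrite divr_gt0.
  move=> z yz; apply: H => k.
  have -> : z ord0 k - x ord0 k = (z ord0 k - y ord0 k) + (y ord0 k - x ord0 k) by ring.
  by have := yz k; have := xy k; have := ler_normD (z ord0 k - y ord0 k) (y ord0 k - x ord0 k); lra.
have cub (t : R) y : `|t| < d / 4 -> cube x (d / 2) y -> cube x d (y + t *: e j).
  move=> t0 xy; apply: (@cube_sub _ _ _ (d / 2 + d / 4)); first by lra.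
  by apply: (cube_trans xy); exact: cube_shift.
have Ox : Omega x by have [] := H x (cube_center _ d0).
have D2 : is_derive x (e j) (partial i u) (partial j (partial i u) x).
  by split => //; exact: (C_on_derivable (C_on_partial i Cu)).
rewrite (partialC _ _ oO Cu Ox); apply/ler_addgt0Pl => a a0.
have /(_ a a0)[D D0 HD] := (is_derive_eps _ _ _ _).1 D2.
have d40 : 0 < d / 4 by rewrite divr_gt0.
have [t [t0 tD td]] := lt_two D0 d40.
pose v y := t^-1 * (u (y + t *: e j) - u y).
have oC := @cube_is_open R n x (d / 2).
have CO : cube x (d / 2) `<=` Omega.
  by move=> y xy; apply: (H y _).1; apply: cube_sub xy; lra.
have tdn : `|t| < d / 4 by rewrite gtr0_norm.
have Hs : harmonic_on (cube x (d / 2)) (fun y => u (y + t *: e j)).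
  apply: (harmonic_shift oC _ Hu) => y xy.
  exact: (H _ (cub t y tdn xy)).1.
have Hv : harmonic_on (cube x (d / 2)) v.
  exact: (harmonicZ _ oC (harmonicB oC Hs (harmonic_sub CO Hu))).
have := @gradient_bound _ v x i (d / 4) (n.+1%:R * M / (d / 4)) oC Hv d40 M'0.
have xc : cube x (d / 2) x by apply: cube_center; lra.
have Cs := Hs.1; have CuC := C_on_sub CO Cu.
have -> : partial i v x = t^-1 * (partial i u (x + t *: e j) - partial i u x).
  have dus := C_on_derivable (i := i) Cs xc; have du := C_on_derivable (i := i) CuC xc.
  rewrite /v (partialZ _ (derivableBf dus du)) (partialB dus du).
  by rewrite (partial_shift (C_on_derivable Cu (H _ (cub t x tdn xc)).1)).
have bv y : (forall k, `|y ord0 k - x ord0 k| <= d / 4) ->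
    cube x (d / 2) y /\ `|v y| <= n.+1%:R * M / (d / 4).
  move=> xy; have cy : cube x (d / 2) y by move=> k; have := xy k; lra.
  split => //; have [|c ct E] := @mvt_line _ _ u y j t.
    move=> s st; apply: (C_on_derivable Cu); apply: (H _ _).1.
    exact: (cub s y (le_lt_trans st tdn) cy).
  rewrite /v E mulrCA mulVf ?gt_eqF// mulr1; apply: pj => k.
  have := @cube_shift _ _ y j c (d / 4) (le_lt_trans ct tdn) k.
  have -> : (y + c *: e j) ord0 k - x ord0 k = ((y + c *: e j) ord0 k - y ord0 k) + (y ord0 k - x ord0 k) by ring.
  have := xy k; have := ler_normD ((y + c *: e j) ord0 k - y ord0 k) (y ord0 k - x ord0 k).
  lra.
move=> /(_ bv) h.
have := HD t; rewrite gtr0_norm// => /(_ tD) h2.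
have -> : (4 * n.+1%:R) ^+ 2 * M / d ^+ 2 = n.+1%:R * (n.+1%:R * M / (d / 4)) / (d / 4).
  by field; rewrite gt_eqF.
have E : partial j (partial i u) x = t^-1 * (partial i u (x + t *: e j) - partial i u x) -
   t^-1 * (partial i u (x + t *: e j) - partial i u x - partial j (partial i u) x * t).
  by field; rewrite gt_eqF.
rewrite E (le_trans (ler_normB _ _))// addrC lerD//.
by rewrite normrM gtr0_norm ?invr_gt0// mulrC ler_pdivrMr.
Qed.

Lemma bounded_on_cube u x (d : R) : (forall y, (forall k, `|y ord0 k - x ord0 k| <= d) ->
  {for y, continuous u}) -> 0 < d ->
  exists2 B : R, 0 < B & forall y, (forall k, `|y ord0 k - x ord0 k| <= d) -> `|u y| <= B.
Proof.
move=> cu d0.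
have KE (y : 'rV[R]_n) : (forall i, x ord0 i - d <= y ord0 i <= x ord0 i + d) <->
    (forall k, `|y ord0 k - x ord0 k| <= d).
  by split=> H k; have := H k; rewrite ler_distl.
have cK := @compact_cbox R n (fun i => x ord0 i - d) (fun i => x ord0 i + d).
have [||c _ Hc] := @compact_argmax R n _ (fun y => `|u y|) cK.
- by exists x => i; apply/andP; split; lra.
- move=> y /KE/cu/continuous_cube H; apply/continuous_cube => a a0.
  have [k k0 Hk] := H a a0; exists k => // z /Hk.
  exact: le_lt_trans (ler_dist_dist _ _).
exists (`|u c| + 1) => [|y /KE/Hc h]; first by rewrite ltr_wpDl.
by rewrite (le_trans h)// lerDl.
Qed.

(** The intervals with centre q t and radius C|t| meet pairwise; the supremum of their left ends
    belongs to all of them. *)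
Lemma cauchy_quotient (q : R -> R) (C tau : R) : 0 < tau ->
  (forall t s, 0 < `|t| < tau -> 0 < `|s| < tau -> `|q t - q s| <= C * (`|t| + `|s|)) ->
  exists L, forall t, 0 < `|t| < tau -> `|q t - L| <= C * `|t|.
Proof.
move=> tau0 H; pose A := [set q t - C * `|t| | t in [set t | 0 < `|t| < tau]].
have A0 : A !=set0.
  exists (q (tau / 2) - C * `|tau / 2|); exists (tau / 2) => //=.
  by rewrite gtr0_norm ?divr_gt0//; lra.
have ubA s : 0 < `|s| < tau -> ubound A (q s + C * `|s|).
  move=> Hs _ [t /= Ht <-]; have /ler_normlP[_] := H t s Ht Hs; lra.
have hA : has_sup A.
  split => //; exists (q (tau / 2) + C * `|tau / 2|); apply: ubA.
  by rewrite gtr0_norm ?divr_gt0//; lra.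
exists (sup A) => t Ht; apply/ler_normlP; split.
  have : sup A <= q t + C * `|t| by apply: ge_sup => //; exact: ubA.
  lra.
have : q t - C * `|t| <= sup A by apply: ub_le_sup; [exact: hA.2|exists t].
lra.
Qed.

(** Difference quotients of the Hessian are Hessians of difference quotients of [u]. By Taylor's
    formula the latter form a Cauchy family near [x], uniformly and at the rate |t| + |s|, and
    [hessian_bound] transfers this rate to the former. *)
Lemma third_derivative Omega u x a b i : open Omega -> harmonic_on Omega u -> Omega x ->
  derivable (partial a (partial b u)) x (e i) /\
  {for x, continuous (partial i (partial a (partial b u)))}.
Proof.
move=> oO Hu Ox; have [Cu _] := Hu.
have [d' d'0 Hd'] := open_cube oO Ox.
pose d := d' / 4; have d0 : 0 < d by rewrite divr_gt0.
pose h := partial a (partial b u).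
have [B B0 HB] : exists2 B : R, 0 < B & forall y, (forall k, `|y ord0 k - x ord0 k| <= 3 * d) ->
    `|partial i (partial i u) y| <= B.
  apply: bounded_on_cube; last by rewrite mulr_gt0.
  move=> y xy; have [_ +] := (C_on_partial i Cu) i; apply; apply: Hd' => k.
  by have := xy k; rewrite /d; move: d'0; clear; lra.
pose C := (4 * n.+1%:R) ^+ 2 * B / d ^+ 2.
have inO y (t : R) : cube x (2 * d) y -> `|t| < d -> Omega (y + t *: e i).
  move=> xy td; apply: Hd'; apply: (@cube_sub _ _ _ (2 * d + d)); first by rewrite /d; move: d'0; clear; lra.
  by apply: cube_trans xy _; exact: cube_shift.
have in3 y (t : R) : cube x (2 * d) y -> `|t| < d ->
    forall k, `|(y + t *: e i) ord0 k - x ord0 k| <= 3 * d.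
  move=> xy td k.
  have := @cube_trans _ _ _ _ _ (2 * d) d xy (@cube_shift _ _ y i t d td) k.
  by clear; lra.
have quot y (t : R) : cube x (2 * d) y -> 0 < `|t| < d ->
    `|t^-1 * (u (y + t *: e i) - u y) - partial i u y| <= B * `|t|.
  move=> xy /andP[t0 td]; have tn0 : t != 0 by rewrite -normr_gt0.
  have [s st|c ct ->] := @mvt_line _ _ u y i t.
    exact: (C_on_derivable Cu (inO _ _ xy (le_lt_trans st td))).
  rewrite mulrCA mulVf// mulr1.
  have [s st|c' ct' ->] := @mvt_line _ _ (partial i u) y i c.
    apply: (C_on_derivable (C_on_partial i Cu)); apply: inO xy _.
    exact: le_lt_trans (le_trans st ct) td.
  rewrite normrM ler_pM//; apply: HB; apply: in3 => //.
  exact: le_lt_trans (le_trans ct' ct) td.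
have HC y (t s : R) : cube x d y -> 0 < `|t| < d -> 0 < `|s| < d ->
    `|t^-1 * (h (y + t *: e i) - h y) - s^-1 * (h (y + s *: e i) - h y)| <= C * (`|t| + `|s|).
  move=> xy Ht Hs; have [t0 td] := andP Ht; have [s0 sd] := andP Hs.
  pose v (r : R) z := r^-1 * (u (z + r *: e i) - u z).
  have oC := @cube_is_open R n x (2 * d).
  have CO : cube x (2 * d) `<=` Omega.
    by move=> z xz; apply: Hd'; apply: cube_sub xz; rewrite /d; move: d'0; clear; lra.
  have Hsh (r : R) : `|r| < d -> harmonic_on (cube x (2 * d)) (fun z => u (z + r *: e i)).
    by move=> rd; apply: (harmonic_shift oC _ Hu) => z xz; exact: inO.
  have Hv (r : R) : `|r| < d -> harmonic_on (cube x (2 * d)) (v r).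
    by move=> rd; exact: (harmonicZ _ oC (harmonicB oC (Hsh r rd) (harmonic_sub CO Hu))).
  have c2 : cube x (2 * d) y by apply: cube_sub xy; move: d0; clear; lra.
  have pv (r : R) : `|r| < d -> partial a (partial b (v r)) y = r^-1 * (h (y + r *: e i) - h y).
    move=> rd.
    have pw z k (w : 'rV[R]_n -> R) :
        C_on 1 Omega w -> cube x (2 * d) z ->
        partial k (fun z => r^-1 * (w (z + r *: e i) - w z)) z =
          r^-1 * (partial k w (z + r *: e i) - partial k w z).
      move=> Cw xz.
      have dw : derivable w z (e k) by apply: (C_on_derivable Cw); exact: CO.
      have dws : derivable w (z + r *: e i) (e k) by apply: (C_on_derivable Cw); exact: inO.
      have dsw := derivable_shift dws.
      by rewrite (partialZ _ (derivableBf dsw dw)) (partialB dsw dw) partial_shift.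
    have E1 : {in cube x (2 * d), partial b (v r) =1
       (fun z => r^-1 * (partial b u (z + r *: e i) - partial b u z))}.
      move=> z; rewrite inE => xz; apply: pw xz; exact: C_onS.
    rewrite (partial_eq a oC E1 c2).2; apply: pw c2; exact: C_on_partial.
  have Hvv := harmonicB oC (Hv t td) (Hv s sd).
  have Bts : 0 < B * (`|t| + `|s|) by rewrite mulr_gt0// addr_gt0.
  have := @hessian_bound _ (fun z => v t z - v s z) y a b d (B * (`|t| + `|s|)) oC Hvv d0 Bts.
  have E2 : partial a (partial b (fun z => v t z - v s z)) y =
     partial a (partial b (v t)) y - partial a (partial b (v s)) y.
    have Ct := (Hv t td).1; have Cs := (Hv s sd).1.
    have E3 z : cube x (2 * d) z -> forall k w w', C_on 1 (cube x (2 * d)) w ->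
        C_on 1 (cube x (2 * d)) w' ->
        partial k (fun z => w z - w' z) z = partial k w z - partial k w' z.
      move=> xz k w w' Cw Cw'.
      have dw : derivable w z (e k) by exact: (C_on_derivable Cw).
      have dw' : derivable w' z (e k) by exact: (C_on_derivable Cw').
      exact: partialB.
    have E4 : {in cube x (2 * d), partial b (fun z => v t z - v s z) =1
       (fun z => partial b (v t) z - partial b (v s) z)}.
      by move=> z; rewrite inE => xz; apply: E3 => //; exact: C_onS.
    by rewrite (partial_eq a oC E4 c2).2; apply: E3 => //; exact: C_on_partial.
  rewrite E2 !pv// => H; apply: le_trans (H _) _; last first.
    rewrite [leLHS](_ : _ = C * (`|t| + `|s|)); first exact: lexx.
    by rewrite /C; ring.
  move=> z yz; have xz : cube x (2 * d) z.
    by apply: cube_sub (cube_trans xy yz); clear; lra.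
  split => //.
  have -> : v t z - v s z = (v t z - partial i u z) - (v s z - partial i u z) by ring.
  by rewrite (le_trans (ler_normB _ _))// mulrDr lerD//; exact: quot.
have HL y : cube x d y -> exists L : R, forall t : R, 0 < `|t| < d ->
    `|t^-1 * (h (y + t *: e i) - h y) - L| <= C * `|t|.
  by move=> xy; apply: cauchy_quotient => // t s; exact: HC.
have C0 : 0 < C by rewrite divr_gt0 ?mulr_gt0 ?exprn_gt0// mulr_gt0.
have dh y (L : R) : (forall t : R, 0 < `|t| < d -> `|t^-1 * (h (y + t *: e i) - h y) - L| <= C * `|t|) ->
    is_derive y (e i) h L.
  move=> H; apply/is_derive_eps => k k0.
  have kC : 0 < k / C by rewrite divr_gt0.
  have [D [D0 Dk Dd]] := lt_two kC d0; exists D => // t tD.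
  have [->|t0] := eqVneq t 0; first by rewrite scale0r addr0 subrr mulr0 subr0 normr0 mulr0.
  have -> : h (y + t *: e i) - h y - L * t = (t^-1 * (h (y + t *: e i) - h y) - L) * t.
    by move: (h _) (h y) => A A'; rewrite mulrBl mulrAC mulVf// mul1r.
  rewrite normrM ler_wpM2r//; apply: le_trans (H t _) _.
    by rewrite normr_gt0 t0 (lt_trans tD).
  by rewrite -ler_pdivlMl// mulrC ltW// (lt_trans tD).
have dhp y : cube x d y -> is_derive y (e i) h (partial i h y) /\
    forall t : R, 0 < `|t| < d -> `|t^-1 * (h (y + t *: e i) - h y) - partial i h y| <= C * `|t|.
  by move=> /HL[L HLy]; have [H1 H2] := dh y L HLy; split; [split|rewrite /partial H2].
split; first by have [[]] := dhp x (cube_center x d0).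
(* Near [x], [partial i h] is the uniform limit of difference quotients of [h], which are
   continuous; one fixed step [t] with C t < k/4 splits the error into three parts. *)
have ch y : Omega y -> {for y, continuous h}.
  by have [_ +] := (C_on_partial b Cu) a; apply.
apply/continuous_cube => k k0.
have k4 : 0 < k / 4 / C by rewrite divr_gt0// divr_gt0.
have [t [t0 tk td]] := lt_two k4 d0.
have tk0 : 0 < k / 4 * t by rewrite mulr_gt0// divr_gt0.
have tn : 0 < `|t| < d by rewrite gtr0_norm// t0.
have [D1 D10 HD1] := (continuous_cube _ _).1 (ch x Ox) _ tk0.
have Oxt : Omega (x + t *: e i).
  by apply: inO; [apply: cube_center; rewrite mulr_gt0|rewrite gtr0_norm].
have [D2 D20 HD2] := (continuous_cube _ _).1 (ch _ Oxt) _ tk0.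
have [D3 [D30 D31 D32]] := lt_two D10 D20.
have [D [D0 DD3 Dd]] := lt_two D30 d0.
exists D => // y xy.
have xy' : cube x d y by apply: cube_sub xy; exact: ltW.
have /ler_normlP[h1 h2] := (dhp y xy').2 t tn.
have /ler_normlP[h3 h4] := (dhp x (cube_center x d0)).2 t tn.
have h5 : `|h y - h x| < k / 4 * t by apply: HD1; apply: cube_sub xy; rewrite ltW// (lt_trans DD3).
have h6 : `|h (y + t *: e i) - h (x + t *: e i)| < k / 4 * t.
  apply: HD2 => j; have := xy j; rewrite !mxE opprD addrACA subrr addr0 => /lt_trans; apply.
  exact: lt_trans DD3 _.
have h7 : C * `|t| < k / 4 by rewrite gtr0_norm// mulrC -ltr_pdivlMr.
rewrite -/h; move: h1 h2 h3 h4 h5 h6 h7.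
move: (h (y + _)) (h y) (h (x + _)) (h x) (partial i h y) (partial i h x) => A1 A2 A3 A4 p q.
move=> h1 h2 h3 h4 h5 h6 h7.
have : `|t^-1 * (A1 - A2) - t^-1 * (A3 - A4)| < k / 2.
  rewrite -mulrBr normrM gtr0_norm ?invr_gt0// mulrC ltr_pdivrMr//.
  have -> : A1 - A2 - (A3 - A4) = (A1 - A3) - (A2 - A4) by ring.
  apply: le_lt_trans (ler_normB _ _) _.
  by move: h5 h6; clear; lra.
move=> /ltr_normlP[h8 h9].
apply/ltr_normlP; split; move: h1 h2 h3 h4 h7 h8 h9; clear; lra.
Qed.

Lemma partial_bigsum m (u_ : 'I_m -> 'rV[R]_n -> R) x i :
  (forall k, derivable (u_ k) x (e i)) ->
  partial i (fun y => \sum_k u_ k y) x = \sum_k partial i (u_ k) x.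
Proof.
move=> H; have [_ E] : is_derive x (e i) (fun y => \sum_k u_ k y) (\sum_k partial i (u_ k) x).
  by apply: is_derive_bigsum => k; split.
exact: E.
Qed.

(** Iteration makes harmonic functions smooth. Once third derivatives exist and are continuous,
    partial derivatives commute with the Laplacian. *)
Theorem harmonic_partial Omega u i : open Omega -> harmonic_on Omega u ->
  harmonic_on Omega (partial i u).
Proof.
move=> oO Hu; have [Cu Lu] := Hu.
have C2 : C_on 2 Omega (partial i u).
  move=> j; split; first by move=> x Ox; exact: (C_on_derivable (C_on_partial i Cu)).
  by move=> k; split=> x Ox; have [] := third_derivative j i k oO Hu Ox.
split; first exact: C2.
move=> x Ox.
have E : {in Omega, laplacian u =1 (fun=> 0)} by move=> y; rewrite inE; exact: Lu.
have := (partial_eq i oO E Ox).2; rewrite partial_cst.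
rewrite {1}/laplacian partial_bigsum; last first.
  by move=> k; have [] := third_derivative k k i oO Hu Ox.
move=> <-; apply: eq_bigr => k _.
have E2 : {in Omega, partial k (partial i u) =1 partial i (partial k u)}.
  by move=> y; rewrite inE => Oy; exact: partialC oO Cu Oy.
rewrite (partial_eq k oO E2 Ox).2; apply: (partialC _ _ oO _ Ox).
move=> j; split; first by move=> y Oy; exact: (C_on_derivable (C_on_partial k Cu)).
by move=> l; split=> y Oy; have [] := third_derivative j k l oO Hu Oy.
Qed.

End Harmonic.

(** * The Hessian determinant of a harmonic function *)

Section SymmetricMatrices.
Context {R : realType}.
Implicit Types (A H N Q : 'M[R]_3) (v w : 'rV[R]_3).

Lemma sum3 (V : nmodType) (F : 'I_3 -> V) :
  \sum_i F i = F 0 + F 1 + F (2%:R : 'I_3).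
Proof.
rewrite !big_ord_recl big_ord0 addr0 addrA; congr (_ + _ + _); congr F;
by apply: val_inj.
Qed.

Definition dot n (v w : 'rV[R]_n) : R := \sum_i v ord0 i * w ord0 i.

Lemma dotC n (v w : 'rV[R]_n) : dot v w = dot w v.
Proof. by apply: eq_bigr => i _; rewrite mulrC. Qed.

Lemma dotDl n (u v w : 'rV[R]_n) : dot (u + v) w = dot u w + dot v w.
Proof. by rewrite -big_split; apply: eq_bigr => i _; rewrite mxE mulrDl. Qed.

Lemma dotZl n (a : R) (v w : 'rV[R]_n) : dot (a *: v) w = a * dot v w.
Proof. by rewrite mulr_sumr; apply: eq_bigr => i _; rewrite mxE mulrA. Qed.

Lemma dotDr n (u v w : 'rV[R]_n) : dot w (u + v) = dot w u + dot w v.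
Proof. by rewrite dotC dotDl !(dotC _ w). Qed.

Lemma dotZr n (a : R) (v w : 'rV[R]_n) : dot w (a *: v) = a * dot w v.
Proof. by rewrite dotC dotZl dotC. Qed.

Lemma dot_ge0 n (v : 'rV[R]_n) : 0 <= dot v v.
Proof. by apply: sumr_ge0 => i _; rewrite -expr2 sqr_ge0. Qed.

Lemma dotE n (v w : 'rV[R]_n) : dot v w = (v *m w^T) ord0 ord0.
Proof. by rewrite mxE; apply: eq_bigr => i _; rewrite mxE. Qed.

Lemma dot_mulmx n (v w : 'rV[R]_n) (A : 'M[R]_n) : dot (v *m A) w = dot v (w *m A^T).
Proof. by rewrite !dotE trmx_mul trmxK mulmxA. Qed.

Lemma dot_coord_le n (v : 'rV[R]_n) i : v ord0 i ^+ 2 <= dot v v.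
Proof.
by rewrite /dot (bigD1 i)//= -expr2 lerDl sumr_ge0// => j _; rewrite -expr2 sqr_ge0.
Qed.

Lemma dot_eq0 n (v : 'rV[R]_n) : dot v v = 0 -> v = 0.
Proof.
move=> v0; apply/rowP => i; rewrite mxE; apply/eqP; rewrite -sqrf_eq0.
by rewrite eq_le sqr_ge0 andbT -v0 dot_coord_le.
Qed.

Lemma continuous_sum n m (F : 'I_m -> 'rV[R]_n -> R) (x : 'rV[R]_n) :
  (forall i, {for x, continuous (F i)}) ->
  {for x, continuous (fun y => \sum_i F i y)}.
Proof.
elim: m F => [|m IH] F cF.
  have -> : (fun y => \sum_i F i y) = (fun=> 0) by apply/funext => y; rewrite big_ord0.
  exact: cst_continuous.
pose w := widen_ord (leqnSn m).
have -> : (fun y => \sum_i F i y) = (fun y => \sum_i (F \o w) i y + F ord_max y).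
  by apply/funext => y; rewrite big_ord_recr.
by apply: continuousD; [apply: IH => i; exact: cF|exact: cF].
Qed.

Lemma continuous_dot n (F G : 'rV[R]_n -> 'rV[R]_n) (x : 'rV[R]_n) :
  (forall i, {for x, continuous (fun y => F y ord0 i)}) ->
  (forall i, {for x, continuous (fun y => G y ord0 i)}) ->
  {for x, continuous (fun y => dot (F y) (G y))}.
Proof.
move=> cF cG; apply: continuous_sum => i.
by apply: continuousM; [exact: cF|exact: cG].
Qed.

Lemma unit_argmax A (S : set 'rV[R]_3) : closed S -> (exists v, S v /\ dot v v = 1) ->
  exists2 v, S v /\ dot v v = 1 & forall w, S w -> dot w w = 1 ->
    dot (w *m A) w <= dot (v *m A) v.
Proof.
move=> cS [v0 [Sv0 v01]].
have cc i (x : 'rV[R]_3) : {for x, continuous (fun y : 'rV[R]_3 => y ord0 i)}.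
  exact: coord_continuous.
have cq : continuous (fun v : 'rV[R]_3 => dot (v *m A) v).
  move=> x; apply: continuous_dot => // i.
  have -> : (fun y : 'rV[R]_3 => (y *m A) ord0 i) = (fun y => \sum_j y ord0 j * A j i).
    by apply/funext => y; rewrite mxE.
  apply: continuous_sum => j.
  by apply: continuousM; [exact: cc|exact: cst_continuous].
pose K := S `&` [set v : 'rV[R]_3 | dot v v = 1].
have cK : compact K.
  apply: bounded_closed_compact.
    exists 1; split; first exact: num_real.
    move=> M M1 v [_ /= v1]; rewrite [leLHS]/Num.norm/= mx_normrE; apply/bigmax_leP; split.
      by rewrite ltW// (lt_trans ltr01).
    move=> [i j] _; rewrite (ord1 i)/= ltW// (le_lt_trans _ M1)//.
    by rewrite -(@ler_pXn2r _ 2)// ?nnegrE// expr1n real_normK ?num_real// -v1 dot_coord_le.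
  apply: closedI => //.
  apply: (@closed_comp _ _ (fun v : 'rV[R]_3 => dot v v) [set 1]).
    by move=> x _; apply: continuous_dot.
  exact: closed_eq.
have [|c [Sc c1] Hc] := @compact_argmax R 3 K _ cK _ (fun x _ => cq x).
  by exists v0.
by exists c => // w Sw w1; exact: Hc.
Qed.

(** Along v + s f the inequality reads 2Bs <= Ms^2 for every s, with [B] the quantity to be shown
    zero; near 0 a quadratic term cannot dominate a linear one. *)
Lemma argmax_orth A v f : A^T = A -> dot v v = 1 -> dot v f = 0 ->
  (forall s : R, dot ((v + s *: f) *m A) (v + s *: f) <=
     dot (v *m A) v * dot (v + s *: f) (v + s *: f)) ->
  dot (v *m A) f = 0.
Proof.
move=> As v1 vf H.
pose B := dot (v *m A) f; pose C := dot (f *m A) f; pose q := dot (v *m A) v.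
have fv : dot (f *m A) v = B by rewrite dot_mulmx As dotC.
have E s : s * (2 * B) <= s ^+ 2 * (q * dot f f - C).
  have := H s; rewrite mulmxDl -scalemxAl !(dotDl, dotDr, dotZl, dotZr) fv (dotC f v) vf v1.
  rewrite -/B -/C -/q; lra.
set M := q * _ - C in E.
apply/eqP; rewrite -/B; apply: contraT => B0.
have M0 : 0 < `|M| + 1 by rewrite ltr_wpDl.
(* For this s the left side is twice B^2/(|M|+1), the right side at most once. *)
have := E (B / (`|M| + 1)).
have -> : B / (`|M| + 1) * (2 * B) = 2 * (B ^+ 2 / (`|M| + 1)) by field; rewrite gt_eqF.
have -> : (B / (`|M| + 1)) ^+ 2 * M = B ^+ 2 / (`|M| + 1) * (M / (`|M| + 1)) by field; rewrite gt_eqF.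
have B2 : 0 < B ^+ 2 / (`|M| + 1) by rewrite divr_gt0// exprn_even_gt0.
rewrite mulrC ler_pM2l//.
have : M / (`|M| + 1) <= 1 by rewrite ler_pdivrMr// mul1r (le_trans (ler_norm _))// lerDl.
lra.
Qed.

Definition cross v w : 'rV[R]_3 := \row_i
  if i == 0 then v ord0 1 * w ord0 2%:R - v ord0 2%:R * w ord0 1
  else if i == 1 then v ord0 2%:R * w ord0 0 - v ord0 0 * w ord0 2%:R
  else v ord0 0 * w ord0 1 - v ord0 1 * w ord0 0.

Lemma crossE v w : [/\ cross v w ord0 0 = v ord0 1 * w ord0 2%:R - v ord0 2%:R * w ord0 1,
  cross v w ord0 1 = v ord0 2%:R * w ord0 0 - v ord0 0 * w ord0 2%:R &
  cross v w ord0 2%:R = v ord0 0 * w ord0 1 - v ord0 1 * w ord0 0].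
Proof. by split; rewrite mxE. Qed.

Lemma exists_orth v : exists w, dot v w = 0 /\ dot w w = 1.
Proof.
suff [w vw w0] : exists2 w, dot v w = 0 & dot w w != 0.
  exists ((Num.sqrt (dot w w))^-1 *: w); rewrite !(dotZl, dotZr) vw mulr0; split => //.
  rewrite mulrA -expr2 exprVn sqr_sqrtr ?dot_ge0// mulVf//.
pose a := v ord0 0; pose b := v ord0 1; pose c := v ord0 2%:R.
have [ab|ab] := eqVneq (a ^+ 2 + b ^+ 2) 0.
  exists (\row_i (i == 0)%:R); rewrite /dot !sum3 !mxE/=; last by rewrite !mulr0 mulr1 !addr0 oner_eq0.
  have a0 : a = 0.
    by apply/eqP; rewrite -sqrf_eq0 eq_le sqr_ge0 andbT; have := sqr_ge0 b; lra.
  by rewrite -/a a0; ring.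
exists (\row_i (if i == 0 then - b else if i == 1 then a else 0)).
  by rewrite /dot sum3 !mxE/= -/a -/b; ring.
rewrite /dot sum3 !mxE/=; apply: contra ab => /eqP ab; apply/eqP; rewrite -ab; ring.
Qed.

(** The spectral theorem in dimension three: [v1] maximizes the quadratic form on the unit sphere,
    [v2] on the unit circle orthogonal to [v1], and [v3] is their cross product. By [argmax_orth]
    the off-diagonal entries vanish in this basis. *)
Lemma orthogonal_diag A : A^T = A -> exists Q (l : 'rV[R]_3),
  [/\ Q *m Q^T = 1%:M, Q^T *m Q = 1%:M & A = Q^T *m diag_mx l *m Q].
Proof.
move=> As.
have [v1 [_ v11] max1] : exists2 v, setT v /\ dot v v = 1 & forall w, setT w -> dot w w = 1 ->
    dot (w *m A) w <= dot (v *m A) v.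
  by apply: unit_argmax; [exact: closedT|have [w [_ w1]] := exists_orth 0; exists w].
have [v2 [v12 v22] max2] : exists2 v, dot v1 v = 0 /\ dot v v = 1 &
    forall w, dot v1 w = 0 -> dot w w = 1 -> dot (w *m A) w <= dot (v *m A) v.
  apply: (@unit_argmax A [set w | dot v1 w = 0]); last exact: exists_orth.
  apply: (@closed_comp _ _ (fun v : 'rV[R]_3 => dot v1 v) [set 0]); last exact: closed_eq.
  move=> x _; apply: continuous_dot => i; [exact: cst_continuous|exact: coord_continuous].
pose v3 := cross v1 v2.
have [c0 c1 c2] := crossE v1 v2.
have d3 w : dot w v3 = w ord0 0 * (v1 ord0 1 * v2 ord0 2%:R - v1 ord0 2%:R * v2 ord0 1)
   + w ord0 1 * (v1 ord0 2%:R * v2 ord0 0 - v1 ord0 0 * v2 ord0 2%:R)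
   + w ord0 2%:R * (v1 ord0 0 * v2 ord0 1 - v1 ord0 1 * v2 ord0 0).
  by rewrite /dot sum3 c0 c1 c2.
have v13 : dot v1 v3 = 0 by rewrite d3; ring.
have v23 : dot v2 v3 = 0 by rewrite d3; ring.
have v33 : dot v3 v3 = 1.
  rewrite d3 c0 c1 c2.
  transitivity (dot v1 v1 * dot v2 v2 - dot v1 v2 ^+ 2); last by rewrite v11 v22 v12; ring.
  by rewrite /dot !sum3; ring.
have norm_max v (S : 'rV[R]_3 -> Prop) : (forall (a : R) w, S w -> S (a *: w)) ->
   (forall w, S w -> dot w w = 1 -> dot (w *m A) w <= dot (v *m A) v) ->
   forall w, S w -> dot (w *m A) w <= dot (v *m A) v * dot w w.
  move=> Sz H w Sw; have [w0|w0] := eqVneq (dot w w) 0.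
    by rewrite w0 mulr0 (dot_eq0 w0) mul0mx /dot big1// => i _; rewrite mxE mul0r.
  have wp : 0 < dot w w by rewrite lt_neqAle eq_sym w0 dot_ge0.
  have ww : (Num.sqrt (dot w w))^-1 * (Num.sqrt (dot w w))^-1 = (dot w w)^-1.
    by rewrite -expr2 exprVn sqr_sqrtr// ltW.
  have := H ((Num.sqrt (dot w w))^-1 *: w) (Sz _ _ Sw).
  have -> : dot ((Num.sqrt (dot w w))^-1 *: w) ((Num.sqrt (dot w w))^-1 *: w) = 1.
    by rewrite dotZl dotZr mulrA ww mulVf.
  have -> : dot ((Num.sqrt (dot w w))^-1 *: w *m A) ((Num.sqrt (dot w w))^-1 *: w) =
      (dot w w)^-1 * dot (w *m A) w.
    by rewrite -scalemxAl dotZl dotZr mulrA ww.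
  by move=> /(_ erefl); rewrite ler_pdivrMl// mulrC.
have o1 f : dot v1 f = 0 -> dot (v1 *m A) f = 0.
  move=> vf; apply: argmax_orth => // s.
  exact: (norm_max v1 (fun _ => True)).
have a12 := o1 _ v12; have a13 := o1 _ v13.
have a23 : dot (v2 *m A) v3 = 0.
  apply: argmax_orth => // s.
  apply: (norm_max v2 (fun w => dot v1 w = 0)) => //.
    by move=> a w vw; rewrite dotZr vw mulr0.
  by rewrite dotDr dotZr v12 v13 mulr0 addr0.
pose r (i : 'I_3) := if i == 0 then v1 else if i == 1 then v2 else v3.
pose Q : 'M[R]_3 := \matrix_(i, j) r i ord0 j.
have QE (B : 'M[R]_3) i j : (Q *m B *m Q^T) i j = dot (r i *m B) (r j).
  rewrite !mxE; apply: eq_bigr => k _; rewrite !mxE; congr (_ * _).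
  by apply: eq_bigr => l _; rewrite mxE.
have QQ : Q *m Q^T = 1%:M.
  apply/matrixP => i j; rewrite -[Q in Q *m _]mulmx1 QE mulmx1 mxE.
  have I3 (k : 'I_3) : [\/ k = 0, k = 1 | k = 2%:R].
    case: k => [[|[|[|//]]] Hk]; [apply: Or31|apply: Or32|apply: Or33]; exact: val_inj.
  case: (I3 i) => ->; case: (I3 j) => ->; rewrite /r/= ?v11 ?v22 ?v33 ?v12 ?v13 ?v23//;
  by rewrite dotC ?v12 ?v13 ?v23.
have QQ' : Q^T *m Q = 1%:M by exact: mulmx1C.
exists Q, (\row_i dot (r i *m A) (r i)); split => //.
have -> : diag_mx (\row_i dot (r i *m A) (r i)) = Q *m A *m Q^T.
  apply/matrixP => i j; rewrite QE !mxE.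
  have I3 (k : 'I_3) : [\/ k = 0, k = 1 | k = 2%:R].
    case: k => [[|[|[|//]]] Hk]; [apply: Or31|apply: Or32|apply: Or33]; exact: val_inj.
  have sA v w : dot (v *m A) w = dot (w *m A) v by rewrite dot_mulmx As dotC.
  case: (I3 i) => ->; case: (I3 j) => ->; rewrite /r/= ?mulr1n ?mulr0n// ?a12 ?a13 ?a23//;
  by rewrite sA ?a12 ?a13 ?a23.
by rewrite !mulmxA QQ' mul1mx -mulmxA QQ' mulmx1.
Qed.

Lemma dot_rot Q v : Q^T *m Q = 1%:M -> dot (v *m Q^T) (v *m Q^T) = dot v v.
Proof. by move=> QQ; rewrite dot_mulmx trmxK -mulmxA QQ mulmx1. Qed.

Lemma mxtrace_rot Q A : Q^T *m Q = 1%:M -> \tr (Q *m A *m Q^T) = \tr A.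
Proof. by move=> QQ; rewrite mxtrace_mulC mulmxA QQ mul1mx. Qed.

(** In an eigenbasis, three times each squared eigenvalue is at most twice the sum of the squares:
    if a + b + c = 0 then 2(a^2 + b^2 + c^2) - 3a^2 = (b - c)^2. The trace condition is what
    improves the factor 1 to 2/3. *)
Lemma refined_kato A v : A^T = A -> \tr A = 0 ->
  3 * dot (v *m A) (v *m A) <= 2 * (\sum_i \sum_j A i j ^+ 2) * dot v v.
Proof.
move=> As trA; have [Q [l [QQ' QQ AE]]] := orthogonal_diag As.
pose w := v *m Q^T.
have vw : dot v v = dot w w by rewrite dot_rot.
have vA : dot (v *m A) (v *m A) = dot (w *m diag_mx l) (w *m diag_mx l).
  rewrite -(dot_rot (v *m A) QQ) AE !mulmxA -/w -!mulmxA QQ' mulmx1 -/w.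
  by rewrite /w !mulmxA.
have sA : \sum_i \sum_j A i j ^+ 2 = \sum_i l ord0 i ^+ 2.
  have -> : \sum_i \sum_j A i j ^+ 2 = \tr (A *m A).
    apply: eq_bigr => i _; rewrite mxE; apply: eq_bigr => j _.
    by rewrite -[in A j i]As mxE expr2.
  rewrite AE -!mulmxA [Q *m _]mulmxA QQ' mul1mx mxtrace_mulC -!mulmxA QQ' mulmx1.
  rewrite mul_diag_mx /mxtrace; apply: eq_bigr => i _.
  by rewrite !mxE eqxx mulr1n expr2.
have trl : \sum_i l ord0 i = 0.
  by apply: etrans trA; rewrite AE mxtrace_mulC mulmxA QQ' mul1mx mxtrace_diag.
have wl : dot (w *m diag_mx l) (w *m diag_mx l) = \sum_i (w ord0 i * l ord0 i) ^+ 2.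
  by rewrite mul_mx_diag; apply: eq_bigr => i _; rewrite mxE expr2.
rewrite vA vw sA wl /dot; move: trl; rewrite !sum3.
move: (l ord0 0) (l ord0 1) (l ord0 2%:R) (w ord0 0) (w ord0 1) (w ord0 2%:R) => a b c x y z abc.
have -> : a = - (b + c) by lra.
rewrite -subr_ge0.
set p := _ - _; have -> : p = (b - c) ^+ 2 * x ^+ 2 + (b + c + c) ^+ 2 * y ^+ 2 + (b + b + c) ^+ 2 * z ^+ 2.
  by rewrite /p; ring.
by rewrite !addr_ge0// mulr_ge0// sqr_ge0.
Qed.

(* By Cayley-Hamilton this is the adjugate of [H] when [\tr H = 0]. *)
Definition adj0 H : 'M[R]_3 := H *m H - (2^-1 * \tr (H *m H))%:M.

(* [H] and [T k] stand for the Hessian of a harmonic function of three variables and for its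
   k-th partial derivative.  In a basis diagonalizing [H] the trace form becomes a sum of
   three squares. *)
Lemma adj0_form_ge0 H (T : 'I_3 -> 'M[R]_3) : H^T = H -> \tr H = 0 ->
  (forall i j k, T k i j = T k j i) -> (forall i j k, T k i j = T i k j) ->
  (forall k, \tr (T k) = 0) ->
  0 <= \sum_k \tr (adj0 H *m T k *m (adj0 H *m T k)).
Proof.
move=> Hs trH Ts1 Ts2 Ttr; set N := adj0 H.
have [Q [l [QQ' QQ HE]]] := orthogonal_diag Hs.
(* Since the eigenvalues of [H] sum to 0, each entry of [nu] is the product of the two other
   eigenvalues. *)
pose nu : 'rV[R]_3 := \row_i (l ord0 i ^+ 2 - 2^-1 * \sum_j l ord0 j ^+ 2).
have HH : H *m H = Q^T *m diag_mx (\row_i l ord0 i ^+ 2) *m Q.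
  rewrite HE -!mulmxA [Q *m (_ *m _)]mulmxA QQ' mul1mx !mulmxA; congr (_ *m Q).
  rewrite -mulmxA; congr (_ *m _); rewrite mul_diag_mx; apply/matrixP => i j.
  by rewrite !mxE; case: (i == j); rewrite ?mulr1n ?mulr0n ?mulr0// expr2.
have trHH : \tr (H *m H) = \sum_j l ord0 j ^+ 2.
  rewrite HH mxtrace_mulC mulmxA QQ' mul1mx mxtrace_diag.
  by apply: eq_bigr => i _; rewrite mxE.
have NE : N = Q^T *m diag_mx nu *m Q.
  have -> : diag_mx nu = diag_mx (\row_i l ord0 i ^+ 2) - (2^-1 * \tr (H *m H))%:M.
    apply/matrixP => i j; rewrite trHH !mxE; case: (i == j); rewrite ?mulr1n// !mulr0n subr0//.
  rewrite mulmxBr mulmxBl -HH /N /adj0; congr (_ - _).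
  by rewrite mul_mx_scalar -scalemxAl QQ scalemx1.
have trl : l ord0 0 + l ord0 1 + l ord0 2%:R = 0.
  by apply: etrans trH; rewrite -sum3 HE mxtrace_mulC mulmxA QQ' mul1mx mxtrace_diag.
pose X k := Q *m T k *m Q^T.
have E1 k : \tr (N *m T k *m (N *m T k)) = \sum_a \sum_b nu ord0 a * nu ord0 b * X k a b ^+ 2.
  have -> : N *m T k *m (N *m T k) = Q^T *m (diag_mx nu *m X k *m (diag_mx nu *m X k)) *m Q.
    rewrite NE /X -!mulmxA; do 5 congr (_ *m _).
    by rewrite QQ mulmx1.
  rewrite mxtrace_mulC [Q *m (Q^T *m _)]mulmxA QQ' mul1mx /mxtrace; apply: eq_bigr => a _.
  rewrite mxE; apply: eq_bigr => b _.
  have DE i j : (diag_mx nu *m X k) i j = nu ord0 i * X k i j by rewrite mul_diag_mx mxE.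
  have XT : (X k)^T = X k.
    rewrite /X !trmx_mul trmxK mulmxA; congr (_ *m _ *m _).
    by apply/matrixP => i j; rewrite mxE Ts1.
  rewrite !DE; have -> : X k b a = X k a b by rewrite -[X k in LHS]XT [LHS]mxE.
  by ring.
(* The tensor [T] in the eigenbasis of [H]; it stays totally symmetric and trace-free. *)
pose t a b c := \sum_k X k a b * Q c k.
have E2 a b : \sum_k X k a b ^+ 2 = \sum_c t a b c ^+ 2.
  have := dot_rot (\row_k X k a b) QQ; rewrite /dot.
  under eq_bigr do rewrite -expr2 mxE.
  move=> E; rewrite [RHS](_ : _ = \sum_k (\row_k X k a b) ord0 k * (\row_k X k a b) ord0 k); last first.
    rewrite -E; apply: eq_bigr => c _; congr (_ ^+ 2); rewrite /t.
    by apply: eq_bigr => k _; rewrite !mxE.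
  by apply: eq_bigr => k _; rewrite mxE expr2.
have tE a b c : t a b c = \sum_i \sum_j \sum_k T k i j * Q a i * Q b j * Q c k.
  rewrite /t; under eq_bigr => k _.
    rewrite /X !mxE; under eq_bigr do rewrite !mxE mulr_suml.
    rewrite exchange_big mulr_suml; under eq_bigr do rewrite mulr_suml; over.
  rewrite exchange_big; apply: eq_bigr => i _; rewrite exchange_big; apply: eq_bigr => j _.
  by apply: eq_bigr => k _; ring.
have ts1 a b c : t a b c = t b a c.
  rewrite !tE exchange_big; apply: eq_bigr => i _; apply: eq_bigr => j _; apply: eq_bigr => k _.
  by rewrite Ts1; ring.
have ts2 a b c : t a b c = t c b a.
  rewrite !tE; under eq_bigr do rewrite exchange_big.
  rewrite exchange_big; apply: eq_bigr => i _.
  rewrite exchange_big/=; apply: eq_bigr => j _; apply: eq_bigr => k _.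
  by rewrite Ts2; ring.
have ttr c : t 0 0 c + t 1 1 c + t 2%:R 2%:R c = 0.
  rewrite -(sum3 (fun a => t a a c)) /t exchange_big big1// => k _.
  rewrite -mulr_suml -/(mxtrace (X k)) /X mxtrace_rot// Ttr mul0r//.
have -> : \sum_k \tr (N *m T k *m (N *m T k)) =
    \sum_a \sum_b nu ord0 a * nu ord0 b * \sum_c t a b c ^+ 2.
  under eq_bigr do rewrite E1.
  rewrite exchange_big; apply: eq_bigr => a _; rewrite exchange_big; apply: eq_bigr => b _.
  by rewrite -mulr_sumr E2.
(* Symmetry leaves ten entries and the traces remove three. The square of [t 0 1 2%:R] appears with
   a multiple of abc(a + b + c) = 0, where a, b, c are the eigenvalues of [H]. *)
have e100 : t 1 0 0 = t 0 0 1 by exact: ts2.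
have e010 : t 0 1 0 = t 0 0 1 by rewrite ts1.
have e200 : t 2%:R 0 0 = t 0 0 2%:R by exact: ts2.
have e020 : t 0 2%:R 0 = t 0 0 2%:R by rewrite ts1.
have e101 : t 1 0 1 = t 0 1 1 by exact: ts1.
have e110 : t 1 1 0 = t 0 1 1 by exact: ts2.
have e202 : t 2%:R 0 2%:R = t 0 2%:R 2%:R by exact: ts1.
have e220 : t 2%:R 2%:R 0 = t 0 2%:R 2%:R by exact: ts2.
have e102 : t 1 0 2%:R = t 0 1 2%:R by exact: ts1.
have e210 : t 2%:R 1 0 = t 0 1 2%:R by exact: ts2.
have e120 : t 1 2%:R 0 = t 0 1 2%:R by rewrite ts1.
have e021 : t 0 2%:R 1 = t 0 1 2%:R by rewrite ts2.
have e201 : t 2%:R 0 1 = t 0 1 2%:R by rewrite ts1.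
have e211 : t 2%:R 1 1 = t 1 1 2%:R by exact: ts2.
have e121 : t 1 2%:R 1 = t 1 1 2%:R by rewrite ts1.
have e212 : t 2%:R 1 2%:R = t 1 2%:R 2%:R by exact: ts1.
have e221 : t 2%:R 2%:R 1 = t 1 2%:R 2%:R by exact: ts2.
have := ttr 2%:R; have := ttr 1; have := ttr 0.
rewrite !sum3 /nu !mxE !sum3.
rewrite e100 e010 e200 e020 e101 e110 e202 e220 e102 e210 e120 e021 e201 e211 e121 e212 e221.
move: (t 0 0 0) (t 1 1 1) (t 2%:R 2%:R 2%:R) (t 0 0 1) (t 0 0 2%:R) (t 0 1 1) (t 1 1 2%:R)
  (t 0 2%:R 2%:R) (t 1 2%:R 2%:R) (t 0 1 2%:R) trl.
move: (l ord0 0) (l ord0 1) (l ord0 2%:R) => a b c.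
move=> t0 t1 t2 p q r s u v w abc E0 E1' E2'.
have -> : a = - (b + c) by lra.
have -> : t0 = - (r + u) by lra.
have -> : t1 = - (p + v) by lra.
have -> : t2 = - (q + s) by lra.
rewrite [leRHS](_ : _ = (c ^+ 2 * r + b ^+ 2 * u) ^+ 2 + (c ^+ 2 * p + (b + c) ^+ 2 * v) ^+ 2 +
   (b ^+ 2 * q + (b + c) ^+ 2 * s) ^+ 2); last by field.
by rewrite !addr_ge0// sqr_ge0.
Qed.

Definition det3 (u v w : 'I_3 -> R) : R :=
  u 0 * (v 1 * w 2%:R - v 2%:R * w 1) - u 1 * (v 0 * w 2%:R - v 2%:R * w 0)
  + u 2%:R * (v 0 * w 1 - v 1 * w 0).

Lemma det_det3 A : \det A = det3 (A 0) (A 1) (A 2%:R).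
Proof.
have d2 (B : 'M[R]_2) : \det B = B 0 0 * B 1 1 - B 0 1 * B 1 0.
  rewrite (expand_det_row _ 0) !big_ord_recl big_ord0 /cofactor !det_mx11 !mxE.
  have e0 : lift (0 : 'I_2) (0 : 'I_1) = 1 by exact: val_inj.
  have e1 : lift (1 : 'I_2) (0 : 'I_1) = 0 by exact: val_inj.
  by rewrite !e0 !e1 /=; ring.
rewrite (expand_det_row _ 0) sum3 /cofactor !d2 !mxE /det3 /=.
have l01 : lift (0 : 'I_3) (0 : 'I_2) = 1 by exact: val_inj.
have l02 : lift (0 : 'I_3) (1 : 'I_2) = 2%:R by exact: val_inj.
have l10 : lift (1 : 'I_3) (0 : 'I_2) = 0 by exact: val_inj.
have l12 : lift (1 : 'I_3) (1 : 'I_2) = 2%:R by exact: val_inj.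
have l20 : lift (2%:R : 'I_3) (0 : 'I_2) = 0 by exact: val_inj.
have l21 : lift (2%:R : 'I_3) (1 : 'I_2) = 1 by exact: val_inj.
rewrite l01 l02 l10 l12 l20 l21; ring.
Qed.

(* [b] and [c] stand for the first and second derivatives of the rows of a matrix. *)
Definition ddet3 (a b : 'I_3 -> 'I_3 -> R) : R :=
  det3 (b 0) (a 1) (a 2%:R) + det3 (a 0) (b 1) (a 2%:R) + det3 (a 0) (a 1) (b 2%:R).

Definition dddet3 (a b c : 'I_3 -> 'I_3 -> R) : R :=
  ddet3 a c + 2 * (det3 (b 0) (b 1) (a 2%:R) + det3 (b 0) (a 1) (b 2%:R) + det3 (a 0) (b 1) (b 2%:R)).

(** [ddet3] is linear in its second argument, so for harmonic entries their second derivatives drop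
    out of the Laplacian of the determinant. *)
Lemma ddet3_sum0 (a : 'I_3 -> 'I_3 -> R) (c : 'I_3 -> 'I_3 -> 'I_3 -> R) :
  (forall i j, \sum_k c k i j = 0) -> \sum_k ddet3 a (c k) = 0.
Proof.
move=> L; rewrite sum3 /ddet3 /det3.
have L' i j : c 2%:R i j = - (c 0 i j + c 1 i j).
  by have := L i j; rewrite sum3 => E; lra.
by rewrite !L'; ring.
Qed.

Lemma jet2N (f : R -> R) (p q : R) : jet2 f p q -> jet2 (fun t => - f t) (- p) (- q).
Proof.
move=> Hf; have -> : (fun t => - f t) = (fun t => (-1) * f t).
  by apply/funext => t; rewrite mulN1r.
by apply: jet2_eq (jet2M (jet2_cst (-1)) Hf) _ _; ring.
Qed.

Lemma jet2_det3 (h : 'I_3 -> 'I_3 -> R -> R) (b c : 'I_3 -> 'I_3 -> R) :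
  (forall i j, jet2 (h i j) (b i j) (c i j)) ->
  jet2 (fun t => det3 (fun j => h 0 j t) (fun j => h 1 j t) (fun j => h 2%:R j t))
    (ddet3 (fun i j => h i j 0) b) (dddet3 (fun i j => h i j 0) b c).
Proof.
move=> H.
have minor j k := jet2D (jet2M (H 1 j) (H 2%:R k)) (jet2N (jet2M (H 1 k) (H 2%:R j))).
have := jet2D (jet2D (jet2M (H 0 0) (minor 1 2%:R)) (jet2N (jet2M (H 0 1) (minor 0 2%:R))))
   (jet2M (H 0 2%:R) (minor 0 1)).
by move/jet2_eq; apply; rewrite /dddet3 /ddet3 /det3; ring.
Qed.

(** The second derivative of ln det (H + sT) at s = 0 is -tr((H^-1 T)^2). Multiplied by (det H)^2 it
    becomes a polynomial identity, which holds for singular [H] as well. *)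
Lemma det3_adj0 H (T : 'M[R]_3) : H^T = H -> \tr H = 0 -> T^T = T -> \tr T = 0 ->
  det3 (H 0) (H 1) (H 2%:R) *
    (2 * (det3 (T 0) (T 1) (H 2%:R) + det3 (T 0) (H 1) (T 2%:R) + det3 (H 0) (T 1) (T 2%:R)))
  - (ddet3 H T) ^+ 2 = - \tr (adj0 H *m T *m (adj0 H *m T)).
Proof.
move=> Hs trH Ts trT.
have H10 : H 1 0 = H 0 1 by rewrite -[in LHS]Hs mxE.
have H20 : H 2%:R 0 = H 0 2%:R by rewrite -[in LHS]Hs mxE.
have H21 : H 2%:R 1 = H 1 2%:R by rewrite -[in LHS]Hs mxE.
have T10 : T 1 0 = T 0 1 by rewrite -[in LHS]Ts mxE.
have T20 : T 2%:R 0 = T 0 2%:R by rewrite -[in LHS]Ts mxE.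
have T21 : T 2%:R 1 = T 1 2%:R by rewrite -[in LHS]Ts mxE.
have H22 : H 2%:R 2%:R = - (H 0 0 + H 1 1).
  by move: trH; rewrite /mxtrace sum3 => E; lra.
have T22 : T 2%:R 2%:R = - (T 0 0 + T 1 1).
  by move: trT; rewrite /mxtrace sum3 => E; lra.
have NE i j : adj0 H i j = H i 0 * H 0 j + H i 1 * H 1 j + H i 2%:R * H 2%:R j
   - (2^-1 * (H 0 0 ^+ 2 + H 1 1 ^+ 2 + H 2%:R 2%:R ^+ 2 + 2 * H 0 1 ^+ 2 + 2 * H 0 2%:R ^+ 2
      + 2 * H 1 2%:R ^+ 2)) *+ (i == j).
  rewrite /adj0 !mxE sum3; congr (_ - _ *+ _); congr (_ * _).
  rewrite /mxtrace sum3 !mxE !sum3 H10 H20 H21; ring.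
have ME i j : (adj0 H *m T) i j = adj0 H i 0 * T 0 j + adj0 H i 1 * T 1 j + adj0 H i 2%:R * T 2%:R j.
  by rewrite mxE sum3.
have -> : \tr (adj0 H *m T *m (adj0 H *m T)) =
   (adj0 H *m T) 0 0 ^+ 2 + (adj0 H *m T) 1 1 ^+ 2 + (adj0 H *m T) 2%:R 2%:R ^+ 2
   + 2 * ((adj0 H *m T) 0 1 * (adj0 H *m T) 1 0) + 2 * ((adj0 H *m T) 0 2%:R * (adj0 H *m T) 2%:R 0)
   + 2 * ((adj0 H *m T) 1 2%:R * (adj0 H *m T) 2%:R 1).
  move: (adj0 H *m T) => M; rewrite /mxtrace sum3 !mxE !sum3; ring.
rewrite !ME !NE /= ?mulr1n ?mulr0n !subr0 /ddet3 /det3 H10 H20 H21 T10 T20 T21 H22 T22.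
move: (H 0 0) (H 1 1) (H 0 1) (H 0 2%:R) (H 1 2%:R) (T 0 0) (T 1 1) (T 0 1) (T 0 2%:R) (T 1 2%:R).
by move=> a b c d e p q r s t; field.
Qed.

End SymmetricMatrices.

(** * Superharmonicity of the logarithm of the Hessian determinant *)

Section HarmonicHessian.
Context {R : realType}.
Implicit Types (Omega : set 'rV[R]_3) (h : 'I_3 -> 'I_3 -> 'rV[R]_3 -> R).

(** The Hessian of a harmonic function described without its potential, by conditions inherited by
    the leading Taylor terms of the entries. Symmetry and the Codazzi condition together make the
    first derivatives totally symmetric. *)
Record harmonic_hessian Omega h : Prop := HarmonicHessian {
  hess_open : open Omega;
  hess_harmonic : forall i j, harmonic_on Omega (h i j);
  hess_sym : forall i j x, Omega x -> h i j x = h j i x;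
  hess_trace : forall x, Omega x -> \sum_i h i i x = 0;
  hess_codazzi : forall i j k x, Omega x -> partial k (h i j) x = partial i (h k j) x }.

Definition hess_det h x : R := \det (\matrix_(i, j) h i j x).

Lemma hess_detE h x : hess_det h x =
  det3 (fun j => h 0 j x) (fun j => h 1 j x) (fun j => h 2%:R j x).
Proof. by rewrite /hess_det det_det3 /det3 !mxE. Qed.

(* Equivalently, [ln |hess_det h|] is superharmonic where [hess_det h] does not vanish. *)
Lemma hess_det_superharmonic Omega h x : harmonic_hessian Omega h -> Omega x ->
  exists b c, jet (hess_det h) x b c /\ hess_det h x * \sum_k c k <= \sum_k b k ^+ 2.
Proof.
move=> [oO Hh hs htr hc] Ox.
pose H : 'M[R]_3 := \matrix_(i, j) h i j x.
pose T (k : 'I_3) : 'M[R]_3 := \matrix_(i, j) partial k (h i j) x.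
pose a i j := h i j x; pose b k i j := partial k (h i j) x.
pose c k i j := partial k (partial k (h i j)) x.
exists (fun k => ddet3 a (b k)), (fun k => dddet3 a (b k) (c k)); split.
  move=> k.
  have := @jet2_det3 R (fun i j t => h i j (x + t *: basis_vec k)) (b k) (c k).
  have -> : (fun i j => h i j (x + 0 *: basis_vec k)) = a.
    by apply/funext => i; apply/funext => j; rewrite line0.
  have -> : (fun t : R => hess_det h (x + t *: basis_vec k)) = (fun t : R =>
      det3 (fun j => h 0 j (x + t *: basis_vec k)) (fun j => h 1 j (x + t *: basis_vec k))
        (fun j => h 2%:R j (x + t *: basis_vec k))).
    by apply/funext => t; rewrite hess_detE.
  by apply=> i j; exact: (C2_jet oO (Hh i j).1 Ox).
have Hs : H^T = H by apply/matrixP => i j; rewrite !mxE hs.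
have trH : \tr H = 0 by apply: etrans (htr x Ox); apply: eq_bigr => i _; rewrite mxE.
have Ts k : (T k)^T = T k.
  apply/matrixP => i j; rewrite !mxE.
  by apply: (partial_eq k oO _ Ox).2 => y; rewrite inE => Oy; exact: hs.
have trT k : \tr (T k) = 0.
  rewrite /mxtrace; under eq_bigr do rewrite mxE.
  rewrite -partial_bigsum => [|i]; last exact: (C_on_derivable (Hh i i).1).
  apply: etrans (partial_cst 0 k x).
  by apply: (partial_eq k oO _ Ox).2 => y; rewrite inE => Oy; exact: htr.
have Ts1 i j k : T k i j = T k j i by rewrite -[in LHS]Ts mxE.
have Ts2 i j k : T k i j = T i k j by rewrite !mxE; exact: hc.
have := adj0_form_ge0 Hs trH Ts1 Ts2 trT.
have HE i : H i = a i by apply/funext => j; rewrite mxE.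
have TE k i : T k i = b k i by apply/funext => j; rewrite mxE.
have E k : \tr (adj0 H *m T k *m (adj0 H *m T k)) = ddet3 a (b k) ^+ 2 -
  hess_det h x * dddet3 a (b k) (c k) + hess_det h x * ddet3 a (c k).
  have := det3_adj0 Hs trH (Ts k) (trT k); rewrite !HE !TE.
  have -> : ddet3 H (T k) = ddet3 a (b k).
    by rewrite /ddet3 !HE !TE.
  rewrite hess_detE /dddet3 -/(a 0) -/(a 1) -/(a 2%:R).
  by move: (\tr _) => S E; rewrite -[S]opprK -E; ring.
under eq_bigr do rewrite E.
rewrite big_split/= sumrB -!mulr_sumr.
have -> : \sum_k ddet3 a (c k) = 0.
  by apply: ddet3_sum0 => i j; exact: (Hh i j).2.
by rewrite mulr0 addr0 subr_ge0.
Qed.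

End HarmonicHessian.

(** * Weak derivatives of smooth functions *)

Section TupleMeasure.
Context {R : realType}.
Local Notation T := (measurableTypeR R).

Definition obox n (a b : 'I_n -> R) : set (n.-tuple T) :=
  [set t | forall i, a i < tnth t i < b i].

Lemma measurable_tnth_itv n (i : 'I_n) (I : interval R) :
  measurable [set t : n.-tuple T | tnth t i \in I].
Proof.
have := @measurable_tnth _ T n i measurableT [set` I] (measurable_itv I).
by rewrite setTI.
Qed.

Lemma measurable_obox n (a b : 'I_n -> R) : measurable (obox a b).
Proof.
have -> : obox a b = \bigcap_(i in [set: 'I_n]) [set t : n.-tuple T | tnth t i \in `]a i, b i[].
  apply/seteqP; split=> t /= H i; first by move=> _; rewrite /= in_itv; exact: H.
  by have := H i I; rewrite /= in_itv.
by apply: fin_bigcap_measurable => // i _; exact: measurable_tnth_itv.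
Qed.

Lemma tnth_cons_pair0 n (x : T) (t : n.-tuple T) : tnth (cons_pair (x, t)) ord0 = x.
Proof. by rewrite tnth0. Qed.

Lemma tnth_cons_pairS n (x : T) (t : n.-tuple T) i :
  tnth (cons_pair (x, t)) (lift ord0 i) = tnth t i.
Proof. by rewrite tnthS. Qed.

Lemma cons_pair_obox n (a b : 'I_n.+1 -> R) :
  @cons_pair R n @^-1` obox a b =
  `]a ord0, b ord0[ `*` obox (a \o lift ord0) (b \o lift ord0).
Proof.
apply/seteqP; split=> -[x t] /=.
  move=> H; split; first by have := H ord0; rewrite tnth_cons_pair0 in_itv.
  by move=> i; have := H (lift ord0 i); rewrite tnth_cons_pairS.
move=> [xab tab] i; case: (unliftP ord0 i) => [j ->|->].
  by rewrite tnth_cons_pairS; exact: tab.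
by rewrite tnth_cons_pair0; rewrite in_itv in xab.
Qed.

Lemma lebesgue_obox n (a b : 'I_n -> R) : (forall i, a i <= b i) ->
  lebesgue_tuple R n (obox a b) = (\prod_i (b i - a i))%:E.
Proof.
elim: n a b => [|n IH] a b ab.
  rewrite big_ord0 /= diracE mem_set//=; by case.
rewrite /= /lebesgue_step /pushforward cons_pair_obox.
rewrite product_measure1E//; last exact: measurable_obox.
rewrite IH => [|i]; last exact: ab.
rewrite big_ord_recl EFinM /= lebesgue_measure_itv/= lte_fin.
have := ab ord0; rewrite le_eqVlt => /orP[/eqP ->|->]; last by rewrite EFinB.
by rewrite ltxx subrr.
Qed.

Definition upd n (t : n.-tuple T) (i : 'I_n) (r : T) : n.-tuple T :=
  [tuple if j == i then r else tnth t j | j < n].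

Lemma upd_cons0 n (x r : T) (t : n.-tuple T) :
  upd (cons_pair (x, t)) ord0 r = cons_pair (r, t).
Proof.
apply: eq_from_tnth => j; rewrite tnth_mktuple.
case: (unliftP ord0 j) => [k ->|->]; last by rewrite eqxx tnth_cons_pair0.
by rewrite !tnth_cons_pairS eq_sym (negbTE (neq_lift _ _)).
Qed.

Lemma upd_consS n (x r : T) (t : n.-tuple T) i :
  upd (cons_pair (x, t)) (lift ord0 i) r = cons_pair (x, upd t i r).
Proof.
apply: eq_from_tnth => j; rewrite tnth_mktuple.
case: (unliftP ord0 j) => [k ->|->].
  by rewrite !tnth_cons_pairS tnth_mktuple (inj_eq lift_inj).
by rewrite !tnth_cons_pair0 (negbTE (neq_lift _ _)).
Qed.

Lemma bounded_supp_integrable d (X : measurableType d) (mu : {measure set X -> \bar R})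
    (A : set X) (f : X -> R) (M : R) : measurable A -> (mu A < +oo)%E ->
  measurable_fun setT f -> (forall x, `|f x| <= M) -> (forall x, ~ A x -> f x = 0) ->
  mu.-integrable setT (EFin \o f).
Proof.
move=> mA Afin mf fM f0.
have -> : EFin \o f = (EFin \o f) \_ A.
  apply/funext => x; rewrite patchE; case: ifPn => //= /negP xA.
  by rewrite f0// => Ax; apply: xA; rewrite inE.
apply/(integrable_mkcond (EFin \o f) mA).
apply: measurable_bounded_integrable => //; first exact: measurable_funTS.
exists M; split; first exact: num_real.
by move=> M' MM' x _ /=; rewrite (le_trans (fM x))// ltW.
Qed.

Lemma ftc_compact_support (g g' : R -> R) (C : R) : 0 <= C ->
  (forall s : R, is_derive s 1 g (g' s)) -> continuous g' ->
  (forall s, C < `|s| -> g s = 0 /\ g' s = 0) ->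
  (\int[@lebesgue_measure R]_x (g' x)%:E = 0)%E.
Proof.
move=> C0 dg cg H.
(* One unit beyond [C], since [g] is known to vanish only strictly outside [-C, C]. *)
have ab : - (C + 1) < C + 1 by lra.
have := @continuous_FTC2 R g' g _ _ ab.
have cgg : continuous g.
  by move=> s; exact: (is_derive_continuous (dg s)).
have CC1 : C < C + 1 by rewrite ltrDl.
have -> : g (C + 1) = 0 by apply: (H _ _).1; rewrite ger0_norm// addr_ge0.
have -> : g (- (C + 1)) = 0 by apply: (H _ _).1; rewrite normrN ger0_norm// addr_ge0.
rewrite sube0 => E; rewrite -[RHS]E.
- rewrite [RHS]integral_mkcond; apply: eq_integral => x _; rewrite patchE.
  case: ifPn => // xC; rewrite (H x _).2//.
  move: xC; rewrite notin_setE/= in_itv/= => /negP; rewrite -ler_norml -ltNge.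
  exact: lt_trans.
- exact: continuous_subspaceT.
- split.
  + by move=> x _; have [] := dg x.
  + exact: cvg_at_right_filter (cgg _).
  + exact: cvg_at_left_filter (cgg _).
- by move=> x _; rewrite derive1E; have [_] := dg x.
Qed.

(** Induction on the dimension by Fubini. If [i] is the first coordinate, the inner integral in it
    vanishes by the fundamental theorem of calculus; otherwise the inner integral runs over the
    remaining coordinates and vanishes by induction. *)
Lemma integral_partial_eq0 n (i : 'I_n) (G G' : n.-tuple T -> R) (C M : R) : 0 <= C ->
  measurable_fun setT G' -> (forall t, `|G' t| <= M) ->
  (forall t, (exists j, C < `|tnth t j|) -> G t = 0 /\ G' t = 0) ->
  (forall t (s : R), is_derive s 1 (fun r : R => G (upd t i r)) (G' (upd t i s))) ->
  (forall t, continuous (fun r : R => G' (upd t i r))) ->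
  (\int[lebesgue_tuple R n]_t (G' t)%:E = 0)%E.
Proof.
move=> C0; elim: n i G G' => [[]//|n IH] i G G' mG' G'M G0 dG cG'.
have mc := @measurable_cons_pair R n.
have mGc : measurable_fun setT (G' \o @cons_pair R n) by exact: measurableT_comp.
have intG : (@lebesgue_measure R \x lebesgue_tuple R n)%E.-integrable setT
    (EFin \o (G' \o @cons_pair R n)).
  pose a (j : 'I_n.+1) : R := - (C + 1); pose b (j : 'I_n.+1) : R := C + 1.
  apply: (@bounded_supp_integrable _ _ _ (@cons_pair R n @^-1` obox a b) _ M) => //.
  - rewrite -[X in measurable X]setTI; apply: mc => //; exact: measurable_obox.
  - have := @lebesgue_obox n.+1 a b; rewrite /= /lebesgue_step /pushforward => ->.
      by rewrite ltry.
    by move=> j; rewrite /a /b; lra.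
  - by move=> p /=; exact: G'M.
  - move=> p np /=; apply: (G0 _ _).2; apply: contrapT => nj; apply: np => j.
    have : ~ C < `|tnth (cons_pair p) j| by move=> h; apply: nj; exists j.
    move/negP; rewrite -leNgt ler_norml => /andP[h1 h2].
    by rewrite /a /b; apply/andP; split; lra.
have mE := (measurable_EFinP setT G').2 mG'.
have intG' : (@lebesgue_measure R \x lebesgue_tuple R n)%E.-integrable
  (@cons_pair R n @^-1` setT) ((EFin \o G') \o @cons_pair R n) by rewrite preimage_setT.
rewrite /= /lebesgue_step (integral_pushforward mc mE intG' measurableT).
rewrite preimage_setT; case: (unliftP ord0 i) => [k ik|i0].
  rewrite -(integral12_prod_meas1 intG) /fubini_F.
  rewrite integral0_eq// => x _; apply: (IH k (fun t => G (cons_pair (x, t)))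
      (fun t => G' (cons_pair (x, t)))).
  - by apply: measurableT_comp => //; apply: measurableT_comp => //; exact: measurable_pair1.
  - by move=> t; exact: G'M.
  - by move=> t [j tj]; apply: G0; exists (lift ord0 j); rewrite tnth_cons_pairS.
  - move=> t s; have := dG (cons_pair (x, t)) s; rewrite ik upd_consS.
    by under eq_fun do rewrite upd_consS.
  - move=> t; have := cG' (cons_pair (x, t)); rewrite ik.
    by have -> : (fun r : R => G' (upd (cons_pair (x, t)) (lift ord0 k) r)) =
      (fun r : R => G' (cons_pair (x, upd t k r))) by apply/funext => r; rewrite upd_consS.
rewrite -(integral21_prod_meas1 intG) /fubini_G.
rewrite integral0_eq// => t _ /=.
apply: (@ftc_compact_support (fun r => G (cons_pair (r, t))) (fun r => G' (cons_pair (r, t))) C) => //.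
- move=> s; have := dG (cons_pair (0, t)) s; rewrite i0 upd_cons0.
  by under eq_fun do rewrite upd_cons0.
- have := cG' (cons_pair (0, t)); rewrite i0.
  by have -> : (fun r : R => G' (upd (cons_pair (0, t)) ord0 r)) =
    (fun r : R => G' (cons_pair (r, t))) by apply/funext => r; rewrite upd_cons0.
- by move=> s sC; apply: G0; exists ord0; rewrite tnth_cons_pair0.
Qed.

End TupleMeasure.

Section TupleTopology.
Context {R : realType} {n : nat}.
Local Notation T := (measurableTypeR R).
Implicit Types (Omega U : set 'rV[R]_n) (u v : 'rV[R]_n -> R) (x : 'rV[R]_n).

Lemma tnth_rV (t : n.-tuple T) i : rV_of_tuple t ord0 i = tnth t i.
Proof. by rewrite mxE. Qed.

Lemma preimage_cube x (d : R) : @rV_of_tuple R n @^-1` cube x d =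
  obox (fun i => x ord0 i - d) (fun i => x ord0 i + d).
Proof.
by apply/seteqP; split=> t /= H i; have := H i; rewrite tnth_rV ltr_distl.
Qed.

(** The measurable structure on tuples is the product one, so an open set is exhibited as a
    countable union of boxes: the cubes of radius 1/(k+1) that it contains, centred on the lattice
    of mesh 1/(k+1). *)
Lemma measurable_rV_open U : open U -> measurable (@rV_of_tuple R n @^-1` U).
Proof.
move=> oU.
pose c (p : nat * 'rV[int]_n) : 'rV[R]_n := \row_i ((p.2 ord0 i)%:~R / p.1.+1%:R).
pose F (p : nat * 'rV[int]_n) : set (n.-tuple T) :=
  if `[< cube (c p) p.1.+1%:R^-1 `<=` U >] then @rV_of_tuple R n @^-1` cube (c p) p.1.+1%:R^-1
  else set0.
have -> : @rV_of_tuple R n @^-1` U = \bigcup_p F p.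
  apply/seteqP; split=> [t /= Ut|t [p _]]; last first.
    by rewrite /F; case: ifPn => // /asboolP sU /sU.
  have [d d0 Hd] := open_cube oU Ut.
  pose k := Num.bound (2 / d).
  have kd : 2 / k.+1%:R < d.
    have := archi_boundP (ltW (divr_gt0 (ltr0n R 2) d0)); rewrite -/k => h.
    rewrite ltr_pdivrMr// mulrC -ltr_pdivrMr// (lt_trans h)// ltr_nat//.
  have k0 : 0 < k.+1%:R :> R by [].
  pose z : 'rV[int]_n := \row_i Num.floor (rV_of_tuple t ord0 i * k.+1%:R).
  have tz : cube (c (k, z)) k.+1%:R^-1 (rV_of_tuple t).
    move=> i; set y := rV_of_tuple t ord0 i.
    have -> : c (k, z) ord0 i = (Num.floor (y * k.+1%:R))%:~R / k.+1%:R.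
      by rewrite [LHS]mxE /=; congr (_%:~R / _); rewrite [LHS]mxE.
    have h1 := floor_le (y * k.+1%:R); have h2 := floorD1_gt (y * k.+1%:R).
    have -> : y - (Num.floor (y * k.+1%:R))%:~R / k.+1%:R =
       (y * k.+1%:R - (Num.floor (y * k.+1%:R))%:~R) / k.+1%:R.
      by rewrite mulrBl mulfK// gt_eqF.
    rewrite normrM ger0_norm ?subr_ge0// ger0_norm ?invr_ge0 ?ltW//.
    rewrite -[ltRHS]mul1r ltr_pM2r ?invr_gt0// ltrBlDl.
    by move: h2; rewrite intrD.
  have sub : cube (c (k, z)) k.+1%:R^-1 `<=` U.
    move=> y yz; apply: Hd; apply: (@cube_sub _ _ _ (2 / k.+1%:R)); first exact: ltW.
    have -> : 2 / k.+1%:R = k.+1%:R^-1 + k.+1%:R^-1 :> R by field; rewrite gt_eqF.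
    exact: cube_trans (cube_sym tz) yz.
  by exists (k, z) => //; rewrite /F asboolT.
apply: countable_bigcupT_measurable; first exact: countableP.
move=> p; rewrite /F; case: ifPn => // _; rewrite preimage_cube; exact: measurable_obox.
Qed.

Lemma measurable_rV_continuous Omega u : open Omega ->
  (forall x, Omega x -> {for x, continuous u}) ->
  measurable_fun (@rV_of_tuple R n @^-1` Omega) (u \o @rV_of_tuple R n).
Proof.
move=> oO cu; apply: (measurability _ (RGenOInfty.measurableE R)) => //.
move=> _ [_ [a ->] <-].
have -> : @rV_of_tuple R n @^-1` Omega `&` (u \o @rV_of_tuple R n) @^-1` `]a, +oo[ =
    @rV_of_tuple R n @^-1` (Omega `&` [set x | a < u x]).
  by apply/seteqP; split=> t /= [Ot]; rewrite /= in_itv/= ?andbT.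
apply: measurable_rV_open; rewrite openE => x [Ox ax]; apply/nbhs_cube.
have [d d0 Hd] := open_cube oO Ox.
have e0 : 0 < u x - a by rewrite subr_gt0.
have [d' d'0 Hd'] := (continuous_cube _ _).1 (cu x Ox) _ e0.
have [h [h0 h1 h2]] := lt_two d0 d'0; exists h => // y xy; split.
  by apply: Hd; apply: cube_sub xy; exact: ltW.
have := Hd' y (cube_sub (ltW h2) xy) => /ltr_normlP[+ _] /=; lra.
Qed.

Lemma rV_upd (t : n.-tuple T) i (s : R) :
  rV_of_tuple (upd t i s) = rV_of_tuple t + (s - tnth t i) *: basis_vec i.
Proof.
apply/rowP => j; rewrite tnth_rV shiftE tnth_mktuple tnth_rV.
by case: eqVneq => [->|_]; rewrite ?mulr1 ?mulr0 ?addr0// addrC subrK.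
Qed.

End TupleTopology.

(** * Smooth bump functions approximating indicators of boxes *)

Section Bump.
Context {R : realType}.

(** Prescribing all derivatives at once turns smoothness into an induction on the index. *)
Definition smooth_chain (D : nat -> R -> R) : Prop :=
  forall k (t : R), is_derive t 1 (D k) (D k.+1 t).

(** The [k]-th derivative of exp(-1/t) is p_k(1/t) exp(-1/t). With s = 1/t and ds/dt = -s^2, the
    product rule gives p_{k+1} = (p_k - p_k') X^2. *)
Fixpoint flat_poly (k : nat) : {poly R} :=
  if k is k'.+1 then (flat_poly k' - (flat_poly k')^`()) * 'X^2 else 1.

(* The successive derivatives of the function exp(-1/t), t > 0, extended by 0. *)
Definition flat (k : nat) (t : R) : R :=
  if 0 < t then (flat_poly k).[t^-1] * expR (- t^-1) else 0.

Lemma horner_le_expR (p : {poly R}) : exists2 C : R, 0 < C &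
  forall s, 0 <= s -> `|p.[s]| <= C * expR s.
Proof.
exists (1 + \sum_(i < size p) `|p`_i| * i`!%:R).
  by rewrite ltr_pwDl// sumr_ge0// => i _; rewrite mulr_ge0.
move=> s s0; rewrite horner_coef (le_trans (ler_norm_sum _ _ _))//.
rewrite mulrDl mul1r ler_wpDl ?expR_ge0// mulr_suml ler_sum// => i _.
rewrite normrM -mulrA ler_wpM2l// ger0_norm ?exprn_ge0//.
have f0 : 0 < i`!%:R :> R by rewrite ltr0n fact_gt0.
rewrite -ler_pdivrMl//; case: (i : nat) => [|k].
  by rewrite fact0 invr1 mul1r expr0 (le_trans _ (expR_ge1Dx s))// lerDl.
by rewrite mulrC (le_trans _ (expR_ge1Dxn k s0))// lerDr.
Qed.

(** The exponential beats the polynomial X^2 p_k; the resulting quadratic bound yields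
    differentiability at 0 with derivative 0. *)
Lemma flat_le_sqr k : exists2 C : R, 0 < C & forall t, 0 < t -> `|flat k t| <= C * t ^+ 2.
Proof.
have [C C0 HC] := horner_le_expR ('X^2 * flat_poly k).
exists C => // t t0; rewrite /flat t0 normrM [X in _ * X]ger0_norm ?expR_ge0//.
have := HC t^-1; rewrite invr_ge0 ltW// => /(_ isT).
have -> : `|('X^2 * flat_poly k).[t^-1]| = t ^- 2 * `|(flat_poly k).[t^-1]|.
  by rewrite hornerM hornerXn normrM exprVn ger0_norm// invr_ge0 exprn_ge0// ltW.
rewrite ler_pdivrMl ?exprn_gt0// => h.
by rewrite expRN ler_pdivrMr ?expR_gt0// (le_trans h)// mulrCA mulrA.
Qed.

Lemma flat_chain : smooth_chain flat.
Proof.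
move=> k t; have [t0|t0|->] := ltgtP t 0.
- apply/is_derive_eps => e e0; exists (- t); first by rewrite oppr_gt0.
  move=> h /ltr_normlP[_ ht]; rewrite scaler1 /flat.
  rewrite !ltNge (ltW t0)/= (_ : t + h <= 0)/=; last by lra.
  by rewrite mul0r !subr0 normr0 mulr_ge0// ltW.
- have n0 : t != 0 by rewrite gt_eqF.
  have dinv : is_derive t 1 (fun y : R => y^-1) (- t ^- 2).
    have := @is_deriveV R id t 1 1 n0 (is_derive_id _ _).
    by rewrite [_ *: _]mulr1.
  have dp : is_derive t 1 (fun y : R => (flat_poly k).[y^-1]) ((flat_poly k)^`().[t^-1] * - t ^- 2).
    apply: (@is_derive1_comp _ (fun y => (flat_poly k).[y]) (fun y => y^-1)) => //.
    exact: is_derive_poly.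
  have de : is_derive t 1 (fun y : R => expR (- y^-1)) (expR (- t^-1) * t ^- 2).
    have d1 : is_derive (- t^-1) 1 (@expR R) (expR (- t^-1)) := is_derive_expR _.
    have d2 : is_derive t 1 (fun y : R => - y^-1) (t ^- 2).
      by rewrite -[t ^- 2]opprK; exact: is_deriveN.
    exact: (@is_derive1_comp _ (@expR R) (fun y => - y^-1) t _ _ d1 d2).
  have dm := is_deriveM dp de.
  have -> : flat k.+1 t = (flat_poly k).[t^-1] *: (expR (- t^-1) * t ^- 2) +
       expR (- t^-1) *: ((flat_poly k)^`().[t^-1] * - t ^- 2).
    rewrite /flat t0 /= hornerM hornerXn hornerD hornerN /GRing.scale/=.
    by move: (expR _) (_.[_]) (_.[_]) => a b c; field.
  have {}dm : is_derive t 1 (fun y : R => (flat_poly k).[y^-1] * expR (- y^-1)) _ := dm.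
  apply/is_derive_eps => e e0; have [D D0 HD] := (is_derive_eps _ _ _ _).1 dm e e0.
  have [h [h0 h1 h2]] := lt_two D0 t0; exists h => // s sh.
  have := HD s (lt_trans sh h1); rewrite /flat t0.
  rewrite (_ : 0 < t + s *: 1)//; move: sh => /ltr_normlP[+ _].
  rewrite scaler1; lra.
- have [C C0 HC] := flat_le_sqr k.
  have -> : flat k.+1 0 = 0 by rewrite /flat ltxx.
  apply/is_derive_eps => e e0; exists (e / C); first by rewrite divr_gt0.
  move=> h hC; rewrite add0r scaler1 mul0r subr0 [flat k 0]/flat ltxx subr0.
  have [h0|h0] := ltP 0 h; last by rewrite /flat ltNge h0/= normr0 mulr_ge0// ltW.
  apply: le_trans (HC h h0) _; move: hC; rewrite (gtr0_norm h0) => hC.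
  by rewrite expr2 mulrA ler_pM2r// mulrC -ler_pdivlMr// ltW.
Qed.

Lemma flat_ge0 (t : R) : 0 <= flat 0 t <= 1.
Proof.
rewrite /flat; case: ifP => [t0|_]; last by rewrite lexx ler01.
rewrite /= hornerC mul1r expR_ge0/= -expR0 ler_expR oppr_le0 invr_ge0 ltW//.
Qed.

Lemma flat_cvg (t : R) : flat 0 (k.+1%:R * t) @[k --> \oo] --> ((0 < t)%R%:R : R).
Proof.
have [t0|t0] := ltP 0 t; last first.
  have -> : (fun k => flat 0 (k.+1%:R * t)) = (fun=> 0).
    by apply/funext => k; rewrite /flat ltNge mulr_ge0_le0.
  exact: cvg_cst.
have -> : (fun k => flat 0 (k.+1%:R * t)) = (fun k => expR (- (k.+1%:R^-1 * t^-1))).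
  by apply/funext => k; rewrite /flat mulr_gt0//= hornerC mul1r invfM.
rewrite -[X in _ --> X]expR0; apply: continuous_cvg; first exact: continuous_expR.
rewrite -[X in _ --> X]oppr0 -[X in _ --> - X](mul0r t^-1); apply: cvgN.
by apply: cvgM; [exact: cvg_harmonic|exact: cvg_cst].
Qed.

End Bump.

Section BoxBump.
Context {R : realType} {n : nat}.
Implicit Types (Omega U : set 'rV[R]_n) (u v : 'rV[R]_n -> R) (x : 'rV[R]_n)
  (a b : 'I_n -> R).

Lemma C_on_union k Omega U u : C_on k Omega u -> C_on k U u -> C_on k (Omega `|` U) u.
Proof.
elim: k u => [|k IH] u H1 H2; first by move=> x [/H1|/H2].
move=> i; have [H11 H12] := H1 i; have [H21 H22] := H2 i; split; last exact: IH.
by move=> x [/H11|/H21].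
Qed.

Lemma C_on_prod m k Omega (u_ : 'I_m -> 'rV[R]_n -> R) : open Omega ->
  (forall j, C_on k Omega (u_ j)) -> C_on k Omega (fun x => \prod_j u_ j x).
Proof.
move=> oO; elim: m u_ => [|m IH] u_ H.
  by apply: (C_on_eq oO _ (C_on_cst k Omega 1)) => x _; rewrite big_ord0.
pose w := widen_ord (leqnSn m).
apply: (C_on_eq oO _ (C_onM oO (IH (u_ \o w) (fun j => H (w j))) (H ord_max))) => x _.
by rewrite big_ord_recr.
Qed.

Lemma chain_partial (D : nat -> R -> R) m (c d : R) i j x : smooth_chain D ->
  is_derive x (basis_vec j) (fun y => D m (c * y ord0 i + d))
    (D m.+1 (c * x ord0 i + d) * (c * (i == j)%:R)).
Proof.
move=> ch; set s := c * x ord0 i + d; set w := c * (i == j)%:R.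
have dl : is_derive (0 : R) 1 (fun h : R => s + h * w) w.
  apply/is_derive_eps => e e0; exists 1 => // h _.
  rewrite scaler1 mul0r addr0 add0r [w * h]mulrC.
  have -> : s + h * w - s - h * w = 0 by ring.
  by rewrite normr0 mulr_ge0// ltW.
have ds : is_derive (s + 0 * w) 1 (D m) (D m.+1 s) by rewrite mul0r addr0.
have dc := @is_derive1_comp R (D m) (fun h : R => s + h * w) 0 _ _ ds dl.
apply/is_derive_eps => e e0; have [E E0 HE] := (is_derive_eps _ _ _ _).1 dc e e0.
exists E => // h /HE /=; rewrite scaler1 add0r mul0r addr0.
suff -> : c * (x + h *: basis_vec j) ord0 i + d = s + h * w by [].
rewrite shiftE /s /w eq_sym; ring.
Qed.

Lemma C_on_chain (D : nat -> R -> R) m k (c d : R) i : smooth_chain D ->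
  C_on k setT (fun x => D m (c * x ord0 i + d)).
Proof.
move=> ch; elim: k m => [|k IH] m.
  move=> x _; apply/continuous_cube => e e0.
  have /is_derive_continuous/cvgrPdist_lt/(_ e e0) := ch m (c * x ord0 i + d).
  move=> /nbhs_ballP[r /= r0 Hr].
  have c0 : 0 < 1 + `|c| by rewrite ltr_pwDl.
  exists (r / (1 + `|c|)); first exact: divr_gt0.
  move=> y /(_ i) xy; rewrite distrC; apply: Hr; rewrite /ball /=.
  have -> : c * x ord0 i + d - (c * y ord0 i + d) = - (c * (y ord0 i - x ord0 i)) by ring.
  rewrite normrN normrM; move: xy; rewrite ltr_pdivlMr// => xy.
  apply: le_lt_trans xy; rewrite mulrC ler_wpM2l// lerDr//.
move=> j; split=> [x _|]; first by have [] := chain_partial m c d i j x ch.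
apply: (@C_on_eq _ _ _ _ (fun x => D m.+1 (c * x ord0 i + d) * (c * (i == j)%:R))).
- exact: openT.
- by move=> x _; have [_ E] := chain_partial m c d i j x ch; rewrite /partial E.
- by apply: C_onM; [exact: openT|exact: IH|exact: C_on_cst].
Qed.

Definition cbox a b := [set y : 'rV[R]_n | forall i, a i <= y ord0 i <= b i].

Lemma closed_cbox a b : closed (cbox a b).
Proof.
apply: compact_closed; last exact: compact_cbox.
exact: norm_hausdorff.
Qed.

(** The factor k+1 dilates [flat 0], so that the product tends to the indicator of the open box as
    [k] grows, while the support stays in the closed box and the values in [0, 1]. *)
Definition box_bump a b (k : nat) : 'rV[R]_n -> R := fun x =>
  \prod_i (flat 0 (k.+1%:R * (x ord0 i - a i)) * flat 0 (k.+1%:R * (b i - x ord0 i))).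

Lemma box_bump_smooth a b k m : C_on m setT (box_bump a b k).
Proof.
apply: C_on_prod => [|i]; first exact: openT.
apply: C_onM; first exact: openT.
- have -> : (fun x : 'rV[R]_n => flat 0 (k.+1%:R * (x ord0 i - a i))) =
    (fun x => flat 0 (k.+1%:R * x ord0 i + - (k.+1%:R * a i))).
    by apply/funext => x; rewrite mulrBr.
  by apply: C_on_chain; exact: flat_chain.
- have -> : (fun x : 'rV[R]_n => flat 0 (k.+1%:R * (b i - x ord0 i))) =
    (fun x => flat 0 (- k.+1%:R * x ord0 i + k.+1%:R * b i)).
    by apply/funext => x; rewrite mulrBr mulNr addrC.
  by apply: C_on_chain; exact: flat_chain.
Qed.

Lemma box_bump_ge0 a b k x : 0 <= box_bump a b k x <= 1.
Proof.
rewrite /box_bump prodr_ile1/= ?prodr_ge0// => i _.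
  by have /andP[h1 _] := flat_ge0 (k.+1%:R * (x ord0 i - a i)); have /andP[h2 _] := flat_ge0 (k.+1%:R * (b i - x ord0 i)); rewrite mulr_ge0.
have /andP[h1 h1'] := flat_ge0 (k.+1%:R * (x ord0 i - a i)); have /andP[h2 h2'] := flat_ge0 (k.+1%:R * (b i - x ord0 i)).
by rewrite mulr_ge0//= mulr_ile1.
Qed.

Lemma flat_out k (t : R) : t <= 0 -> flat k t = 0.
Proof. by rewrite /flat ltNge => ->. Qed.

Lemma box_bump_out a b k x : ~ cbox a b x -> box_bump a b k x = 0.
Proof.
move=> nx; have [i] : exists i, ~~ (a i <= x ord0 i <= b i).
  by apply/existsP; rewrite -negb_forall; apply/negP => /forallP H; apply: nx.
rewrite negb_and -!ltNge => H; rewrite /box_bump (bigD1 i)//=.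
case/orP: H => H.
- by rewrite flat_out ?mul0r// mulr_ge0_le0// subr_le0 ltW.
- by rewrite [X in _ * X * _]flat_out ?mulr0 ?mul0r// mulr_ge0_le0// subr_le0 ltW.
Qed.

Lemma box_bump_test Omega a b k : cbox a b `<=` Omega -> test_function Omega (box_bump a b k).
Proof.
move=> H; split; first by move=> m; exact: box_bump_smooth.
exists (cbox a b); split => //; first exact: compact_cbox.
exact: box_bump_out.
Qed.

Lemma cvg_bigprod m (u_ : 'I_m -> nat -> R) (l : 'I_m -> R) :
  (forall i, u_ i k @[k --> \oo] --> l i) -> \prod_i u_ i k @[k --> \oo] --> \prod_i l i.
Proof.
elim: m u_ l => [|m IH] u_ l H.
  by under eq_fun do rewrite big_ord0; rewrite big_ord0; exact: cvg_cst.
under eq_fun do rewrite big_ord_recl; rewrite big_ord_recl.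
apply: cvgM; first exact: H.
by apply: (IH (fun i => u_ (lift ord0 i)) (fun i => l (lift ord0 i))) => i; exact: H.
Qed.

Lemma box_bump_cvg a b x : box_bump a b k x @[k --> \oo] -->
  (\1_[set y : 'rV[R]_n | forall i, a i < y ord0 i < b i] x : R).
Proof.
have -> : \1_[set y : 'rV[R]_n | forall i, a i < y ord0 i < b i] x =
  \prod_i ((0 < x ord0 i - a i)%R%:R * (0 < b i - x ord0 i)%R%:R) :> R.
  rewrite indicE; have [H|H] := pselect (forall i, a i < x ord0 i < b i).
    rewrite mem_set// big1// => i _; have /andP[h1 h2] := H i.
    by rewrite !subr_gt0 h1 h2 mulr1.
  rewrite memNset//; have [i] : exists i, ~~ (a i < x ord0 i < b i).
    by apply/existsP; rewrite -negb_forall; apply/negP => /forallP.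
  rewrite (bigD1 i)//= !subr_gt0; case: (_ < _) => /=; last by rewrite !mul0r.
  by case: (_ < _) => //; rewrite mulr0 mul0r.
apply: cvg_bigprod => i; apply: cvgM; exact: flat_cvg.
Qed.

End BoxBump.

(** * Integration by parts against bump functions *)

Section WeakPartial.
Context {R : realType} {n : nat}.
Implicit Types (Omega U : set 'rV[R]_n) (u v : 'rV[R]_n -> R) (x : 'rV[R]_n)
  (a b : 'I_n -> R).
Local Notation mu := (lebesgue_tuple R n).
Local Notation rv := (@rV_of_tuple R n).

Lemma cbox_bounded Omega u a b : (forall x, Omega x -> {for x, continuous u}) ->
  cbox a b `<=` Omega -> exists M : R, forall x, cbox a b x -> `|u x| <= M.
Proof.
move=> cu sub; have [K0|K0] := pselect (cbox a b !=set0); last first.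
  by exists 0 => x Kx; case: K0; exists x.
have [|c Kc Hc] := compact_argmax (u := fun x => `|u x|) (@compact_cbox R n a b) K0; last first.
  by exists `|u c|.
move=> x Kx; apply: (continuous_comp (cu x (sub _ Kx))); exact: norm_continuous.
Qed.

Lemma partial_out i u a b x : (forall x, ~ cbox a b x -> u x = 0) ->
  ~ cbox a b x -> partial i u x = 0.
Proof.
move=> u0 Kx; have oK : open (~` cbox a b) by apply: closed_openC; exact: closed_cbox.
have E : {in ~` cbox a b, (fun=> 0) =1 u} by move=> y; rewrite inE => /u0 ->.
by rewrite -((partial_eq i oK E Kx).2 : _ = partial i u x) partial_cst.
Qed.

Lemma integral_partial_supp i u a b : C_on 1 setT u ->
  (forall x, ~ cbox a b x -> u x = 0) ->
  (\int[mu]_t (partial i u (rv t))%:E = 0)%E.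
Proof.
move=> Cu u0; have [du cu'] := Cu i.
have cp x : {for x, continuous (partial i u)} := cu' x I.
have [M HM] := @cbox_bounded setT (partial i u) a b (fun x _ => cp x) (@subsetT _ _).
pose C := \sum_j (`|a j| + `|b j|).
have C0 : 0 <= C by apply: sumr_ge0 => j _; rewrite addr_ge0.
apply: (@integral_partial_eq0 R n i (u \o rv) (partial i u \o rv) C (Num.max M 0)) => //.
- have := @measurable_rV_continuous R n setT (partial i u) openT (fun x _ => cp x).
  by rewrite preimage_setT.
- move=> t /=; rewrite le_max; have [Kt|Kt] := pselect (cbox a b (rv t)).
    by rewrite HM.
  by rewrite (partial_out i u0 Kt) normr0 lexx orbT.
- move=> t [j tj]; suff Kt : ~ cbox a b (rv t).
    by rewrite /= u0// (partial_out i u0 Kt).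
  move=> /(_ j); rewrite tnth_rV => /andP[h1 h2].
  have : `|a j| + `|b j| <= C.
    by rewrite /C (bigD1 j)//= lerDl sumr_ge0// => k _; rewrite addr_ge0.
  have := ler_norm (b j); have := ler_normr (- a j) `|a j|.
  have := ler_norm (- a j); rewrite normrN.
  have := normr_ge0 (a j); have := normr_ge0 (b j).
  move: tj; rewrite ltNge => /negP tj h3 h4 h5 _ h6 h7; apply: tj.
  by rewrite ler_norml; apply/andP; split; lra.
- move=> t s; set x := rv t.
  have -> : (fun r : R => (u \o rv) (upd t i r)) =
      (fun r : R => u ((x + - tnth t i *: basis_vec i) + r *: basis_vec i)).
    by apply/funext => r; rewrite /= rV_upd [r - _]addrC scalerDl addrA.
  have -> : (partial i u \o rv) (upd t i s) =
      'D_(basis_vec i) u ((x + - tnth t i *: basis_vec i) + s *: basis_vec i).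
    by rewrite /= rV_upd -/x /partial [s - _]addrC scalerDl addrA.
  by apply: line_is_derive; exact: du.
- move=> t r.
  apply: (@continuous_comp _ _ _ (fun r => rv (upd t i r)) (partial i u)); last exact: cp.
  have -> : (fun r => rv (upd t i r)) = (fun r => rv t + (r - tnth t i) *: basis_vec i).
    by apply/funext => s; rewrite rV_upd.
  apply: (@continuousD _ _ _ (fun=> _)); first exact: cst_continuous.
  apply: (@continuousZr_tmp _ _ _ (fun r => r - tnth t i)).
  apply: (@continuousB _ _ _ id (fun=> _)); first by move=> A; exact.
  exact: cst_continuous.
Qed.

Lemma measurable_cbox a b : measurable (rv @^-1` cbox a b).
Proof.
rewrite -[cbox a b]setCK preimage_setC; apply: measurableC.
by apply: (@measurable_rV_open R n (~` cbox a b)); apply: closed_openC; exact: closed_cbox.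
Qed.

Lemma mu_cbox a b : (mu (rv @^-1` cbox a b) < +oo)%E.
Proof.
have [K0|K0] := pselect (cbox a b !=set0); last first.
  suff -> : cbox a b = set0 by rewrite preimage_set0 measure0.
  by apply/seteqP; split => // x Kx; case: K0; exists x.
have sub : rv @^-1` cbox a b `<=` obox (fun i => a i - 1) (fun i => b i + 1).
  by move=> t Kt i; have := Kt i; rewrite tnth_rV => /andP[h1 h2]; apply/andP; split; lra.
apply: le_lt_trans (le_measure mu _ _ sub) _.
- by rewrite inE; exact: measurable_cbox.
- by rewrite inE; exact: measurable_obox.
have [x Kx] := K0; rewrite [X in (X < _)%E]lebesgue_obox ?ltry// => i.
by have /andP[h1 h2] := Kx i; lra.
Qed.

Lemma continuous_integrable Omega u a b : open Omega ->
  (forall x, Omega x -> {for x, continuous u}) -> cbox a b `<=` Omega ->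
  mu.-integrable (rv @^-1` cbox a b) (EFin \o (u \o rv)).
Proof.
move=> oO cu sub; apply: measurable_bounded_integrable.
- exact: measurable_cbox.
- exact: mu_cbox.
- apply: (@measurable_funS _ _ _ _ (rv @^-1` Omega)).
  + exact: measurable_rV_open.
  + by move=> t /sub.
  + exact: measurable_rV_continuous.
- have [M HM] := cbox_bounded cu sub; exists M; split; first exact: num_real.
  by move=> M' MM' t /HM h; exact: le_trans h (ltW MM').
Qed.

Lemma Rintegral_support (D K : set (n.-tuple (measurableTypeR R))) h : K `<=` D ->
  (forall t, D t -> ~ K t -> h t = 0) -> \int[mu]_(t in D) h t = \int[mu]_(t in K) h t.
Proof.
move=> KD h0; rewrite Rintegral_mkcond [RHS]Rintegral_mkcond; congr (Rintegral _ _ _).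
apply/funext => t; rewrite !patchE; have [Kt|Kt] := pselect (K t).
  by rewrite !mem_set//; exact: KD.
rewrite [t \in K]memNset//; case: ifPn => //; rewrite inE => Dt; exact: h0.
Qed.

(** The integral of [partial i] of the product of [u] and the bump over the whole space is 0, which
    is integration by parts for the classical derivative. Comparison with the weak identity leaves
    the difference of the two derivatives. *)
Lemma weak_box_bump Omega i u v a b k : open Omega -> C_on 1 Omega u ->
  weak_partial i Omega u v -> cbox a b `<=` Omega ->
  mu.-integrable (rv @^-1` cbox a b) (EFin \o (v \o rv)) ->
  \int[mu]_(t in rv @^-1` cbox a b)
    ((v (rv t) - partial i u (rv t)) * box_bump a b k (rv t)) = 0.
Proof.
have aux (A B C : R) : A + B = 0 -> A = - C -> C - B = 0 by lra.
move=> oO Cu wk sub iv; set phi := box_bump a b k.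
have phi0 : forall x, ~ cbox a b x -> phi x = 0 by exact: box_bump_out.
have Cphi m : C_on m setT phi by exact: box_bump_smooth.
have cphi x : {for x, continuous phi} := Cphi 0%N x I.
have cdphi x : {for x, continuous (partial i phi)} := (Cphi 1%N i).2 x I.
have subK : rv @^-1` cbox a b `<=` rv @^-1` Omega by move=> t /sub.
have cu x : Omega x -> {for x, continuous u} by exact: C_on_continuous Cu.
have cdu x : Omega x -> {for x, continuous (partial i u)} := (Cu i).2 x.
have mK := measurable_cbox a b.
have := wk phi (box_bump_test k sub).
rewrite (Rintegral_support subK); last first.
  by move=> t _ /= Kt; rewrite (partial_out i phi0 Kt) mulr0.
rewrite (@Rintegral_support _ _ (fun t => v (rv t) * phi (rv t)) subK); last first.
  by move=> t _ /= Kt; rewrite phi0// mulr0.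
(* The product is C^1 on [Omega] and identically 0 off the closed box, and these two open sets cover
   the space. *)
have CG : C_on 1 setT (fun x => u x * phi x).
  have -> : [set: 'rV[R]_n] = Omega `|` ~` cbox a b.
    apply/esym; rewrite -subTset => x _.
    by have [/sub|] := pselect (cbox a b x); [left|right].
  apply: C_on_union.
    by apply: C_onM; [exact: oO|exact: Cu|exact: C_on_sub (@subsetT _ _) (Cphi 1%N)].
  apply: (@C_on_eq _ _ _ _ (fun=> 0)); last exact: C_on_cst.
    by apply: closed_openC; exact: closed_cbox.
  by move=> y; rewrite inE => Ky; rewrite phi0// mulr0.
have G0 x : ~ cbox a b x -> u x * phi x = 0 by move=> Kx; rewrite phi0// mulr0.
have := integral_partial_supp i CG G0 => /(congr1 fine).
rewrite [LHS](_ : _ = \int[mu]_(t in setT) partial i (fun x => u x * phi x) (rv t))//.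
rewrite (@Rintegral_support _ (rv @^-1` cbox a b))//; last first.
  by move=> t _ Kt; exact: (partial_out i G0 Kt).
rewrite (@eq_Rintegral _ _ _ _ _ (fun t => u (rv t) * partial i phi (rv t) + phi (rv t) * partial i u (rv t))); last first.
  move=> t; rewrite inE => /sub Ot; apply: partialM; first exact: (Cu i).1.
  exact: (Cphi 1%N i).1.
have i1 : mu.-integrable (rv @^-1` cbox a b) (EFin \o (fun t => u (rv t) * partial i phi (rv t))).
  apply: (@continuous_integrable Omega (fun x => u x * partial i phi x)) => // x Ox.
  by apply: continuousM; [exact: cu|exact: cdphi].
have i2 : mu.-integrable (rv @^-1` cbox a b) (EFin \o (fun t => phi (rv t) * partial i u (rv t))).
  apply: (@continuous_integrable Omega (fun x => phi x * partial i u x)) => // x Ox.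
  by apply: continuousM; [exact: cphi|exact: cdu].
have i3 : mu.-integrable (rv @^-1` cbox a b) (EFin \o (fun t => v (rv t) * phi (rv t))).
  apply: (le_integrable mK _ _ iv).
    have /integrableP[/measurable_EFinP mv _] := iv.
    apply/measurable_EFinP; apply: measurable_funM => //.
    have := @measurable_rV_continuous R n setT phi openT (fun x _ => cphi x).
    by rewrite preimage_setT; exact: measurable_funTS.
  move=> t _ /=; rewrite lee_fin normrM ler_piMr//.
  by have /andP[p0 p1] := box_bump_ge0 a b k (rv t); rewrite ger0_norm.
rewrite RintegralD// => E1 E2.
rewrite (@eq_Rintegral _ _ _ _ _ (fun t => v (rv t) * phi (rv t) - phi (rv t) * partial i u (rv t))); last first.
  by move=> t _; ring.
rewrite RintegralB//; move: E1 E2; exact: aux.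
Qed.

End WeakPartial.

(** * Agreement of weak and classical derivatives *)

Section WeakClassical.
Context {R : realType} {n : nat}.
Implicit Types (Omega U : set 'rV[R]_n) (u v : 'rV[R]_n -> R) (x : 'rV[R]_n)
  (a b : 'I_n -> R).
Local Notation T := (measurableTypeR R).
Local Notation mu := (lebesgue_tuple R n).
Local Notation rv := (@rV_of_tuple R n).

Definition oboxes : set (set (n.-tuple T)) := [set A | exists a b, A = obox a b].

Lemma oboxI a b a' b' : obox a b `&` obox a' b' =
  obox (fun i => Num.max (a i) (a' i)) (fun i => Num.min (b i) (b' i)).
Proof.
apply/seteqP; split=> t /=.
  by move=> [H1 H2] i; rewrite gt_max lt_min; have /andP[-> ->] := H1 i; have /andP[-> ->] := H2 i.
move=> H; split=> i; have := H i; rewrite gt_max lt_min.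
  by case/andP => /andP[-> _] /andP[-> _].
by case/andP => /andP[_ ->] /andP[_ ->].
Qed.

(** Open boxes are a generating family stable under intersection, as Dynkin's lemma requires. *)
Lemma tuple_measurableE : @measurable _ (n.-tuple T) = <<s oboxes >>.
Proof.
apply/seteqP; split; last first.
  apply: smallest_sub; first exact: sigma_algebra_measurable.
  by move=> _ [a [b ->]]; exact: measurable_obox.
suff mid : measurable_fun setT (fun t : g_sigma_algebraType oboxes => (t : n.-tuple T)).
  by move=> A mA; have := mid measurableT A mA; rewrite setTI preimage_id.
apply/measurable_fun_tnthP => i.
apply: (measurability _ (RGenOInfty.measurableE R)) => //.
move=> _ [_ [c ->] <-]; rewrite setTI.
(* An open half space is exhausted by boxes whose free bounds grow with [k]. *)
pose F (k : nat) : set (n.-tuple T) :=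
  obox (fun j => if j == i then c else - k%:R) (fun j => k%:R).
have -> : (fun t : g_sigma_algebraType oboxes => tnth (t : n.-tuple T) i) @^-1` `]c, +oo[ = \bigcup_k F k.
  apply/seteqP; split=> t /=; rewrite in_itv/= andbT.
    move=> ct; exists (Num.bound (\sum_j `|tnth t j|)) => // j.
    have h : `|tnth t j| < (Num.bound (\sum_j `|tnth t j|))%:R.
      apply: le_lt_trans (archi_boundP _); last by apply: sumr_ge0.
      by rewrite (bigD1 j)//= lerDl sumr_ge0.
    case: eqVneq h => [->|_] /ltr_normlP[h1 h2]; first by rewrite ct.
    by rewrite ltrNl h1.
  by move=> [k _ /(_ i)]; rewrite eqxx => /andP[].
apply: bigcup_measurable => k _; apply: sub_sigma_algebra; exact: ex_intro (ex_intro _ _ _).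
Qed.

(** The limit of [weak_box_bump] as [k] grows, by dominated convergence. *)
Lemma box_integral_eq0 Omega i u v a b : open Omega -> C_on 1 Omega u ->
  weak_partial i Omega u v -> cbox a b `<=` Omega ->
  mu.-integrable (rv @^-1` cbox a b) (EFin \o (v \o rv)) ->
  (\int[mu]_(t in obox a b) (v (rv t) - partial i u (rv t))%:E = 0)%E.
Proof.
move=> oO Cu wk sub iv; pose w t := v (rv t) - partial i u (rv t).
have mK := @measurable_cbox R n a b.
have iw : mu.-integrable (rv @^-1` cbox a b) (EFin \o w).
  have idu := @continuous_integrable R n Omega (partial i u) a b oO (Cu i).2 sub.
  exact: (integrableB mK iv idu).
have mw : measurable_fun (rv @^-1` cbox a b) w.
  by have /integrableP[/measurable_EFinP mv _] := iw.
pose f_ k t := (w t * box_bump a b k (rv t))%:E.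
pose B := [set y : 'rV[R]_n | forall i, a i < y ord0 i < b i].
pose f t := (w t * \1_B (rv t))%:E.
have mb k : measurable_fun (rv @^-1` cbox a b) (fun t => box_bump a b k (rv t)).
  have := @measurable_rV_continuous R n setT (box_bump a b k) openT (box_bump_smooth a b k 0).
  by rewrite preimage_setT; exact: measurable_funTS.
have mf_ k : measurable_fun (rv @^-1` cbox a b) (f_ k).
  by apply/measurable_EFinP; apply: measurable_funM.
have BE : rv @^-1` B = obox a b.
  by apply/seteqP; split=> t H j; have := H j; rewrite tnth_rV.
have mB : measurable (rv @^-1` B) by rewrite BE; exact: measurable_obox.
have mf : measurable_fun (rv @^-1` cbox a b) f.
  apply/measurable_EFinP; apply: measurable_funM => //.
  have -> : (fun t => \1_B (rv t)) = \1_(rv @^-1` B) :> (_ -> R).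
    by apply/funext => t; rewrite !indicE.
  by apply: measurable_funTS; exact: measurable_indic.
have h1 : {ae mu, forall t, (rv @^-1` cbox a b) t -> f_ ^~ t @ \oo --> f t}.
  apply: aeW => t _; rewrite /f_ /f; apply/cvg_EFin; first exact: nearW.
  by apply: cvgM; [exact: cvg_cst|exact: box_bump_cvg].
have h2 : {ae mu, forall t k, (rv @^-1` cbox a b) t -> (`|f_ k t| <= `|w t|%:E)%E}.
  apply: aeW => t k _; rewrite lee_fin normrM ler_piMr//.
  by have /andP[p0 p1] := box_bump_ge0 a b k (rv t); rewrite ger0_norm.
have ig : mu.-integrable (rv @^-1` cbox a b) (fun t => (`|w t|)%:E).
  exact: (integrable_abse iw).
have [intf _ L] := dominated_convergence mK mf_ mf h1 ig h2.
have E0 : [sequence (\int[mu]_(t in rv @^-1` cbox a b) f_ k t)%E]_k = (fun=> 0%E).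
  apply/funext => k /=.
  have := congr1 (fun r : R => r%:E) (weak_box_bump k oO Cu wk sub iv).
  rewrite /Rintegral fineK//; apply: integrable_fin_num => //.
  apply: (le_integrable mK (mf_ k) _ iw) => t _ /=.
  rewrite lee_fin normrM ler_piMr//.
  by have /andP[p0 p1] := box_bump_ge0 a b k (rv t); rewrite ger0_norm.
rewrite E0 in L; have E : (\int[mu]_(t in rv @^-1` cbox a b) f t = 0)%E.
  by apply/esym; apply: cvg_unique L; [exact: ereal_hausdorff|exact: cvg_cst].
rewrite -[RHS]E integral_mkcond [RHS]integral_mkcond; apply: eq_integral => t _.
rewrite !patchE /f -BE indicE; have [Bt|Bt] := pselect (B (rv t)).
  rewrite !mem_set ?mulr1// => j; have /andP[b1 b2] := Bt j.
  by rewrite !ltW.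
by rewrite [t \in rv @^-1` B]memNset// [rv t \in B]memNset// mulr0; case: ifP.
Qed.

(** The measurable sets whose intersection with the cube carries zero integral of v - partial i u
    form a Dynkin system containing the boxes, hence are all measurable sets; so this difference
    vanishes almost everywhere on the cube. *)
Lemma weak_partial_ae Omega i u v x (d : R) : open Omega -> C_on 1 Omega u ->
  weak_partial i Omega u v -> 
  cbox (fun j => x ord0 j - d) (fun j => x ord0 j + d) `<=` Omega ->
  mu.-integrable (rv @^-1` cbox (fun j => x ord0 j - d) (fun j => x ord0 j + d)) (EFin \o (v \o rv)) ->
  {ae mu, forall t, (rv @^-1` cube x d) t -> v (rv t) = partial i u (rv t)}.
Proof.
move=> oO Cu wk sub iv; rewrite preimage_cube.
set a := fun j => _ - _; set b := fun j => _ + _; rewrite -/a -/b in sub iv.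
pose w t := v (rv t) - partial i u (rv t).
have mK := @measurable_cbox R n a b; have mQ := @measurable_obox R n a b.
have QK : obox a b `<=` rv @^-1` cbox a b.
  by move=> t Qt j; have /andP[h1 h2] := Qt j; rewrite tnth_rV !ltW.
have iw : mu.-integrable (obox a b) (EFin \o w).
  apply: (integrableS mK mQ QK).
  have idu := @continuous_integrable R n Omega (partial i u) a b oO (Cu i).2 sub.
  exact: (integrableB mK iv idu).
pose P : set (set (n.-tuple T)) := [set A | (\int[mu]_(t in A `&` obox a b) (w t)%:E = 0)%E].
have PG : oboxes `<=` P.
  move=> _ [a' [b' ->]]; rewrite /P/= oboxI.
  have s2 : cbox (fun i => Num.max (a' i) (a i)) (fun i => Num.min (b' i) (b i)) `<=` cbox a b.
    by move=> y H j; have := H j; rewrite ge_max le_min => /andP[/andP[_ ->] /andP[_ ->]].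
  apply: (box_integral_eq0 oO Cu wk); first by move=> y /s2/sub.
  apply: (integrableS mK _ _ iv); first exact: measurable_cbox.
  by move=> t /s2.
have PA A : measurable A -> P A.
  rewrite tuple_measurableE; apply: dynkin_induction A.
  - exact: tuple_measurableE.
  - by move=> _ _ [a1 [b1 ->]] [a2 [b2 ->]]; rewrite oboxI; exact: ex_intro (ex_intro _ _ _).
  - by rewrite /P /=; have := PG _ (ex_intro _ a (ex_intro _ b erefl)); rewrite /P /= setIid setTI.
  - exact: PG.
  - move=> S mS PS; have := PG _ (ex_intro _ a (ex_intro _ b erefl)); rewrite /P /= setIid.
    have SE : obox a b = (S `&` obox a b) `|` (~` S `&` obox a b).
      by rewrite -setIUl setUv setTI.
    rewrite {1}SE integral_setU.
    + by rewrite PS add0e.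
    + exact: measurableI.
    + by apply: measurableI => //; exact: measurableC.
    + by rewrite -SE; have /integrableP[] := iw.
    + by apply/disj_setPS; rewrite setIACA setICr set0I.
  - move=> F mF tF PF; rewrite /P /= setI_bigcupl integral_bigcup.
    + by rewrite eseries0// => k _ _; exact: PF.
    + exact: trivIset_setIr.
    + by move=> k; exact: measurableI.
    + apply: (integrableS mQ _ _ iw); last by apply: bigcup_sub => k _; exact: subIsetr.
      by apply: bigcup_measurable => k _; exact: measurableI.
have := integral_ae_eq mQ iw (measurable_cst 0%E).
have : forall E : set (n.-tuple T), E `<=` obox a b -> measurable E ->
    (\int[mu]_(t in E) (EFin \o w) t = \int[mu]_(t in E) cst 0%E t)%E.
  by move=> E EQ mE; rewrite integral0; have := PA E mE; rewrite /P /= setIidl.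
move=> H /(_ H); apply: filterS => t Ht Qt; have := Ht Qt => -[] /eqP.
by rewrite subr_eq0 => /eqP.
Qed.

(** A box has finite measure, and |v| <= 1 + |v|^(p+1). *)
Lemma Lp_loc_integrable p Omega v a b : open Omega -> Lp_loc p.+1 Omega v ->
  cbox a b `<=` Omega -> mu.-integrable (rv @^-1` cbox a b) (EFin \o (v \o rv)).
Proof.
move=> oO [mv iv] sub; have mK := @measurable_cbox R n a b.
have mvK : measurable_fun (rv @^-1` cbox a b) (v \o rv).
  apply: measurable_funS mv; first exact: measurable_rV_open.
  by move=> t /sub.
have ip : mu.-integrable (rv @^-1` cbox a b) (fun t => (`|v (rv t)| ^+ p.+1)%:E).
  apply/integrableP; split.
    by apply/measurable_EFinP; apply: measurable_funX; exact: measurableT_comp.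
  have := iv (cbox a b) (@compact_cbox R n a b) sub.
  under [X in (X < _)%E -> _]eq_integral => t _ do rewrite -[X in X%:E]ger0_norm ?exprn_ge0//.
  by [].
have i1 : mu.-integrable (rv @^-1` cbox a b) (EFin \o cst (1:R)).
  apply: measurable_bounded_integrable => //; first exact: mu_cbox.
  exact: bounded_cst.
apply: (le_integrable mK _ _ (integrableD mK i1 ip)); first exact/measurable_EFinP.
move=> t _ /=; rewrite lee_fin; set y := `|v (rv t)|.
have y0 : 0 <= y by exact: normr_ge0.
rewrite [leRHS]ger0_norm ?addr_ge0 ?exprn_ge0//.
have [y1|y1] := leP y 1; first by rewrite (le_trans y1)// lerDl exprn_ge0.
by rewrite -[leLHS]add0r lerD// exprS ler_peMr// exprn_ege1// ltW.
Qed.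

End WeakClassical.

Section AlmostEverywhere.
Context {R : realType}.

Lemma ae_cube_pos n (P : 'rV[R]_n -> Prop) x (d : R) : 0 < d ->
  {ae lebesgue_tuple R n, forall t, P (rV_of_tuple t)} -> exists2 y, cube x d y & P y.
Proof.
move=> d0 [N [mN N0 sN]]; apply: contrapT => H.
have sub : @rV_of_tuple R n @^-1` cube x d `<=` N.
  by move=> t Qt; apply: sN => /= Pt; apply: H; exists (rV_of_tuple t).
have mQ : measurable (@rV_of_tuple R n @^-1` cube x d) by rewrite preimage_cube; exact: measurable_obox.
have : (lebesgue_tuple R n (@rV_of_tuple R n @^-1` cube x d) <= 0)%E.
  by rewrite -N0; apply: le_measure => //; rewrite inE.
rewrite preimage_cube lebesgue_obox; last by move=> i; lra.
by rewrite lee_fin leNgt => /negP; apply; apply: prodr_gt0 => i _; lra.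
Qed.

Lemma ae_and d (T : measurableType d) (mu : {measure set T -> \bar R}) (P Q S : T -> Prop) :
  {ae mu, forall t, P t} -> {ae mu, forall t, Q t} -> (forall t, P t -> Q t -> S t) ->
  {ae mu, forall t, S t}.
Proof. by move=> HP HQ H; exact: (@filterS2 _ _ (ae_filter_ringOfSetsType mu) P Q S H HP HQ). Qed.

Lemma ae_forall3 d (T : measurableType d) (mu : {measure set T -> \bar R}) (P : 'I_3 -> T -> Prop) :
  (forall i, {ae mu, forall t, P i t}) -> {ae mu, forall t, forall i, P i t}.
Proof.
move=> H; apply: (ae_and (ae_and (H 0) (H 1) (fun _ => @conj _ _)) (H 2%:R)) => t [h0 h1] h2 i.
have : i \in [:: 0; 1; 2%:R] by case: i => [[|[|[]]]].
by rewrite !inE => /or3P[] /eqP ->.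
Qed.

End AlmostEverywhere.

(** * The distortion inequality at every point *)

Section JacobianInequality.
Context {R : realType}.
Implicit Types (Omega U : set 'rV[R]_3) (f : 'rV[R]_3 -> 'rV[R]_3) (A : 'M[R]_3).
Local Notation mu := (lebesgue_tuple R 3).
Local Notation rv := (@rV_of_tuple R 3).

Definition jacobian3 f x : 'M[R]_3 := \matrix_(i, j) partial i (fun y => f y ord0 j) x.

(** The squared Frobenius norm, which replaces the operator norm because it is a polynomial in the
    entries. *)
Definition sumsq A : R := \sum_i \sum_j A i j ^+ 2.

Lemma enorm_row A i : enorm (basis_vec i *m A) ^+ 2 = \sum_j A i j ^+ 2.
Proof.
rewrite /enorm sqr_sqrtr; last by apply: sumr_ge0 => j _; exact: sqr_ge0.
by apply: eq_bigr => j _; rewrite /basis_vec -rowE mxE.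
Qed.

Lemma enorm0 : enorm (0 : 'rV[R]_3) = 0.
Proof. by rewrite /enorm big1 ?sqrtr0// => j _; rewrite mxE expr0n. Qed.

Lemma enorm_le_opnorm A v : enorm v <= 1 -> enorm (v *m A) <= opnorm A.
Proof.
move=> v1; apply: sup_upper_bound; last by exists v.
split; first by exists (enorm (v *m A)); exists v.
exists (Num.sqrt (\sum_j (\sum_i `|A i j|) ^+ 2)) => _ [w w1 <-].
rewrite /enorm ler_wsqrtr//; apply: ler_sum => j _.
rewrite -real_normK ?num_real// lerXn2r ?nnegrE ?sumr_ge0//.
rewrite mxE (le_trans (ler_norm_sum _ _ _))//; apply: ler_sum => i _.
rewrite normrM ler_piMl//.
have : w ord0 i ^+ 2 <= 1.
  have S0 : 0 <= \sum_(i < 3) w ord0 i ^+ 2 by apply: sumr_ge0 => k _; exact: sqr_ge0.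
  have : \sum_(i < 3) w ord0 i ^+ 2 <= 1.
    by rewrite -(sqr_sqrtr S0) -[1](expr1n _ 2) lerXn2r ?nnegrE ?sqrtr_ge0.
  apply: le_trans; rewrite (bigD1 i)//= lerDl sumr_ge0// => k _; exact: sqr_ge0.
by rewrite -real_normK ?num_real// expr_le1.
Qed.

(** Each row of [A] is the image of a unit vector, so sumsq A <= 3|A|^2, and cubing gives 27; the
    added 1 keeps the constant positive for every [K]. *)
Lemma opnorm_sumsq A (K : R) : opnorm A ^+ 3 <= K * `|\det A| ->
  sumsq A ^+ 3 <= (27 * K ^+ 2 + 1) * (\det A) ^+ 2.
Proof.
set o := opnorm A => H.
have o0 : 0 <= o.
  have := @enorm_le_opnorm A 0; rewrite mul0mx enorm0; apply; exact: ler01.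
have row i : \sum_j A i j ^+ 2 <= o ^+ 2.
  rewrite -enorm_row lerXn2r ?nnegrE ?sqrtr_ge0//.
  apply: enorm_le_opnorm; rewrite /enorm (bigD1 i)//= big1 ?addr0 => [|j ji].
    by rewrite basis_vecE eqxx expr1n sqrtr1.
  by rewrite basis_vecE (negbTE ji) expr0n.
have So : sumsq A <= 3 * o ^+ 2.
  by rewrite /sumsq sum3; move: (row 0) (row 1) (row 2%:R) => h1 h2 h3; lra.
have S0 : 0 <= sumsq A by apply: sumr_ge0 => i _; apply: sumr_ge0 => j _; exact: sqr_ge0.
have h : sumsq A ^+ 3 <= (3 * o ^+ 2) ^+ 3 by rewrite lerXn2r ?nnegrE// mulr_ge0// sqr_ge0.
apply: (le_trans h).
have -> : (3 * o ^+ 2) ^+ 3 = 27 * (o ^+ 3) ^+ 2 by ring.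
have : (o ^+ 3) ^+ 2 <= (K * `|\det A|) ^+ 2.
  by rewrite lerXn2r ?nnegrE ?exprn_ge0// (le_trans _ H)// exprn_ge0.
rewrite [X in _ <= X -> _]exprMn (real_normK (num_real _)); have := sqr_ge0 (\det A).
move: (_ ^+ 2) (_ ^+ 2) (_ ^+ 2) => a b c; nra.
Qed.

Lemma continuous_det3 (F : 'rV[R]_3 -> 'M[R]_3) x :
  (forall i j, {for x, continuous (fun y => F y i j)}) ->
  {for x, continuous (fun y => \det (F y))}.
Proof.
move=> cF; have -> : (fun y => \det (F y)) = (fun y => det3 (F y 0) (F y 1) (F y 2%:R)).
  by apply/funext => y; rewrite det_det3.
have cM (u v : 'rV[R]_3 -> R) : {for x, continuous u} -> {for x, continuous v} ->
  {for x, continuous (fun y => u y * v y)} by exact: continuousM.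
have cD (u v : 'rV[R]_3 -> R) : {for x, continuous u} -> {for x, continuous v} ->
  {for x, continuous (fun y => u y + v y)} by exact: continuousD.
have cB (u v : 'rV[R]_3 -> R) : {for x, continuous u} -> {for x, continuous v} ->
  {for x, continuous (fun y => u y - v y)} by exact: continuousB.
pose m (i j k l : 'I_3) := cB _ _ (cM _ _ (cF 1 i) (cF 2%:R j)) (cM _ _ (cF 1 k) (cF 2%:R l)).
exact: cD _ _ (cB _ _ (cM _ _ (cF 0 0) (m 1 2%:R 2%:R 1)) (cM _ _ (cF 0 1) (m 0 2%:R 2%:R 0)))
  (cM _ _ (cF 0 2%:R) (m 0 1 1 0)).
Qed.

(** Near [x] the weak differential agrees almost everywhere with the classical one, which is
    continuous. A strict failure of the inequality at [x] would persist on a cube, and a cube has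
    positive measure. *)
Lemma jacobian_inequality Omega f Df (K : R) : open Omega ->
  (forall j, C_on 1 Omega (fun x => f x ord0 j)) -> W1p_loc 3 Omega f Df ->
  {ae mu, forall t, Omega (rv t) -> opnorm (Df (rv t)) ^+ 3 <= K * `|\det (Df (rv t))|} ->
  forall x, Omega x -> sumsq (jacobian3 f x) ^+ 3 <= (27 * K ^+ 2 + 1) * (\det (jacobian3 f x)) ^+ 2.
Proof.
move=> oO Cf [_ wf] ae_ineq x Ox; rewrite leNgt; apply/negP => lt_x.
have [r r0 Hr] := open_cube oO Ox; pose d := r / 2.
have d0 : 0 < d by rewrite divr_gt0.
have sub : cbox (fun j => x ord0 j - d) (fun j => x ord0 j + d) `<=` Omega.
  by move=> y H; apply: Hr => j; have := H j; rewrite -ler_distl /d => h; rewrite (le_lt_trans h)//; lra.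
pose g y := sumsq (jacobian3 f y) ^+ 3 - (27 * K ^+ 2 + 1) * (\det (jacobian3 f y)) ^+ 2.
have cJ i j : {for x, continuous (fun y => jacobian3 f y i j)}.
  have -> : (fun y => jacobian3 f y i j) = partial i (fun y => f y ord0 j).
    by apply/funext => y; rewrite mxE.
  exact: (Cf j i).2.
have cg : {for x, continuous g}.
  apply: continuousB; last first.
    by apply: continuousM; [exact: cst_continuous|apply: continuousM; exact: continuous_det3].
  have cs : {for x, continuous (fun y => sumsq (jacobian3 f y))}.
    apply: continuous_sum => i; apply: continuous_sum => j.
    by apply: continuousM; exact: cJ.
  by apply: continuousM => //; apply: continuousM.
have g0 : 0 < g x by rewrite subr_gt0.
have [s s0 Hs] := (continuous_cube _ _).1 cg _ g0.
have [h [h0 hd hs]] := lt_two d0 s0.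
have aeJ : {ae mu, forall t, (forall i j, (rv @^-1` cube x d) t -> Df (rv t) i j = jacobian3 f (rv t) i j)}.
  apply: ae_forall3 => i; apply: ae_forall3 => j.
  have [Lv wk] := wf i j.
  have := weak_partial_ae oO (Cf j) wk sub (Lp_loc_integrable oO Lv sub).
  move=> H0; apply: (ae_and H0 H0) => t H _ /H ->; by rewrite mxE.
pose P y := cube x d y -> g y <= 0.
have aeP : {ae mu, forall t, P (rv t)}.
  apply: (ae_and aeJ ae_ineq) => t H1 H2 Qt.
  have E : Df (rv t) = jacobian3 f (rv t) by apply/matrixP => i j; exact: H1.
  rewrite subr_le0 -E; apply/opnorm_sumsq/H2/sub => j; rewrite -ler_distl ltW//; exact: Qt.
have [y xy Py] := ae_cube_pos x h0 aeP.
have := Py (cube_sub (ltW hd) xy); have := Hs y (cube_sub (ltW hs) xy).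
by move=> /ltr_normlP[+ _]; move: (g x) (g y) => a b; lra.
Qed.

End JacobianInequality.

(** * Taylor expansions of harmonic functions *)

Section LeadingTerm.
Context {R : realType} {n : nat}.
Implicit Types (Omega : set 'rV[R]_n) (g u v : 'rV[R]_n -> R) (x y z : 'rV[R]_n).
Local Notation e i := (@basis_vec R n i).

Lemma is_derive_power (c t : R) k :
  is_derive t 1 (fun s : R => c * s ^+ k.+1) (c * (k.+1%:R * t ^+ k)).
Proof.
have d1 : is_derive t 1 (fun s : R => s ^+ k.+1) (k.+1%:R * t ^+ k).
  have := @is_deriveX R R id k.+1 t 1 1 (is_derive_id _ _).
  rewrite /GRing.scale/= mulr1; congr (is_derive t 1 _ _).
  by apply/funext => s; rewrite fctE.
exact: (is_deriveZ c d1).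
Qed.

Lemma power_growth (phi phi' : R -> R) (h c : R) k : 0 < h ->
  (forall t : R, 0 <= t <= h -> is_derive t 1 phi (phi' t)) -> phi 0 = 0 ->
  (forall t, 0 <= t <= h -> `|phi' t| <= c * t ^+ k) ->
  `|phi h| <= c * h ^+ k.+1 / k.+1%:R.
Proof.
move=> h0 dphi phi0 Hphi.
have dpow (t : R) : is_derive t 1 (fun s : R => c * s ^+ k.+1 / k.+1%:R) (c * t ^+ k).
  have -> : c * t ^+ k = c / k.+1%:R * (k.+1%:R * t ^+ k) by rewrite mulrA divfK.
  under eq_fun do rewrite mulrAC; exact: is_derive_power.
have main (psi psi' : R -> R) : (forall t : R, 0 <= t <= h -> is_derive t 1 psi (psi' t)) ->
    psi 0 = 0 -> (forall t, 0 <= t <= h -> psi' t <= c * t ^+ k) ->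
    psi h <= c * h ^+ k.+1 / k.+1%:R.
  move=> dpsi psi0 Hpsi.
  have [t th|t /andP[t0 th]] := @mvt_pos _ (fun s => psi s - c * s ^+ k.+1 / k.+1%:R)
     (fun s => psi' s - c * s ^+ k) h h0.
    exact: is_deriveB (dpsi t th) (dpow t).
  rewrite psi0 expr0n/= mulr0 mul0r !subr0 => E.
  have : (psi' t - c * t ^+ k) * h <= 0.
    have hp : psi' t - c * t ^+ k <= 0 by rewrite subr_le0 Hpsi// !ltW.
    exact: mulr_le0_ge0 hp (ltW h0).
  by rewrite -E subr_le0.
apply/ler_normlP; split.
  apply: (main (fun s => - phi s) (fun s => - phi' s)).
  - by move=> t th; exact: is_deriveN (dphi t th).
  - by rewrite phi0 oppr0.
  - by move=> t /Hphi /ler_normlP[].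
by apply: (main phi phi') => // t /Hphi /ler_normlP[].
Qed.

Lemma ord_pos_min m (P : 'I_m -> R -> Prop) :
  (forall i, exists2 d : R, 0 < d & forall t, 0 <= t < d -> P i t) ->
  exists2 d : R, 0 < d & forall i t, 0 <= t < d -> P i t.
Proof.
move=> H; have H' i : exists d : R, 0 < d /\ forall t, 0 <= t < d -> P i t.
  by have [d d0 Hd] := H i; exists d.
have [f Hf] := choice H'.
exists (\big[Num.min/1]_i f i).
  by apply/bigmin_gtP; split => // i _; have [] := Hf i.
move=> i t /andP[t0 tf]; have [_] := Hf i; apply.
by rewrite t0/= (lt_le_trans tf)//; exact: bigmin_le_cond.
Qed.

Fixpoint iter_partial (s : seq 'I_n) g : 'rV[R]_n -> R :=
  if s is i :: s' then iter_partial s' (partial i g) else g.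

(* For smooth [g], the homogeneous part of degree [m] of the Taylor expansion of
   [x |-> g (z + x)], computed by Euler's identity. *)
Fixpoint taylor_form (m : nat) z g : 'rV[R]_n -> R :=
  if m is m'.+1 then fun x => m%:R^-1 * \sum_i x ord0 i * taylor_form m' z (partial i g) x
  else fun=> g z.

Lemma iter_partial_harmonic Omega s g : open Omega -> harmonic_on Omega g ->
  harmonic_on Omega (iter_partial s g).
Proof.
move=> oO; elim: s g => [|i s IH] g Hg; [exact: Hg|exact: IH (harmonic_partial i oO Hg)].
Qed.

Lemma iter_partial_eq Omega s u v z : open Omega -> {in Omega, u =1 v} -> Omega z ->
  iter_partial s u z = iter_partial s v z.
Proof.
move=> oO; elim: s u v => /= [|i s IH] u v uv Oz; first by apply: uv; rewrite inE.
apply: IH => // y; rewrite inE => Oy; exact: (partial_eq i oO uv Oy).2.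
Qed.

Lemma taylor_form_eq Omega m u v z : open Omega -> {in Omega, u =1 v} -> Omega z ->
  taylor_form m z u = taylor_form m z v.
Proof.
move=> oO; elim: m u v => /= [|m IH] u v uv Oz; apply/funext => x.
  by apply: uv; rewrite inE.
congr (_ * _); apply: eq_bigr => i _; congr (_ * _).
rewrite (IH _ (partial i v))// => y; rewrite inE => Oy; exact: (partial_eq i oO uv Oy).2.
Qed.

Lemma taylor_form_sum Omega m k (g_ : 'I_k -> 'rV[R]_n -> R) z x : open Omega -> Omega z ->
  (forall i, harmonic_on Omega (g_ i)) ->
  taylor_form m z (fun y => \sum_i g_ i y) x = \sum_i taylor_form m z (g_ i) x.
Proof.
move=> oO Oz; elim: m g_ => [|m IH] g_ Hg //=.
rewrite -mulr_sumr exchange_big/=; congr (_ * _); apply: eq_bigr => i _.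
rewrite -mulr_sumr -IH => [|j]; last exact: (harmonic_partial i oO (Hg j)).
rewrite (taylor_form_eq m (u := partial i (fun y => \sum_j g_ j y))
  (v := fun y => \sum_j partial i (g_ j) y) oO)// => y; rewrite inE => Oy.
by rewrite partial_bigsum// => j; exact: (C_on_derivable (Hg j).1).
Qed.

Lemma taylor_form_cst0 m z x : taylor_form m z (fun=> 0) x = 0.
Proof.
elim: m => //= m IH; rewrite big1 ?mulr0// => i _.
by rewrite (_ : partial i (fun=> 0) = fun=> 0) ?IH ?mulr0//; apply/funext => y; rewrite partial_cst.
Qed.

Lemma taylor_form_homog m z g x (t : R) :
  taylor_form m z g (t *: x) = t ^+ m * taylor_form m z g x.
Proof.
elim: m g => [|m IH] g /=; first by rewrite mul1r.
rewrite mulrCA; congr (_ * _); rewrite mulr_sumr; apply: eq_bigr => i _.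
rewrite IH mxE exprS; ring.
Qed.

Lemma taylor_form_C m k z g : C_on k setT (taylor_form m z g).
Proof.
elim: m g => [|m IH] g /=; first exact: C_on_cst.
apply: C_onZ; first exact: openT.
apply: C_on_sum => [|i]; first exact: openT.
apply: C_onM; [exact: openT|apply: C_on_coord; exact: openT|exact: IH].
Qed.

(** By the product rule and induction, the derivative of Euler's sum of degree m+2 consists of m+1
    copies of the form of [partial k g], from its recursion, and one more from differentiating the
    coordinate; the factor 1/(m+2) cancels. *)
Lemma taylor_form_partial Omega m z g k : open Omega -> harmonic_on Omega g -> Omega z ->
  partial k (taylor_form m.+1 z g) = taylor_form m z (partial k g).
Proof.
move=> oO; elim: m g => [|m IH] g Hg Oz; apply/funext => x.
  rewrite [LHS]partialZ/=; last first.
    apply: (C_on_derivable (k := 0)) (I : setT x).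
    apply: C_on_sum => [|i]; first exact: openT.
    apply: C_onM; [exact: openT|apply: C_on_coord; exact: openT|exact: C_on_cst].
  rewrite invr1 mul1r partial_bigsum => [|i]; last first.
    apply: (C_on_derivable (k := 0)) (I : setT x).
    apply: C_onM; [exact: openT|apply: C_on_coord; exact: openT|exact: C_on_cst].
  rewrite (bigD1 k)//= big1 => [|i ik]; last first.
    rewrite partialM ?partial_cst ?partial_coord ?(negbTE ik) ?mulr0 ?addr0//.
    by have [] := is_derive_coord x (e k) i.
  rewrite partialM ?partial_cst ?partial_coord ?eqxx ?mulr0 ?add0r ?addr0 ?mulr1//.
  by have [] := is_derive_coord x (e k) k.
have dT i : derivable (taylor_form m.+1 z (partial i g)) x (e k).
  exact: (C_on_derivable (k := 0) (taylor_form_C _ _ _ _) (I : setT x)).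
have dc i : derivable (fun y => y ord0 i) x (e k) by have [] := is_derive_coord x (e k) i.
have dM i : derivable (fun y => y ord0 i * taylor_form m.+1 z (partial i g) y) x (e k).
  exact: (@derivableM _ _ (fun y => y ord0 i)).
have E i : partial k (fun y => y ord0 i * taylor_form m.+1 z (partial i g) y) x =
    x ord0 i * taylor_form m z (partial i (partial k g)) x +
    taylor_form m.+1 z (partial i g) x * (i == k)%:R.
  rewrite (partialM (dc i) (dT i)) partial_coord (IH _ (harmonic_partial i oO Hg) Oz).
  have pE : {in Omega, partial k (partial i g) =1 partial i (partial k g)}.
    by move=> y; rewrite inE => Oy; exact: (partialC _ _ oO Hg.1 Oy).
  exact: (congr1 (fun F => x ord0 i * F x + _) (taylor_form_eq m oO pE Oz)).
have dS := is_derive_bigsum (fun i => derivableP (dM i)).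
have -> : partial k (taylor_form m.+2 z g) x =
    m.+2%:R^-1 * \sum_i partial k (fun y => y ord0 i * taylor_form m.+1 z (partial i g) y) x.
  have [dv dE] := dS.
  by rewrite -[X in _ * X]dE -[RHS](partialZ _ dv).
under eq_bigr do rewrite E.
rewrite big_split/= [X in _ + X](bigD1 k)//= [X in _ + (_ + X)]big1 => [|i ik]; last first.
  by rewrite (negbTE ik) mulr0.
rewrite eqxx mulr1 addr0; move: (\sum_i _) => A; field.
by rewrite nat1r -natrD !pnatr_eq0.
Qed.

Lemma taylor_form_harmonic Omega m z g : open Omega -> harmonic_on Omega g -> Omega z ->
  harmonic_on setT (taylor_form m z g).
Proof.
move=> oO Hg Oz; split; first exact: taylor_form_C.
move=> x _; case: m => [|[|m]].
- by apply: big1 => i _; rewrite (_ : partial i (taylor_form 0 z g) = fun=> 0) ?partial_cst//; apply/funext => y; rewrite partial_cst.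
- by apply: big1 => i _; rewrite (taylor_form_partial 0 i oO Hg Oz) partial_cst.
have E i : partial i (partial i (taylor_form m.+2 z g)) = taylor_form m z (partial i (partial i g)).
  by rewrite (taylor_form_partial m.+1 i oO Hg Oz) (taylor_form_partial m i oO (harmonic_partial i oO Hg) Oz).
rewrite /laplacian; under eq_bigr do rewrite E.
rewrite -(taylor_form_sum m x oO Oz) => [|i]; last first.
  exact: (harmonic_partial i oO (harmonic_partial i oO Hg)).
have L0 : {in Omega, (fun y => \sum_i partial i (partial i g) y) =1 (fun=> 0)}.
  by move=> y; rewrite inE; exact: Hg.2.
by rewrite (taylor_form_eq m oO L0 Oz) taylor_form_cst0.
Qed.

Lemma iter_partial_taylor Omega s m z g : open Omega -> harmonic_on Omega g -> Omega z ->
  iter_partial s (taylor_form (size s + m) z g) = taylor_form m z (iter_partial s g).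
Proof.
move=> oO; elim: s g => [|i s IH] g Hg Oz; first by [].
rewrite [LHS]/= (taylor_form_partial _ i oO Hg Oz).
exact: IH (harmonic_partial i oO Hg) Oz.
Qed.

Lemma taylor_form_eq0 m z g x : (forall s, size s = m -> iter_partial s g z = 0) ->
  taylor_form m z g x = 0.
Proof.
elim: m g => [|m IH] g H /=; first exact: (H [::]).
rewrite big1 ?mulr0// => i _; rewrite IH ?mulr0// => s sm.
by apply: (H (i :: s)); rewrite /= sm.
Qed.

Lemma line_derive Omega g z x (t : R) : open Omega -> harmonic_on Omega g ->
  Omega (z + t *: x) ->
  is_derive t 1 (fun s : R => g (z + s *: x)) (\sum_i x ord0 i * partial i g (z + t *: x)).
Proof.
move=> oO Hg Ot; have [dv dE] := C1_is_derive x oO (C_onS oO Hg.1) Ot.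
by rewrite -dE; exact: line_is_derive.
Qed.

(** Induction on [m]: the derivative along the ray t -> z + t x is a combination of first partial
    derivatives, which vanish at [z] to one order less, and [power_growth] integrates their
    estimate. *)
Lemma taylor_form_limit Omega m z g x (a : R) : open Omega -> harmonic_on Omega g -> Omega z ->
  (forall s, (size s < m)%N -> iter_partial s g z = 0) -> 0 < a ->
  exists2 d : R, 0 < d & forall t, 0 <= t < d ->
    `|g (z + t *: x) - t ^+ m * taylor_form m z g x| <= a * t ^+ m.
Proof.
move=> oO; elim: m g a => [|m IH] g a Hg Oz H a0.
  have [dv dE] := C1_is_derive x oO (C_onS oO Hg.1) Oz.
  have /is_derive_eps/(_ 1 ltr01)[D D0 HD] : is_derive z x g ('D_x g z) by [].
  have M0 : 0 < 1 + `|'D_x g z| by rewrite ltr_pwDl.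
  have [d [d0 d1 d2]] := lt_two D0 (divr_gt0 a0 M0).
  exists d => // t /andP[t0 td]; rewrite !expr0 mul1r mulr1 /=.
  have := HD t; rewrite ger0_norm// => /(_ (lt_trans td d1)); rewrite mul1r => h.
  have {}d2 : t * (1 + `|'D_x g z|) <= a by rewrite -ler_pdivlMr// ltW// (lt_trans td).
  apply: le_trans d2; have := ler_normD (g (z + t *: x) - g z - 'D_x g z * t) ('D_x g z * t).
  rewrite subrK normrM (ger0_norm t0) => h'; apply: (le_trans h').
  by rewrite mulrDr mulr1 [t * `|_|]mulrC lerD2r.
have [r r0 Hr] := open_cube oO Oz.
pose S := 1 + \sum_i `|x ord0 i|.
have S0 : 0 < S by rewrite ltr_pwDl// sumr_ge0.
have aS : 0 < a / S by rewrite divr_gt0.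
have [|d1 d10 Hd1] := @ord_pos_min n (fun i t =>
    `|partial i g (z + t *: x) - t ^+ m * taylor_form m z (partial i g) x| <= a / S * t ^+ m).
  move=> i; apply: (IH _ _ (harmonic_partial i oO Hg) Oz _ aS) => s sm.
  by apply: (H (i :: s)); rewrite /= ltnS.
have [d [d0 dd1 drS]] := lt_two d10 (divr_gt0 r0 S0).
exists d => // h /andP[h0 hd].
have [->|hn0] := eqVneq h 0.
  rewrite !expr0n/= mul0r mulr0 subr0 scale0r addr0.
  by rewrite (H [::] isT : g z = 0) normr0.
have {}h0 : 0 < h by rewrite lt_neqAle eq_sym hn0.
have Oh (t : R) : 0 <= t <= h -> Omega (z + t *: x).
  move=> /andP[t0 th]; apply: Hr => i; rewrite !mxE [z _ _ + _]addrC addrK normrM ger0_norm//.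
  have xS : `|x ord0 i| <= S.
    by rewrite /S (bigD1 i)//= addrCA lerDl addr_ge0// sumr_ge0.
  have : t * S < r by rewrite -ltr_pdivlMr// (le_lt_trans th)// (lt_trans hd).
  by apply: le_lt_trans; rewrite ler_wpM2l.
set L := taylor_form m.+1 z g x.
have LE : m.+1%:R * L = \sum_i x ord0 i * taylor_form m z (partial i g) x.
  by rewrite /L /= mulrA mulfV ?mul1r.
have dpow (t : R) : is_derive t 1 (fun s : R => s ^+ m.+1 * L) (t ^+ m * (m.+1%:R * L)).
  rewrite mulrA mulrC; under eq_fun do rewrite mulrC.
  by rewrite [t ^+ m * _]mulrC; exact: is_derive_power.
have := @power_growth (fun t => g (z + t *: x) - t ^+ m.+1 * L)
  (fun t => (\sum_i x ord0 i * partial i g (z + t *: x)) - t ^+ m * (m.+1%:R * L)) h a m h0.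
move=> H'; apply: le_trans (H' _ _ _) _.
- by move=> t th; exact: is_deriveB (line_derive oO Hg (Oh t th)) (dpow t).
- by rewrite scale0r addr0 expr0n/= mul0r subr0 (H [::] isT : g z = 0).
- move=> t /andP[t0 th]; rewrite LE mulr_sumr -sumrB.
  apply: le_trans (ler_norm_sum _ _ _) _.
  have B i : `|x ord0 i * partial i g (z + t *: x) - t ^+ m * (x ord0 i * taylor_form m z (partial i g) x)|
      <= `|x ord0 i| * (a / S * t ^+ m).
    have -> : x ord0 i * partial i g (z + t *: x) - t ^+ m * (x ord0 i * taylor_form m z (partial i g) x)
      = x ord0 i * (partial i g (z + t *: x) - t ^+ m * taylor_form m z (partial i g) x) by ring.
    rewrite normrM ler_wpM2l//; apply: Hd1; rewrite t0/=.
    by rewrite (le_lt_trans th)// (lt_trans hd).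
  apply: le_trans (ler_sum _ (fun i _ => B i)) _.
  rewrite -mulr_suml mulrA ler_wpM2r ?exprn_ge0// mulrCA ger_pMr//.
  by rewrite ler_pdivrMr// mul1r /S lerDr.
rewrite ler_pdivrMr// ler_peMr// ?ler1n//.
by rewrite mulr_ge0 ?exprn_ge0 ?ltW.
Qed.

(** The gradient bound is applied [size s] times, each application using up a margin [h] of the
    cube. *)
Lemma iter_partial_bound Omega s g z (r h M : R) : open Omega -> harmonic_on Omega g ->
  0 <= r -> 0 < h -> 0 < M ->
  (forall y, (forall j, `|y ord0 j - z ord0 j| <= r + (size s)%:R * h) -> Omega y /\ `|g y| <= M) ->
  forall y, (forall j, `|y ord0 j - z ord0 j| <= r) ->
    `|iter_partial s g y| <= (n.+1%:R / h) ^+ size s * M.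
Proof.
move=> oO + r0 h0; elim: s g M => [|i s IH] g M Hg M0 H y Hy.
  rewrite /= expr0 mul1r; apply: (H y _).2 => j.
  by rewrite mul0r addr0; exact: Hy.
have n0 : 0 < n.+1%:R * M / h by rewrite divr_gt0// mulr_gt0.
rewrite [X in X <= _]/= [size _]/= exprSr -mulrA [_ / h * M]mulrAC.
apply: (IH _ _ (harmonic_partial i oO Hg) n0 _ y Hy) => x Hx.
have sub (w : 'rV[R]_n) : (forall j, `|w ord0 j - x ord0 j| <= h) -> Omega w /\ `|g w| <= M.
  move=> Hw; apply: H => j.
  have -> : w ord0 j - z ord0 j = (w ord0 j - x ord0 j) + (x ord0 j - z ord0 j) by ring.
  apply: le_trans (ler_normD _ _) _; rewrite [size _]/= -natr1 mulrDl mul1r addrA addrC.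
  exact: lerD (Hw j) (Hx j).
split; last first.
  have G := @gradient_bound _ _ _ _ _ i _ _ oO Hg h0 M0 sub.
  exact: G.
by apply: (sub x _).1 => j; rewrite subrr normr0 ltW.
Qed.

Lemma taylor_bound Omega k g z x (B : R) : open Omega -> harmonic_on Omega g -> 0 <= B ->
  (forall t, 0 <= t <= 1 -> Omega (z + t *: x)) ->
  (forall s, (size s < k)%N -> iter_partial s g z = 0) ->
  (forall s t, size s = k -> 0 <= t <= 1 -> `|iter_partial s g (z + t *: x)| <= B) ->
  forall t, 0 <= t <= 1 -> `|g (z + t *: x)| <= B * (\sum_i `|x ord0 i|) ^+ k / k`!%:R * t ^+ k.
Proof.
move=> oO + B0 Ox; set S := \sum_i _.
have S0 : 0 <= S by rewrite sumr_ge0.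
elim: k g => [|k IH] g Hg H1 H2 t t01.
  by rewrite !expr0 mulr1 fact0 divr1 mulr1; exact: (H2 [::]).
have [->|tn0] := eqVneq t 0.
  by rewrite scale0r addr0 (H1 [::] isT : g z = 0) normr0 expr0n/= mulr0.
have /andP[t0 t1] := t01; have {}t0 : 0 < t by rewrite lt_neqAle eq_sym tn0.
pose c := S * (B * S ^+ k / k`!%:R).
have := @power_growth (fun t => g (z + t *: x)) (fun t => \sum_i x ord0 i * partial i g (z + t *: x)) t c k t0.
have sub (s : R) : 0 <= s <= t -> 0 <= s <= 1.
  by move=> /andP[-> st]; exact: le_trans t1.
move=> H; apply: le_trans (H _ _ _) _.
- by move=> s st; exact: line_derive oO Hg (Ox _ (sub s st)).
- by rewrite scale0r addr0 (H1 [::] isT : g z = 0).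
- move=> s st; apply: le_trans (ler_norm_sum _ _ _) _.
  have E i : `|x ord0 i * partial i g (z + s *: x)| <= `|x ord0 i| * (B * S ^+ k / k`!%:R * s ^+ k).
    rewrite normrM ler_wpM2l//.
    apply: (IH _ (harmonic_partial i oO Hg) _ _ s (sub s st)) => [q qk|q w qk w01].
      exact: (H1 (i :: q)).
    by apply: (H2 (i :: q)); rewrite /= ?qk.
  apply: le_trans (ler_sum _ (fun i _ => E i)) _.
  by rewrite -mulr_suml /c -!mulrA.
rewrite /c factS natrM invfM [S ^+ k.+1]exprS.
have -> : S * (B * S ^+ k / k`!%:R) * t ^+ k.+1 / k.+1%:R =
  B * (S * S ^+ k) * (k.+1%:R^-1 * k`!%:R^-1) * t ^+ k.+1.
  by move: (t ^+ _) (S ^+ _) (_^-1) (_^-1) => a b a1 a2; ring.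
exact: lexx.
Qed.

(** Sharing a radius [r] among K = k+1 differentiations bounds the derivatives of order K by
    M((n+1)K/r)^K. Since K^K/K! <= e^K, the Taylor remainder of order K is at most M/2^K on a cube
    whose size does not depend on K. *)
Theorem unique_continuation Omega g z : open Omega -> harmonic_on Omega g -> Omega z ->
  (forall s, iter_partial s g z = 0) ->
  exists2 d : R, 0 < d & forall y, cube z d y -> g y = 0.
Proof.
have aux (a b M c f : R) : a * b * M * c * f = M * (a * (c * (b * f))) by ring.
move=> oO Hg Oz H; have [d d0 Hd] := open_cube oO Oz.
pose r := d / 4; have r0 : 0 < r by rewrite divr_gt0.
have Or y : (forall j, `|y ord0 j - z ord0 j| <= r + r) -> Omega y.
  by move=> Hy; apply: Hd => j; rewrite (le_lt_trans (Hy j))// /r; lra.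
have [|M M0 HM] := @bounded_on_cube _ _ g z (r + r) _ (addr_gt0 r0 r0).
  by move=> y /Or Oy; exact: (C_on_continuous oO Hg.1 Oy).
pose E := expR (1 : R); have E0 : 0 < E by exact: expR_gt0.
(* Solves (n+1)/r * (n+1)r/q * e = 1/2, the ratio of the geometric bound. *)
pose q := n.+1%:R * E * (n.+1%:R) * 2 : R.
have q1 : 1 <= q.
  have n1 : 1 <= n.+1%:R :> R by rewrite ler1n.
  have E1 : 1 <= E by rewrite (le_trans _ (expR_ge1Dx 1))// lerDl.
  have h1 : 1 <= n.+1%:R * E by exact: mulr_ege1.
  have h2 : 1 <= n.+1%:R * E * n.+1%:R by exact: mulr_ege1.
  by rewrite /q; lra.
have q0 : 0 < q by rewrite (lt_le_trans ltr01).
have dr : 0 < r / q by rewrite divr_gt0.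
exists (r / q) => // y Hy; pose x := y - z.
have yE : y = z + 1 *: x by rewrite scale1r /x addrC subrK.
have xr j : `|x ord0 j| <= r / q by rewrite !mxE ltW//; exact: Hy.
have xt (t : R) j : 0 <= t <= 1 -> `|(z + t *: x) ord0 j - z ord0 j| <= r.
  move=> /andP[t0 t1]; rewrite [(z + _) _ _]mxE [(t *: x) _ _]mxE addrC addKr normrM (ger0_norm t0).
  apply: le_trans (_ : r / q <= r); last by rewrite ler_pdivrMr// ler_peMr// ltW.
  by apply: le_trans (xr j); rewrite ler_piMl.
have S0 : 0 <= \sum_i `|x ord0 i| by rewrite sumr_ge0.
have key k : `|g y| <= M * 2^-1 ^+ k.+1.
  pose K : R := k.+1%:R; have K0 : 0 < K by [].
  have h0 : 0 < r / K by rewrite divr_gt0.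
  pose B := (n.+1%:R / (r / K)) ^+ k.+1 * M.
  have B0 : 0 <= B by rewrite mulr_ge0 ?exprn_ge0 ?divr_ge0 ?ltW.
  have := @taylor_bound Omega k.+1 g z x B oO Hg B0 _ (fun s _ => H s) _ 1.
  rewrite -yE ler01 lexx expr1n mulr1 => H'; apply: le_trans (H' _ _ isT) _.
  - move=> t t01; apply: Or => j; apply: le_trans (xt t j t01) _.
    by rewrite lerDl ltW.
  - move=> s t sk t01; rewrite /B -sk.
    apply: (@iter_partial_bound Omega s g z r (r / K) M oO Hg (ltW r0) h0 M0); last by move=> j; exact: xt.
    move=> w Hw; have Hw' j : `|w ord0 j - z ord0 j| <= r + r.
      by apply: le_trans (Hw j) _; rewrite sk mulrC divfK// gt_eqF.
    by split; [exact: Or|exact: HM].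
  have xS : \sum_i `|x ord0 i| <= n.+1%:R * (r / q).
    apply: le_trans (ler_sum _ (fun i _ => xr i)) _.
    by rewrite sumr_const card_ord -[X in X <= _]mulr_natl ler_wpM2r ?(ltW dr)// ler_nat.
  have KE : K ^+ k.+1 / (k.+1)`!%:R <= E ^+ k.+1.
    by rewrite /E -expRM_natl mulr1 (le_trans _ (expR_ge1Dxn k (ltW K0)))// lerDr.
  have f0 : 0 < (k.+1)`!%:R^-1 :> R by rewrite invr_gt0 ltr0n fact_gt0.
  have h1 : (\sum_i `|x ord0 i|) ^+ k.+1 <= (n.+1%:R * (r / q)) ^+ k.+1.
    by rewrite lerXn2r ?nnegrE// mulr_ge0// ltW.
  rewrite /B.
  have -> : (n.+1%:R / (r / K)) ^+ k.+1 * M * (\sum_i `|x ord0 i|) ^+ k.+1 / (k.+1)`!%:R =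
     M * ((n.+1%:R / r) ^+ k.+1 * ((\sum_i `|x ord0 i|) ^+ k.+1 * (K ^+ k.+1 / (k.+1)`!%:R))).
    have -> : n.+1%:R / (r / K) = n.+1%:R / r * K by rewrite invfM invrK mulrA.
    rewrite [(_ / r * K) ^+ _]exprMn.
    exact: aux.
  rewrite ler_wpM2l ?(ltW M0)//.
  have -> : (2^-1 : R) ^+ k.+1 = (n.+1%:R / r) ^+ k.+1 * ((n.+1%:R * (r / q)) ^+ k.+1 * E ^+ k.+1).
    rewrite -!exprMn; congr (_ ^+ _); rewrite /q; field.
    by rewrite !gt_eqF// nat1r; apply/andP; split.
  apply: ler_wpM2l; first by rewrite exprn_ge0// divr_ge0// ltW.
  apply: ler_pM h1 KE; first exact: exprn_ge0.
  by rewrite mulr_ge0 ?(ltW f0)// exprn_ge0// ltW.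
apply/eqP; rewrite -normr_le0 leNgt; apply/negP => g0.
have := archi_boundP (ltW (divr_gt0 M0 g0)); set k := Num.bound _ => hk.
have := key k; rewrite leNgt => /negP; apply.
rewrite exprVn ltr_pdivrMr ?exprn_gt0// mulrC -ltr_pdivrMr//.
apply: lt_trans hk _; rewrite -natrX ltr_nat.
by rewrite (ltn_trans (ltn_expl k (ltnSn 1)))// ltn_exp2l.
Qed.

End LeadingTerm.

Section LeadingTermMore.
Context {R : realType} {n : nat}.
Implicit Types (Omega : set 'rV[R]_n) (g u v : 'rV[R]_n -> R) (x y z : 'rV[R]_n).
Local Notation e i := (@basis_vec R n i).

Lemma taylor_formZ Omega m (a : R) g z x : open Omega -> harmonic_on Omega g -> Omega z ->
  taylor_form m z (fun y => a * g y) x = a * taylor_form m z g x.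
Proof.
move=> oO; elim: m g => [|m IH] g Hg Oz //=.
rewrite [RHS]mulrCA; congr (_ * _); rewrite mulr_sumr; apply: eq_bigr => i _.
rewrite [RHS]mulrCA; congr (_ * _).
rewrite -(IH _ (harmonic_partial i oO Hg) Oz).
have E : {in Omega, partial i (fun y => a * g y) =1 (fun y => a * partial i g y)}.
  by move=> y; rewrite inE => Oy; rewrite (partialZ a (C_on_derivable Hg.1 Oy)).
by rewrite (taylor_form_eq m oO E Oz).
Qed.

Lemma iter_partial_cst0 s x : iter_partial s (fun=> 0) x = 0.
Proof.
elim: s => //= i s IH.
by have -> : partial i (fun=> 0) = (fun=> 0 : R) :> ('rV[R]_n -> R) by apply/funext => y; rewrite partial_cst.
Qed.

Lemma iter_partial_dir Omega s (c : 'I_n -> R) g z : open Omega -> harmonic_on Omega g ->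
  Omega z -> iter_partial s (fun y => \sum_k c k * partial k g y) z =
    \sum_k c k * partial k (iter_partial s g) z.
Proof.
move=> oO; elim: s g => [|i s IH] g Hg Oz //=.
rewrite -(IH _ (harmonic_partial i oO Hg) Oz).
have dk k y : Omega y -> derivable (partial k g) y (e i).
  by move=> Oy; exact: (C_on_derivable (C_on_partial k Hg.1) Oy).
apply: (iter_partial_eq s oO _ Oz) => y; rewrite inE => Oy.
rewrite partial_bigsum => [|k]; last first.
  by apply: derivableM; [exact: derivable_cst|exact: dk].
by apply: eq_bigr => k _; rewrite (partialZ _ (dk k y Oy)) (partialC _ _ oO Hg.1 Oy).
Qed.

Lemma taylor_form_cvg Omega m z g x : open Omega -> harmonic_on Omega g -> Omega z ->
  (forall s, (size s < m)%N -> iter_partial s g z = 0) ->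
  g (z + t *: x) / t ^+ m @[t --> (0:R)^'+] --> taylor_form m z g x.
Proof.
move=> oO Hg Oz H; apply/cvgrPdist_le => a a0.
have [d d0 Hd] := taylor_form_limit x oO Hg Oz H a0.
near=> t; have t0 : 0 < t by near: t; exact: nbhs_right_gt.
have td : t < d by near: t; exact: nbhs_right_lt.
have tm : 0 < t ^+ m by rewrite exprn_gt0.
have := Hd t; rewrite (ltW t0) td => /(_ isT) h.
rewrite distrC -(ler_pM2r tm); apply: le_trans h.
rewrite -[X in _ * X](gtr0_norm tm) -normrM mulrBl divfK ?gt_eqF//.
by rewrite [_ * t ^+ m]mulrC.
Unshelve. all: by end_near. Qed.

End LeadingTermMore.

(** * Nonvanishing of the Jacobian *)

Section Lewy.
Context {R : realType}.
Implicit Types (Omega : set 'rV[R]_3) (h p : 'I_3 -> 'I_3 -> 'rV[R]_3 -> R).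
Implicit Types (x y z : 'rV[R]_3).

Definition hess_mx h x : 'M[R]_3 := \matrix_(i, j) h i j x.

(* Equivalent to the comparability of all the singular values of [hess_mx h x]. *)
Definition bounded_distortion (C : R) Omega h : Prop :=
  forall x, Omega x -> sumsq (hess_mx h x) ^+ 3 <= C * hess_det h x ^+ 2.

Definition leading m z h : 'I_3 -> 'I_3 -> 'rV[R]_3 -> R :=
  fun i j => taylor_form m z (h i j).

Definition flat_at m z h : Prop :=
  forall i j s, (size s < m)%N -> iter_partial s (h i j) z = 0.

Lemma sumsqE h x : sumsq (hess_mx h x) = \sum_i \sum_j h i j x ^+ 2.
Proof. by apply: eq_bigr => i _; apply: eq_bigr => j _; rewrite mxE. Qed.

Lemma sumsq_ge0 (A : 'M[R]_3) : 0 <= sumsq A.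
Proof. by apply: sumr_ge0 => i _; apply: sumr_ge0 => j _; exact: sqr_ge0. Qed.

Lemma sumsq_eq0 (A : 'M[R]_3) : sumsq A = 0 -> A = 0.
Proof.
move=> S0; apply/matrixP => i j; rewrite mxE.
have Si : \sum_j A i j ^+ 2 = 0.
  have := S0; rewrite /sumsq => /eqP; rewrite psumr_eq0 => [/allP /(_ i)|k _].
    by rewrite mem_index_enum => /(_ isT) /eqP.
  by apply: sumr_ge0 => l _; exact: sqr_ge0.
move/eqP: Si; rewrite psumr_eq0 => [/allP /(_ j)|k _]; last exact: sqr_ge0.
by rewrite mem_index_enum sqrf_eq0 => /(_ isT) /eqP.
Qed.

Lemma distortion_det0 C Omega h x : bounded_distortion C Omega h -> Omega x ->
  hess_det h x = 0 -> forall i j, h i j x = 0.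
Proof.
move=> D Ox d0 i j; have := D x Ox; rewrite d0 expr0n/= mulr0 => S0.
have : sumsq (hess_mx h x) = 0.
  have : sumsq (hess_mx h x) ^+ 3 == 0 by rewrite eq_le S0 exprn_ge0// sumsq_ge0.
  by rewrite expf_eq0 => /andP[_ /eqP].
by move=> /sumsq_eq0 /matrixP/(_ i j); rewrite !mxE.
Qed.

Lemma leading_hessian Omega m z h : harmonic_hessian Omega h -> Omega z ->
  harmonic_hessian setT (leading m z h).
Proof.
move=> [oO Hh hs htr hc] Oz; split.
- exact: openT.
- by move=> i j; exact: taylor_form_harmonic oO (Hh i j) Oz.
- move=> i j x _; have E : {in Omega, h i j =1 h j i} by move=> y; rewrite inE; exact: hs.
  by rewrite /leading (taylor_form_eq m oO E Oz).
- move=> x _; rewrite /leading -(taylor_form_sum m x oO Oz); last by move=> i; exact: Hh.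
  have E : {in Omega, (fun y => \sum_i h i i y) =1 (fun=> 0)} by move=> y; rewrite inE; exact: htr.
  by rewrite (taylor_form_eq m oO E Oz) taylor_form_cst0.
- move=> i j k x _; rewrite /leading; case: m => [|m].
    by rewrite !partial_cst.
  rewrite (taylor_form_partial m k oO (Hh i j) Oz) (taylor_form_partial m i oO (Hh k j) Oz).
  have E : {in Omega, partial k (h i j) =1 partial i (h k j)} by move=> y; rewrite inE; exact: hc.
  by rewrite (taylor_form_eq m oO E Oz).
Qed.

Lemma cvg_mul {T : Type} (F : set_system T) (FF : Filter F) (f g : T -> R) (a b : R) :
  f @ F --> a -> g @ F --> b -> (fun t => f t * g t) @ F --> a * b.
Proof. exact: cvgM. Qed.

Lemma cvg_sub {T : Type} (F : set_system T) (FF : Filter F) (f g : T -> R) (a b : R) :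
  f @ F --> a -> g @ F --> b -> (fun t => f t - g t) @ F --> a - b.
Proof. exact: cvgB. Qed.

Lemma cvg_add {T : Type} (F : set_system T) (FF : Filter F) (f g : T -> R) (a b : R) :
  f @ F --> a -> g @ F --> b -> (fun t => f t + g t) @ F --> a + b.
Proof. exact: cvgD. Qed.

Lemma cvg_sum3 {T : Type} (F : set_system T) {FF : Filter F} (f : 'I_3 -> T -> R) (l : 'I_3 -> R) :
  (forall i, f i @ F --> l i) -> (fun t => \sum_i f i t) @ F --> \sum_i l i.
Proof.
move=> H; rewrite sum3; under eq_fun do rewrite sum3.
exact: cvgD (cvgD (H 0) (H 1)) (H 2%:R).
Qed.

Lemma cvg_det3 {T : Type} (F : set_system T) (FF : Filter F) (f : 'I_3 -> 'I_3 -> T -> R)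
    (l : 'I_3 -> 'I_3 -> R) : (forall i j, f i j @ F --> l i j) ->
  (fun t => det3 (f 0 ^~ t) (f 1 ^~ t) (f 2%:R ^~ t)) @ F --> det3 (l 0) (l 1) (l 2%:R).
Proof.
move=> H; rewrite /det3.
pose m (i j k o : 'I_3) := cvg_sub FF (cvg_mul FF (H 1 i) (H 2%:R j)) (cvg_mul FF (H 1 k) (H 2%:R o)).
exact: (cvg_add FF (cvg_sub FF (cvg_mul FF (H 0 0) (m 1 2%:R 2%:R 1))
  (cvg_mul FF (H 0 1) (m 0 2%:R 2%:R 0))) (cvg_mul FF (H 0 2%:R) (m 0 1 1 0))).
Qed.

(** Both sides are homogeneous of degree 6 in the entries, so the inequality survives division by
    t^(6m) and passes to the limit along z + t x. *)
Lemma leading_distortion C Omega m z h : harmonic_hessian Omega h -> Omega z ->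
  bounded_distortion C Omega h -> flat_at m z h ->
  bounded_distortion C setT (leading m z h).
Proof.
move=> [oO Hh _ _ _] Oz D fl x _.
pose f i j (t : R) := h i j (z + t *: x) / t ^+ m.
have cf i j : f i j t @[t --> (0:R)^'+] --> leading m z h i j x.
  by apply: taylor_form_cvg oO (Hh i j) Oz _ => s; exact: fl.
pose G (t : R) := C * det3 (f 0 ^~ t) (f 1 ^~ t) (f 2%:R ^~ t) ^+ 2 -
  (\sum_i \sum_j f i j t ^+ 2) ^+ 3.
have cG : G t @[t --> (0:R)^'+] --> C * hess_det (leading m z h) x ^+ 2 -
    sumsq (hess_mx (leading m z h) x) ^+ 3.
  rewrite hess_detE sumsqE.
  have FF : Filter (0:R)^'+ by exact: at_right_proper_filter.
  have cd := cvg_det3 FF cf.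
  have cS : (\sum_i \sum_j f i j t ^+ 2) @[t --> (0:R)^'+] --> \sum_i \sum_j leading m z h i j x ^+ 2.
    by apply: cvg_sum3 => i; apply: cvg_sum3 => j; exact: (cvg_mul FF (cf i j) (cf i j)).
  exact: (cvg_sub FF (cvg_mul FF (cvg_cst C) (cvg_mul FF cd cd)) (cvg_mul FF cS (cvg_mul FF cS cS))).
rewrite -subr_ge0; apply: (cvgr_to_ge cG).
have [d d0 Hd] := open_cube oO Oz.
pose M := 1 + \sum_i `|x ord0 i|.
have M0 : 0 < M by rewrite ltr_pwDl// sumr_ge0.
have dM : 0 < d / M by rewrite divr_gt0.
near=> t; have t0 : 0 < t by near: t; exact: nbhs_right_gt.
have td : t < d / M by near: t; exact: nbhs_right_lt.
have Ot : Omega (z + t *: x).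
  apply: Hd => i; rewrite !mxE [z _ _ + _]addrC addrK normrM (gtr0_norm t0).
  move: td; rewrite ltr_pdivlMr// => td; apply: le_lt_trans td.
  rewrite ler_wpM2l ?(ltW t0)// /M (bigD1 i)//= addrCA lerDl addr_ge0// sumr_ge0//.
have := D _ Ot; rewrite sumsqE hess_detE /G subr_ge0.
have tm : t ^+ m != 0 by rewrite gt_eqF// exprn_gt0.
have -> : \sum_i \sum_j f i j t ^+ 2 = (\sum_i \sum_j h i j (z + t *: x) ^+ 2) * (t ^+ m)^-1 ^+ 2.
  by rewrite mulr_suml; apply: eq_bigr => i _; rewrite mulr_suml; apply: eq_bigr => j _; rewrite -exprMn.
have -> : det3 (f 0 ^~ t) (f 1 ^~ t) (f 2%:R ^~ t) = (t ^+ m)^-1 ^+ 3 *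
    det3 (h 0 ^~ (z + t *: x)) (h 1 ^~ (z + t *: x)) (h 2%:R ^~ (z + t *: x)).
  by rewrite /det3 /f; ring.
move: (\sum_i _) (det3 _ _ _) (t ^+ m)^-1 => S d' w Hw.
have -> : (S * w ^+ 2) ^+ 3 = S ^+ 3 * w ^+ 6 by ring.
have -> : C * (w ^+ 3 * d') ^+ 2 = C * d' ^+ 2 * w ^+ 6 by ring.
by rewrite ler_wpM2r// (_ : w ^+ 6 = (w ^+ 3) ^+ 2) ?sqr_ge0// -exprM.
Unshelve. all: by end_near. Qed.

Lemma leading_iter_partial Omega z h i j s x : harmonic_hessian Omega h -> Omega z ->
  iter_partial s (leading (size s) z h i j) x = iter_partial s (h i j) z.
Proof.
move=> [oO Hh _ _ _] Oz.
by rewrite /leading -[size s]addn0 (iter_partial_taylor s 0 oO (Hh i j) Oz).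
Qed.

Definition has_order m z h := flat_at m z h /\
  exists i j s, size s = m /\ iter_partial s (h i j) z != 0.

Lemma exists_order z h i j s : iter_partial s (h i j) z != 0 ->
  exists2 m, (m <= size s)%N & has_order m z h.
Proof.
move=> H; pose P m := `[< exists i j s, size s = m /\ iter_partial s (h i j) z != 0 >].
have exP : exists m, P m by exists (size s); apply/asboolP; exists i, j, s.
case: (ex_minnP exP) => m /asboolP Pm min; exists m.
  by apply: min; apply/asboolP; exists i, j, s.
split => // i' j' s' sm; apply/eqP; apply: contraTT sm => ne; rewrite -leqNgt.
by apply: min; apply/asboolP; exists i', j', s'.
Qed.

(** A homogeneous function that vanishes at [e0] vanishes on the whole line through [e0] and 0, so
    its derivative in the direction [e0] is 0. *)
Lemma homog_deriv0 (g : 'rV[R]_3 -> R) r (e0 : 'rV[R]_3) : harmonic_on setT g ->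
  (forall x (t : R), g (t *: x) = t ^+ r * g x) -> g e0 = 0 ->
  \sum_k e0 ord0 k * partial k g e0 = 0.
Proof.
move=> Hg hom g0.
have [_ <-] := C1_is_derive e0 openT (C_onS openT Hg.1) (I : setT e0).
suff [_ E] : is_derive e0 e0 g 0 by [].
apply/is_derive_eps => a a0; exists 1 => // t _.
rewrite -{1}[e0]scale1r -scalerDl hom g0 mulr0 mul0r !subr0 normr0.
by rewrite mulr_ge0// ltW.
Qed.

(* If the leading term vanishes at [e0 != 0], its own leading term [q] at [e0] satisfies
   [e0 q = 0] by Euler's identity, so [det q = 0] and the distortion bound gives [q = 0]. *)
Lemma leading_nonzero C Omega m z h : harmonic_hessian Omega h -> Omega z ->
  bounded_distortion C Omega h -> has_order m z h ->
  forall x, x != 0 -> hess_det (leading m z h) x != 0.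
Proof.
move=> Hh Oz D [fl [i0 [j0 [s0 [sm ne]]]]] e0 e0n0; apply/eqP => d0.
set p := leading m z h.
have Hp : harmonic_hessian setT p by exact: (leading_hessian m Hh Oz).
have Dp : bounded_distortion C setT p by exact: (leading_distortion Hh Oz D fl).
have p0 := distortion_det0 Dp (I : setT e0) d0.
have [oO Hh' _ _ _] := Hh; have [_ Hp' _ _ cp] := Hp.
have nep : iter_partial s0 (p i0 j0) e0 != 0.
  by rewrite /p -sm (leading_iter_partial i0 j0 s0 e0 Hh Oz).
have [m' m'm [flp [i1 [j1 [s1 [s1m ne1]]]]]] := exists_order nep.
rewrite sm in m'm.
have m'0 : (0 < m')%N.
  case: (m') s1m => // /size0nil s10; move: ne1; rewrite s10 /= p0 eqxx //.
pose q := leading m' e0 p.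
have Hq : harmonic_hessian setT q by exact: (leading_hessian m' Hp (I : setT e0)).
have Dq : bounded_distortion C setT q by exact: (leading_distortion Hp (I : setT e0) Dp flp).
(* As m' > 0, a derivative of order [m'] begins with some [partial i], and the Codazzi condition
   turns [partial i] of the sum of e0_k p_kj into the sum of e0_k [partial k] of p_ij. The remaining
   derivatives commute with this sum and leave the radial derivative at [e0] of a homogeneous
   derivative of p_ij of order below m', which vanishes at [e0]. *)
have qe j x : \sum_k e0 ord0 k * q k j x = 0.
  have -> : \sum_k e0 ord0 k * q k j x = taylor_form m' e0 (fun y => \sum_k e0 ord0 k * p k j y) x.
    rewrite (taylor_form_sum m' x openT (I : setT e0)) => [|k].
      by apply: eq_bigr => k _; rewrite (taylor_formZ _ _ _ openT (Hp' k j) (I : setT e0)).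
    exact: harmonicZ openT (Hp' k j).
  apply: taylor_form_eq0 => -[|i s] ss; first by rewrite -ss in m'0.
  rewrite /=.
  have -> : partial i (fun y => \sum_k e0 ord0 k * p k j y) =
      (fun y => \sum_k e0 ord0 k * partial k (p i j) y).
    apply/funext => y; have dk k : derivable (p k j) y (basis_vec i).
      exact: (C_on_derivable (Hp' k j).1 (I : setT y)).
    rewrite partial_bigsum => [|k]; last by apply: derivableM; [exact: derivable_cst|exact: dk].
    by apply: eq_bigr => k _; rewrite (partialZ _ (dk k)) (cp i j k y I).
  rewrite (iter_partial_dir s _ openT (Hp' i j) (I : setT e0)).
  have sm' : (size s <= m)%N by rewrite (leq_trans _ m'm)// -ss /=.
  have E : iter_partial s (p i j) = taylor_form (m - size s) z (iter_partial s (h i j)).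
    by rewrite /p /leading -{1}(subnKC sm') (iter_partial_taylor _ _ oO (Hh' i j) Oz).
  apply: (@homog_deriv0 _ (m - size s)).
  - exact: iter_partial_harmonic openT (Hp' i j).
  - by move=> x' t; rewrite E taylor_form_homog.
  - by apply: flp; rewrite -ss /=.
have dq x : hess_det q x = 0.
  apply/eqP; apply: contraT => dn0.
  have U : hess_mx q x \in unitmx by rewrite unitmxE unitfE.
  have : e0 *m hess_mx q x = 0.
    apply/rowP => j; rewrite !mxE -[RHS](qe j x); apply: eq_bigr => k _; by rewrite mxE.
  move/(congr1 (fun A => A *m invmx (hess_mx q x))); rewrite mulmxK// mul0mx => e00.
  by rewrite e00 eqxx in e0n0.
have q0 i j : q i j = (fun=> 0).
  by apply/funext => x; exact: distortion_det0 Dq (I : setT x) (dq x) i j.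
move: ne1; rewrite -(leading_iter_partial i1 j1 s1 e0 Hp (I : setT e0)) s1m -/q.
by rewrite q0 iter_partial_cst0 eqxx.
Qed.

Lemma jet_dot x : jet (fun y : 'rV[R]_3 => dot y y) x (fun i => 2 * x ord0 i) (fun=> 2).
Proof.
have H := jet_sum (fun k => jet_sqr (jet_coord k x)).
move: H; under [X in jet X]eq_fun => y do under eq_bigr do rewrite expr2.
move=> H; apply: (jet_eq H) => i.
  rewrite (bigD1 i)//= big1 => [|k ki]; first by rewrite eqxx mulr1 addr0.
  by rewrite (negbTE ki) mulr0.
rewrite (bigD1 i)//= big1 => [|k ki]; first by rewrite eqxx mulr0 add0r expr1n mulr1 addr0.
by rewrite (negbTE ki) mulr0 expr0n/= mulr0 addr0.
Qed.

Lemma continuous_dotxx x : {for x, continuous (fun y : 'rV[R]_3 => dot y y)}.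
Proof. by apply: continuous_dot => i; exact: coord_continuous. Qed.

Lemma compact_sphere : compact [set x : 'rV[R]_3 | dot x x = 1].
Proof.
apply: (subclosed_compact _ (@compact_cbox R 3 (fun=> -1) (fun=> 1))).
  apply: (@preimage_closed _ _ (fun v : 'rV[R]_3 => dot v v) [set 1]).
    by move=> x _; exact: continuous_dotxx.
  exact: closed_eq.
move=> x /= x1 i; rewrite -ler_norml.
by rewrite -(@ler_pXn2r _ 2)// ?nnegrE// expr1n real_normK ?num_real// -x1 dot_coord_le.
Qed.

Lemma dot0l x : dot 0 x = 0.
Proof. by rewrite /dot big1// => i _; rewrite mxE mul0r. Qed.

Lemma dot_gt0 x : x != 0 -> 0 < dot x x.
Proof.
by move=> x0; rewrite lt_neqAle dot_ge0 andbT eq_sym; apply: contra_neq x0; exact: dot_eq0.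
Qed.

Lemma hess_det_continuous Omega h x : harmonic_hessian Omega h -> Omega x ->
  {for x, continuous (hess_det h)}.
Proof.
move=> [oO Hh _ _ _] Ox; apply: (continuous_det3 (F := hess_mx h)) => i j.
have -> : (fun y => hess_mx h y i j) = h i j by apply/funext => y; rewrite mxE.
exact: C_on_continuous oO (Hh i j).1 Ox.
Qed.

(* On the unit sphere the minimum of [ln (det p)^2 - 3 m ln |x|^2] is a local
   minimum in space, although this function is strictly superharmonic. *)
Lemma homogeneous_det_zero p m : harmonic_hessian setT p -> (0 < m)%N ->
  (forall i j x (t : R), p i j (t *: x) = t ^+ m * p i j x) ->
  exists2 x, x != 0 & hess_det p x = 0.
Proof.
move=> Hp m0 hom; apply: contrapT => nz.
have {}nz x : x != 0 -> 0 < hess_det p x ^+ 2.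
  move=> x0; rewrite lt_neqAle sqr_ge0 andbT eq_sym sqrf_eq0.
  by apply/eqP => d0; apply: nz; exists x.
(* The degree of [hess_det p], a cubic expression in entries of degree [m]. *)
pose k := (m * 3)%N.
have homD x (t : R) : hess_det p (t *: x) = t ^+ k * hess_det p x.
  rewrite !hess_detE /det3 !hom /k exprM.
  by move: (t ^+ m) => s; ring.
pose phi x := ln (hess_det p x ^+ 2) - k%:R * ln (dot x x).
have homphi x (t : R) : 0 < t -> x != 0 -> phi (t *: x) = phi x.
  move=> t0 x0; rewrite /phi homD dotZl dotZr mulrA -expr2 exprMn -exprM mulnC exprM.
  have t2 : 0 < t ^+ 2 by rewrite exprn_gt0.
  have mul (a b : R) : 0 < a -> 0 < b -> ln (a * b) = ln a + ln b by move=> a0 b0; rewrite lnM.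
  rewrite (mul _ _ (exprn_gt0 k t2) (nz x x0)) (mul _ _ t2 (dot_gt0 x0)) (lnXn _ t2) -[_ *+ k]mulr_natl.
  by move: (ln _) (ln _) (ln _) => a b c; ring.
have cphi x : x != 0 -> {for x, continuous phi}.
  move=> x0; apply: continuousB.
    apply: (@continuous_comp _ _ _ (fun y => hess_det p y ^+ 2) (@ln R)).
      by apply: continuousM; exact: (hess_det_continuous Hp (I : setT x)).
    exact/continuous_ln/nz.
  apply: continuousM; first exact: cst_continuous.
  apply: (@continuous_comp _ _ _ (fun y : 'rV[R]_3 => dot y y) (@ln R)).
    exact: continuous_dotxx.
  exact/continuous_ln/dot_gt0.
have S0 x : dot x x = 1 -> x != 0.
  by move=> x1; apply: contra_eq_neq x1 => ->; rewrite dot0l eq_sym oner_eq0.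
have [||x0 x01 Hx0] := @compact_argmax R 3 _ (fun x => - phi x) compact_sphere.
- exists (basis_vec 0); rewrite /= /dot (bigD1 0)//= big1 => [|j j0].
    by rewrite basis_vecE eqxx mulr1 addr0.
  by rewrite basis_vecE (negbTE j0) mulr0.
- by move=> x x1; apply: continuousN; exact/cphi/S0.
have x0n0 := S0 _ x01.
have lmin : exists2 d : R, 0 < d & forall y, cube x0 d y -> - phi y <= - phi x0.
  have /continuous_cube/(_ 1 ltr01)[d d0 Hd] := continuous_dotxx (x := x0).
  exists d => // y /Hd; rewrite x01 => /ltr_normlP[h1 h2].
  have y0 : 0 < dot y y by lra.
  have yn0 : y != 0.
    by apply: contraTneq y0 => ->; rewrite dot0l ltxx.
  have s0 : 0 < (Num.sqrt (dot y y))^-1 by rewrite invr_gt0 sqrtr_gt0.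
  rewrite -(homphi y _ s0 yn0); apply: Hx0.
  rewrite /= dotZl dotZr mulrA -invfM -expr2 sqr_sqrtr ?ltW// mulVf// gt_eqF//.
have [b [c [jD sup]]] := hess_det_superharmonic Hp (I : setT x0).
have j1 := jet_ln (jet_sqr jD) (nz _ x0n0).
have j2 := jet_ln (jet_dot x0) (dot_gt0 x0n0).
have [_] := jet_max_lap (jetN (jetB j1 (jetZ k%:R j2))) lmin.
have Dn0 : hess_det p x0 != 0 by rewrite -sqrf_eq0 gt_eqF// nz.
move: sup x01; rewrite /= /dot !sum3; move: (hess_det p x0) Dn0 => J J0.
move: (x0 ord0 0) (x0 ord0 1) (x0 ord0 2%:R) (b 0) (b 1) (b 2%:R) (c 0) (c 1) (c 2%:R).
move=> X Y Z b0 b1 b2 c0 c1 c2 sup xyz; rewrite xyz.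
have k0 : 0 < k%:R :> R by rewrite ltr0n muln_gt0 m0.
(* At a unit vector the Laplacian of ln |x|^2 is 6 - 4 = 2, so the last term equals 2k > 0, and the
   first is nonnegative by superharmonicity; a maximum of -phi forbids a positive sum. *)
have -> : - ((2 * J * c0 + 2 * b0 ^+ 2) / J ^+ 2 - (2 * J * b0 / J ^+ 2) ^+ 2 -
      k%:R * (2 / 1 - (2 * X / 1) ^+ 2)) +
    - ((2 * J * c1 + 2 * b1 ^+ 2) / J ^+ 2 - (2 * J * b1 / J ^+ 2) ^+ 2 -
      k%:R * (2 / 1 - (2 * Y / 1) ^+ 2)) +
    - ((2 * J * c2 + 2 * b2 ^+ 2) / J ^+ 2 - (2 * J * b2 / J ^+ 2) ^+ 2 -
      k%:R * (2 / 1 - (2 * Z / 1) ^+ 2)) =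
  2 * (b0 ^+ 2 + b1 ^+ 2 + b2 ^+ 2 - J * (c0 + c1 + c2)) / J ^+ 2 +
  k%:R * (6 - 4 * (X * X + Y * Y + Z * Z)) by field.
rewrite xyz; apply/negP; rewrite -ltNge.
have h1 : 0 <= 2 * (b0 ^+ 2 + b1 ^+ 2 + b2 ^+ 2 - J * (c0 + c1 + c2)) / J ^+ 2.
  by rewrite mulr_ge0 ?invr_ge0 ?sqr_ge0// mulr_ge0// subr_ge0.
rewrite (lt_le_trans _ (lerD h1 (lexx _)))// add0r mulr_gt0//; lra.
Qed.

(** Since the entries do not all vanish near [z], unique continuation makes the order at [z] finite,
    and it is positive if the determinant vanishes there. Then [homogeneous_det_zero] and
    [leading_nonzero] contradict each other. *)
Theorem lewy C Omega h z : harmonic_hessian Omega h -> bounded_distortion C Omega h ->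
  Omega z -> (forall d : R, 0 < d -> exists i j y, cube z d y /\ h i j y != 0) ->
  hess_det h z != 0.
Proof.
move=> Hh D Oz nconst; apply/eqP => d0.
have h0 := distortion_det0 D Oz d0; have [oO Hh' _ _ _] := Hh.
have [i [j [s ne]]] : exists i j s, iter_partial s (h i j) z != 0.
  apply: contrapT => none.
  have all0 i j s : iter_partial s (h i j) z = 0.
    by apply/eqP; apply: contraT => ne; case: none; exists i, j, s.
  have [|d d1 Hd] := @cube_forall _ _ z (fun i y => forall j, h i j y = 0).
    move=> i; have [|d d1 Hd] := @cube_forall _ _ z (fun j y => h i j y = 0).
      by move=> j; exact: unique_continuation oO (Hh' i j) Oz (all0 i j).
    by exists d => // y zy j; exact: Hd.
  by have [i [j [y [zy]]]] := nconst d d1; rewrite Hd// eqxx.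
have [m _ Om] := exists_order ne.
have m0 : (0 < m)%N.
  case: m Om => // -[_ [i' [j' [s' [/size0nil -> /=]]]]].
  by rewrite h0 eqxx.
have [|x x0 dx] := homogeneous_det_zero (leading_hessian m Hh Oz) m0.
  by move=> i' j' x t; exact: taylor_form_homog.
by have := leading_nonzero Hh Oz D Om x0; rewrite dx eqxx.
Qed.

End Lewy.

(** * Estimates up to the boundary *)

Section Euclid3.
Context {R : realType}.
Implicit Types (a b v w x y : 'rV[R]_3) (A : 'M[R]_3).

Lemma cauchy_schwarz v w : dot v w ^+ 2 <= dot v v * dot w w.
Proof.
rewrite /dot !sum3 -subr_ge0.
move: (v ord0 0) (v ord0 1) (v ord0 2%:R) (w ord0 0) (w ord0 1) (w ord0 2%:R) => a b c d e f.
have -> : (a * a + b * b + c * c) * (d * d + e * e + f * f) - (a * d + b * e + c * f) ^+ 2 =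
  (a * e - b * d) ^+ 2 + (a * f - c * d) ^+ 2 + (b * f - c * e) ^+ 2 by ring.
by rewrite !addr_ge0 ?sqr_ge0.
Qed.

Lemma enormE v : enorm v = Num.sqrt (dot v v).
Proof. by rewrite /enorm /dot; congr Num.sqrt; apply: eq_bigr => i _; rewrite expr2. Qed.

Lemma enorm_ge0 v : 0 <= enorm v.
Proof. by rewrite enormE sqrtr_ge0. Qed.

Lemma sqr_enorm v : enorm v ^+ 2 = dot v v.
Proof. by rewrite enormE sqr_sqrtr ?dot_ge0. Qed.

Lemma dot_le_enorm v w : dot v w <= enorm v * enorm w.
Proof.
have [d0|d0] := leP (dot v w) 0; first by rewrite (le_trans d0)// mulr_ge0 ?enorm_ge0.
rewrite -(@ler_pXn2r _ 2) ?nnegrE ?mulr_ge0 ?enorm_ge0 ?(ltW d0)//.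
by rewrite exprMn !sqr_enorm; exact: cauchy_schwarz.
Qed.

Lemma enormD v w : enorm (v + w) <= enorm v + enorm w.
Proof.
rewrite -(@ler_pXn2r _ 2) ?nnegrE ?addr_ge0 ?enorm_ge0//.
rewrite sqr_enorm sqrrD !sqr_enorm dotDl !dotDr [dot w v]dotC.
by have := dot_le_enorm v w; move: (dot v w) (_ * _) => p q; lra.
Qed.

Lemma enormN v : enorm (- v) = enorm v.
Proof. by rewrite !enormE -scaleN1r dotZl dotZr mulrA mulrNN !mul1r. Qed.

Lemma enormZ (t : R) v : enorm (t *: v) = `|t| * enorm v.
Proof.
by rewrite !enormE dotZl dotZr mulrA -expr2 sqrtrM ?sqr_ge0// sqrtr_sqr.
Qed.

Lemma coord_le_enorm v i : `|v ord0 i| <= enorm v.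
Proof.
rewrite -(@ler_pXn2r _ 2) ?nnegrE ?enorm_ge0// sqr_enorm real_normK ?num_real//.
exact: dot_coord_le.
Qed.

Lemma enorm_le_coords v (M : R) : (forall i, `|v ord0 i| <= M) -> enorm v <= 3 * M.
Proof.
move=> H; have M0 : 0 <= M by exact: le_trans (H 0).
rewrite -(@ler_pXn2r _ 2) ?nnegrE ?enorm_ge0 ?mulr_ge0// sqr_enorm /dot sum3.
have h i : v ord0 i * v ord0 i <= M ^+ 2.
  by rewrite -expr2 -real_normK ?num_real// lerXn2r ?nnegrE.
by have := (h 0, h 1, h 2%:R); move=> [[h0 h1] h2]; nra.
Qed.

(** Cramer's rule: each coordinate of (det A)v is, up to sign, the triple product of vA with two
    rows of [A], and Lagrange's identity bounds it by the product of the three lengths. The factor 3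
    counts the coordinates. *)
Lemma det_dot_le A v :
  \det A ^+ 2 * dot v v <= 3 * sumsq A ^+ 2 * dot (v *m A) (v *m A).
Proof.
rewrite det_det3 /det3 /sumsq /dot !sum3 !mxE !sum3.
move: (A 0 0) (A 0 1) (A 0 2%:R) (A 1 0) (A 1 1) (A 1 2%:R) (A 2%:R 0) (A 2%:R 1) (A 2%:R 2%:R).
move=> a b c d e f g h i; move: (v ord0 0) (v ord0 1) (v ord0 2%:R) => p q r.
have key (x1 x2 x3 y1 y2 y3 w1 w2 w3 S : R) :
  x1 ^+ 2 + x2 ^+ 2 + x3 ^+ 2 <= S -> y1 ^+ 2 + y2 ^+ 2 + y3 ^+ 2 <= S ->
  (w1 * (x2 * y3 - x3 * y2) - w2 * (x1 * y3 - x3 * y1) + w3 * (x1 * y2 - x2 * y1)) ^+ 2 <=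
  S ^+ 2 * (w1 * w1 + w2 * w2 + w3 * w3).
  move=> hx hy; set X := _ + _ in hx; set Y := _ + _ in hy.
  have X0 : 0 <= X by rewrite !addr_ge0 ?sqr_ge0.
  have Y0 : 0 <= Y by rewrite !addr_ge0 ?sqr_ge0.
  have W0 : 0 <= w1 * w1 + w2 * w2 + w3 * w3 by rewrite -!expr2 !addr_ge0 ?sqr_ge0.
  apply: (@le_trans _ _ (X * Y * (w1 * w1 + w2 * w2 + w3 * w3))); last first.
    by rewrite ler_wpM2r// expr2 ler_pM.
  set c1 := x2 * y3 - x3 * y2; set c2 := x1 * y3 - x3 * y1; set c3 := x1 * y2 - x2 * y1.
  have XY : c1 ^+ 2 + c2 ^+ 2 + c3 ^+ 2 <= X * Y.
    rewrite -subr_ge0 (_ : _ - _ = (x1 * y1 + x2 * y2 + x3 * y3) ^+ 2) ?sqr_ge0//.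
    by rewrite /X /Y /c1 /c2 /c3; ring.
  apply: le_trans (ler_wpM2r W0 XY); rewrite -subr_ge0.
  rewrite (_ : _ - _ = (c1 * w2 + c2 * w1) ^+ 2 + (c1 * w3 - c3 * w1) ^+ 2 + (c2 * w3 + c3 * w2) ^+ 2).
    by rewrite !addr_ge0 ?sqr_ge0.
  by ring.
set D := a * _ - _ + _; set S := _ + _ + _ + _ + _.
pose w1 := p * a + q * d + r * g; pose w2 := p * b + q * e + r * h; pose w3 := p * c + q * f + r * i.
have s1 : a ^+ 2 + b ^+ 2 + c ^+ 2 <= S by rewrite /S; have := (sqr_ge0 d, sqr_ge0 e, sqr_ge0 f, sqr_ge0 g, sqr_ge0 h, sqr_ge0 i) => -[[[[[]]]]]; lra.
have s2 : d ^+ 2 + e ^+ 2 + f ^+ 2 <= S by rewrite /S; have := (sqr_ge0 a, sqr_ge0 b, sqr_ge0 c, sqr_ge0 g, sqr_ge0 h, sqr_ge0 i) => -[[[[[]]]]]; lra.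
have s3 : g ^+ 2 + h ^+ 2 + i ^+ 2 <= S by rewrite /S; have := (sqr_ge0 a, sqr_ge0 b, sqr_ge0 c, sqr_ge0 d, sqr_ge0 e, sqr_ge0 f) => -[[[[[]]]]]; lra.
have k1 := key d e f g h i w1 w2 w3 S s2 s3.
have k2 := key a b c g h i w1 w2 w3 S s1 s3.
have k3 := key a b c d e f w1 w2 w3 S s1 s2.
have e1 : w1 * (e * i - f * h) - w2 * (d * i - f * g) + w3 * (d * h - e * g) = p * D by rewrite /w1 /w2 /w3 /D; ring.
have e2 : w1 * (b * i - c * h) - w2 * (a * i - c * g) + w3 * (a * h - b * g) = - (q * D) by rewrite /w1 /w2 /w3 /D; ring.
have e3 : w1 * (b * f - c * e) - w2 * (a * f - c * d) + w3 * (a * e - b * d) = r * D by rewrite /w1 /w2 /w3 /D; ring.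
rewrite e1 in k1; rewrite e2 in k2; rewrite e3 in k3.
rewrite -/w1 -/w2 -/w3; move: k1 k2 k3; clear.
move: (w1 * w1 + w2 * w2 + w3 * w3) => W; move: (S ^+ 2) => T.
rewrite sqrrN !exprMn => k1 k2 k3.
have -> : D ^+ 2 * (p * p + q * q + r * r) = p ^+ 2 * D ^+ 2 + q ^+ 2 * D ^+ 2 + r ^+ 2 * D ^+ 2 by ring.
have -> : 3 * T * W = T * W + T * W + T * W by ring.
by rewrite !lerD.
Qed.

Lemma dot_mulmx_le A v : dot (v *m A) (v *m A) <= sumsq A * dot v v.
Proof.
rewrite /sumsq /dot !sum3 !mxE !sum3.
move: (A 0 0) (A 0 1) (A 0 2%:R) (A 1 0) (A 1 1) (A 1 2%:R) (A 2%:R 0) (A 2%:R 1) (A 2%:R 2%:R).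
move=> a b c d e f g h i; move: (v ord0 0) (v ord0 1) (v ord0 2%:R) => p q r.
rewrite -subr_ge0.
rewrite (_ : _ - _ = ((a * q - d * p) ^+ 2 + (a * r - g * p) ^+ 2 + (d * r - g * q) ^+ 2) +
  ((b * q - e * p) ^+ 2 + (b * r - h * p) ^+ 2 + (e * r - h * q) ^+ 2) +
  ((c * q - f * p) ^+ 2 + (c * r - i * p) ^+ 2 + (f * r - i * q) ^+ 2)); last by ring.
by rewrite !addr_ge0 ?sqr_ge0.
Qed.

(** [det_dot_le] bounds |v| through the determinant, the hypothesis bounds the determinant from
    below, and a factor sumsq A ^ 2 cancels. *)
Lemma distortion_lower A v (C : R) : 0 < C -> sumsq A ^+ 3 <= C * \det A ^+ 2 ->
  sumsq A * dot v v <= 3 * C * dot (v *m A) (v *m A).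
Proof.
move=> C0 H; have [S0|S0] := eqVneq (sumsq A) 0.
  by rewrite S0 mul0r !mulr_ge0 ?dot_ge0// ltW.
have Sp : 0 < sumsq A ^+ 2 by rewrite exprn_gt0// lt_neqAle eq_sym S0 sumsq_ge0.
rewrite -(ler_pM2l Sp).
have := det_dot_le A v; have := dot_ge0 v; move: H; rewrite exprS expr2.
move: (\det A ^+ 2) (dot v v) (dot (v *m A) (v *m A)) (sumsq A) => d V W S h V0 h2.
have h3 : S * (S * S) * V <= C * d * V by rewrite ler_wpM2r.
have h4 : C * (d * V) <= C * (3 * (S * S) * W) by rewrite ler_wpM2l// ltW.
have -> : S * S * (S * V) = S * (S * S) * V by ring.
have -> : S * S * (3 * C * W) = C * (3 * (S * S) * W) by ring.
by rewrite (le_trans h3)// -mulrA.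
Qed.

End Euclid3.

(** * Decay of 1 - |f|^2 at the boundary *)

Section UpperBounds.
Context {R : realType}.
Implicit Types (v w x y : 'rV[R]_3) (f : 'rV[R]_3 -> 'rV[R]_3) (C : R).
Local Notation B := (unit_ball R 3).

Lemma unit_ballE x : B x <-> dot x x < 1.
Proof.
rewrite /unit_ball /= enormE; split=> H; last by rewrite -sqrtr1 ltr_sqrt.
by rewrite -(sqr_sqrtr (dot_ge0 x)) -[1](expr1n _ 2) ltrXn2r ?nnegrE ?sqrtr_ge0.
Qed.

Lemma open_ball : open B.
Proof.
rewrite openE => x /unit_ballE x1; apply/nbhs_cube.
have e0 : 0 < 1 - dot x x by rewrite subr_gt0.
have [d d0 Hd] := (continuous_cube _ _).1 (continuous_dotxx (x := x)) _ e0.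
exists d => // y /Hd /ltr_normlP[_]; rewrite ltrD2r => h; exact/unit_ballE.
Qed.

Lemma compact_shell (a r : R) : r <= 1 -> compact [set x : 'rV[R]_3 | a <= dot x x <= r].
Proof.
move=> r1; apply: (subclosed_compact _ (@compact_cbox R 3 (fun=> -1) (fun=> 1))).
  have -> : [set x : 'rV[R]_3 | a <= dot x x <= r] =
      (fun v : 'rV[R]_3 => dot v v) @^-1` ([set t | a <= t] `&` [set t | t <= r]).
    by apply/seteqP; split=> x /= => [/andP[]|[-> ->]].
  apply: preimage_closed; first by move=> x _; exact: continuous_dotxx.
  by apply: closedI; [exact: closed_ge|exact: closed_le].
move=> x /= /andP[_ xr] i; rewrite -ler_norml.
rewrite -(@ler_pXn2r _ 2)// ?nnegrE// expr1n real_normK ?num_real//.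
by rewrite (le_trans (dot_coord_le x i))// (le_trans xr).
Qed.

Definition diff_map f : 'I_3 -> 'I_3 -> 'rV[R]_3 -> R :=
  fun i j => partial i (fun y => f y ord0 j).

Lemma diff_mapE f x : hess_mx (diff_map f) x = jacobian3 f x.
Proof. by []. Qed.

(** What the estimates use of f. The field [qg_proper] plays the role of boundary values: |f| tends
    to 1 at the sphere. *)
Record qc_gradient C f : Prop := QCGradient {
  qg_pos : 0 < C;
  qg_harmonic : harmonic_map_on B f;
  qg_hessian : harmonic_hessian B (diff_map f);
  qg_distortion : bounded_distortion C B (diff_map f);
  qg_maps : forall x, B x -> B (f x);
  qg_proper : forall S, compact S -> S `<=` B -> compact (B `&` f @^-1` S) }.

Lemma jacobian3_sym C f x : qc_gradient C f -> B x -> (jacobian3 f x)^T = jacobian3 f x.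
Proof.
by move=> [_ _ [_ _ hs _ _] _ _ _] Bx; apply/matrixP => i j; rewrite !mxE; exact: hs.
Qed.

(** By symmetry of the differential the gradient of |f|^2 is 2 f Df; harmonicity of the coordinates
    leaves only first derivatives in the Laplacian. *)
Lemma jet_dot_map C f x : qc_gradient C f -> B x ->
  exists2 c, jet (fun y => dot (f y) (f y)) x
    (fun i => 2 * (f x *m jacobian3 f x) ord0 i) c & \sum_i c i = 2 * sumsq (jacobian3 f x).
Proof.
move=> Q Bx; have J k := C2_jet open_ball (qg_harmonic Q k).1 Bx.
have H := jet_sum (fun k => jet_sqr (J k)).
exists (fun i => \sum_k (2 * f x ord0 k * partial i (partial i (fun y => f y ord0 k)) x +
    2 * partial i (fun y => f y ord0 k) x ^+ 2)).
  move: H; under [X in jet X]eq_fun => y do under eq_bigr do rewrite expr2.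
  move=> H; apply: (jet_eq H) => i //.
  rewrite mxE mulr_sumr; apply: eq_bigr => k _.
  by rewrite -(jacobian3_sym Q Bx) !mxE mulrA.
rewrite [LHS]exchange_big/= /sumsq [X in 2 * X]exchange_big mulr_sumr; apply: eq_bigr => k _.
rewrite big_split/= -!mulr_sumr.
have -> : \sum_i partial i (partial i (fun y => f y ord0 k)) x = 0 := (qg_harmonic Q k).2 x Bx.
by rewrite mulr0 add0r; congr (_ * _); apply: eq_bigr => i _; rewrite mxE.
Qed.

Lemma continuous_map C f x : qc_gradient C f -> B x ->
  {for x, continuous (fun y => dot (f y) (f y))}.
Proof.
move=> Q Bx; apply: continuous_dot => i;
exact: (C_on_continuous open_ball (qg_harmonic Q i).1 Bx).
Qed.

Lemma qc_lower C f x v : qc_gradient C f -> B x ->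
  sumsq (jacobian3 f x) * dot v v <= 3 * C * dot (v *m jacobian3 f x) (v *m jacobian3 f x).
Proof. by move=> Q Bx; apply: distortion_lower (qg_pos Q) (qg_distortion Q Bx). Qed.

Lemma compact_pre_shell C f (a r : R) : qc_gradient C f -> r < 1 ->
  compact (B `&` [set x | a <= dot (f x) (f x) <= r]).
Proof.
move=> Q r1; apply: (qg_proper Q (compact_shell (ltW r1))).
by move=> x /andP[_ xr]; apply/unit_ballE; exact: le_lt_trans r1.
Qed.

(* [exp (A (1 - |f|^2)) + M |x|^2] is subharmonic where |f| > 1/2 if [A] is large. *)
Lemma boundary_decay C f : qc_gradient C f -> exists2 C1 : R, 0 < C1 &
  forall x, B x -> 1 - dot (f x) (f x) <= C1 * (1 - dot x x).
Proof.
(* Write S = |Df|^2. Where |f|^2 >= 1/4, bounded distortion gives S/4 <= 3C|f Df|^2, hence 4A|f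
   Df|^2 >= 2S: in the Laplacian of the exponential the squared gradient outweighs the negative
   term. *)
move=> Q; have C0 := qg_pos Q; pose A := 6 * C; have A0 : 0 < A by rewrite mulr_gt0.
pose K0 := B `&` [set x | 0 <= dot (f x) (f x) <= 4^-1].
have [rho rho0 Hrho] : exists2 rho : R, 0 < rho & forall x, K0 x -> rho <= 1 - dot x x.
  have [[x Kx]|K0e] := pselect (K0 !=set0); last first.
    by exists 1 => // x Kx; case: K0e; exists x.
  have q1 : 4^-1 < 1 :> R by lra.
  have cK : compact K0 := compact_pre_shell Q q1.
  have [|y [By _] Hy] := compact_argmax (u := fun x => dot x x) cK (ex_intro _ x Kx).
    by move=> z _; exact: continuous_dotxx.
  exists (1 - dot y y); first by rewrite subr_gt0; exact/unit_ballE.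
  by move=> z /Hy; rewrite lerD2l lerN2.
(* Chosen so that exp A <= M(1 - |x|^2) on [K0], which keeps [Phi] at most [M] where |f|^2 = 1/4. *)
pose M := expR A / rho; have M0 : 0 < M by rewrite divr_gt0// expR_gt0.
pose Phi x := expR (A * (1 - dot (f x) (f x))) + M * dot x x.
have cPhi x : B x -> {for x, continuous Phi}.
  move=> Bx; apply: continuousD.
    apply: (@continuous_comp _ _ _ (fun y => A * (1 - dot (f y) (f y))) (@expR R)); last exact: continuous_expR.
    apply: continuousM; first exact: cst_continuous.
    by apply: continuousB; [exact: cst_continuous|exact: (continuous_map Q Bx)].
  by apply: continuousM; [exact: cst_continuous|exact: continuous_dotxx].
have key x : B x -> 4^-1 <= dot (f x) (f x) -> Phi x <= 1 + M.
  move=> Bx fx; rewrite leNgt; apply/negP => lt_x.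
  have fx1 : 0 < 1 - dot (f x) (f x) by rewrite subr_gt0; exact/unit_ballE/(qg_maps Q).
  pose dl := Phi x - 1 - M; have dl0 : 0 < dl by rewrite /dl; move: lt_x; lra.
  (* The level |f|^2 = 1 - t is taken so close to 1 that exp(At) < 1 + dl, which excludes a maximum
     of [Phi] on it. *)
  have l0 : 0 < ln (1 + dl) / A by rewrite divr_gt0// ln_gt0// ltrDl.
  have [t [t0 t1 t2]] := lt_two l0 fx1.
  pose K := B `&` [set y | 4^-1 <= dot (f y) (f y) <= 1 - t].
  have q1 : 1 - t < 1 by move: t0; clear; lra.
  have cK : compact K := compact_pre_shell Q q1.
  have Kx : K x by split => //; apply/andP; split => //; lra.
  have [|y [By /andP[y1 y2]] Hy] := compact_argmax (u := Phi) cK (ex_intro _ x Kx).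
    by move=> z [Bz _]; exact: cPhi.
  have Pxy := Hy x Kx.
  have y1' : 4^-1 < dot (f y) (f y).
    rewrite lt_neqAle y1 andbT; apply/eqP => y4.
    have Ky : K0 y by split => //; apply/andP; rewrite -y4; split; clear; lra.
    have : Phi y <= expR A + M * dot y y.
      rewrite /Phi -y4 lerD2r ler_expR; move: A0; clear; lra.
    have : expR A <= M * (1 - dot y y).
      rewrite /M -mulrA -[leLHS]mulr1 ler_pM2l ?expR_gt0// mulrC ler_pdivlMr// mul1r.
      exact: Hrho.
    have : Phi x <= Phi y by [].
    move: lt_x; clear; move: (Phi x) (Phi y) (expR A) (dot y y) => a b c d; lra.
  have y2' : dot (f y) (f y) < 1 - t.
    rewrite lt_neqAle y2 andbT; apply/eqP => yt.
    have h1 : Phi y <= expR (A * t) + M.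
      rewrite /Phi yt (_ : 1 - (1 - t) = t); last by ring.
      rewrite lerD2l -[leRHS]mulr1 ler_pM2l// ltW//; exact/unit_ballE.
    have h2 : expR (A * t) < 1 + dl.
      rewrite -[X in _ < X]lnK ?posrE; last by rewrite addr_gt0.
      by rewrite ltr_expR mulrC -ltr_pdivlMr.
    have h3 : Phi x <= Phi y by [].
    move: h1 h2 h3; rewrite /dl; clear; move: (Phi x) (Phi y) (expR _) => a b c; lra.
  have [c jf Sc] := jet_dot_map Q By.
  have jw := jetZ A (jetB (jet_cst 1 y) jf).
  have jP := jetD (jet_exp jw) (jetZ M (jet_dot y)).
  have lmax : exists2 d : R, 0 < d & forall z, cube y d z -> Phi z <= Phi y.
    have [d1 d10 Hd1] := open_cube open_ball By.
    pose m := Num.min (dot (f y) (f y) - 4^-1) (1 - t - dot (f y) (f y)).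
    have m0 : 0 < m by rewrite lt_min !subr_gt0 y1' y2'.
    have [d2 d20 Hd2] := (continuous_cube _ _).1 (continuous_map Q By) m m0.
    have [d [d0 dd1 dd2]] := lt_two d10 d20; exists d => // z zy.
    apply: Hy; split; first exact: Hd1 (cube_sub (ltW dd1) zy).
    have := Hd2 z (cube_sub (ltW dd2) zy).
    rewrite /m lt_min => /andP[/ltr_normlP[h1 h2] /ltr_normlP[h3 h4]].
    apply/andP; split; move: h1 h4; clear; move: (dot _ _) (dot _ _) => a b; lra.
  have [_] := jet_max_lap jP lmax.
  apply/negP; rewrite -ltNge.
  set E := expR _; have E0 : 0 < E by exact: expR_gt0.
  have -> : \sum_i (E * ((A * (0 - 2 * (f y *m jacobian3 f y) ord0 i)) ^+ 2 + A * (0 - c i)) + M * 2) =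
      E * (A * (4 * A * dot (f y *m jacobian3 f y) (f y *m jacobian3 f y) - \sum_i c i)) + 6 * M.
    by rewrite /dot !sum3; move: ((f y *m _) _ 0) ((f y *m _) _ 1) ((f y *m _) _ 2%:R) => p q r; ring.
  rewrite Sc; have := qc_lower (f y) Q By; have := sumsq_ge0 (jacobian3 f y).
  move: (sumsq _) (dot (_ *m _) _) => S W S0 h.
  have h' : S * 4^-1 <= 3 * C * W by apply: le_trans h; rewrite ler_wpM2l.
  have h'' : 0 <= 4 * A * W - 2 * S by rewrite /A; move: h'; clear; lra.
  apply: ltr_wpDl; last by rewrite mulr_gt0.
  exact: mulr_ge0 (ltW E0) (mulr_ge0 (ltW A0) h'').
(* M/A serves where |f|^2 >= 1/4, by exp s >= 1 + s, and 1/rho on [K0]. *)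
exists (M / A + rho^-1) => [|x Bx]; first by apply: addr_gt0; [exact: divr_gt0|rewrite invr_gt0].
have x1 : 0 < 1 - dot x x by rewrite subr_gt0; exact/unit_ballE.
have [fx|fx] := leP 4^-1 (dot (f x) (f x)).
  have := key x Bx fx; rewrite /Phi.
  have := expR_ge1Dx (A * (1 - dot (f x) (f x))) => h1 h2.
  have h3 : A * (1 - dot (f x) (f x)) <= M * (1 - dot x x).
    by move: h1 h2; clear; move: (dot (f x) (f x)) (dot x x) (expR _) => a b c; lra.
  rewrite mulrDl; apply: (@le_trans _ _ (M / A * (1 - dot x x))); last first.
    by rewrite lerDl mulr_ge0 ?(ltW x1)// invr_ge0 ltW.
  by rewrite mulrAC ler_pdivlMr// mulrC.
have Kx : K0 x by split => //; rewrite /= dot_ge0/= ltW.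
have h := Hrho x Kx; rewrite mulrDl; apply: (@le_trans _ _ (rho^-1 * (1 - dot x x))).
  apply: (@le_trans _ _ 1); first by rewrite gerBl dot_ge0.
  by rewrite mulrC ler_pdivlMr// mul1r.
by rewrite lerDr mulr_ge0 ?(ltW x1)// divr_ge0 ?ltW.
Qed.

End UpperBounds.

(** * Gradient estimate for positive harmonic functions and bound on the differential *)

Section DifferentialBound.
Context {R : realType}.
Implicit Types (v w x y : 'rV[R]_3) (f : 'rV[R]_3 -> 'rV[R]_3) (C : R) (g : 'rV[R]_3 -> R).
Local Notation B := (unit_ball R 3).

Lemma continuous_pos (u : 'rV[R]_3 -> R) x : {for x, continuous u} -> 0 < u x ->
  exists2 d : R, 0 < d & forall y, cube x d y -> 0 < u y.
Proof.
move=> cu u0; have [d d0 Hd] := (continuous_cube _ _).1 cu _ u0.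
by exists d => // y /Hd /ltr_normlP[+ _]; move: (u x) (u y) => a b; lra.
Qed.

Definition grad_sq g y : R := \sum_j partial j g y ^+ 2.

Lemma jet_grad_sq Omega g x : open Omega -> harmonic_on Omega g -> Omega x ->
  let A : 'M[R]_3 := \matrix_(i, j) partial i (partial j g) x in
  exists2 c, jet (grad_sq g) x (fun i => 2 * (gradient g x *m A) ord0 i) c &
    \sum_i c i = 2 * sumsq A.
Proof.
move=> oO Hg Ox A; have Hp j := harmonic_partial j oO Hg.
have H := jet_sum (fun k => jet_sqr (C2_jet oO (Hp k).1 Ox)).
exists (fun i => \sum_k (2 * partial k g x * partial i (partial i (partial k g)) x +
    2 * partial i (partial k g) x ^+ 2)).
  apply: (jet_eq H) => i //.
  rewrite mxE mulr_sumr; apply: eq_bigr => k _.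
  by rewrite !mxE (partialC i k oO Hg.1 Ox) mulrA.
rewrite [LHS]exchange_big/= /sumsq [X in 2 * X]exchange_big mulr_sumr; apply: eq_bigr => k _.
rewrite big_split/= -!mulr_sumr.
rewrite (_ : \sum_i partial i (partial i (partial k g)) x = 0); last exact: (Hp k).2.
by rewrite mulr0 add0r; congr (_ * _); apply: eq_bigr => i _; rewrite mxE.
Qed.

Lemma grad_sqE g x : grad_sq g x = dot (gradient g x) (gradient g x).
Proof. by apply: eq_bigr => i _; rewrite mxE expr2. Qed.

(** Here P = |grad g|^2, S = |Hess g|^2, e = s - |x|^2, W = |x|^2, X = grad g Hess g, V = grad g and
    D = x. The critical equation gives X/P = V/g + 2D/e, so T <= 3Y/2 + 12Z. With the plain bound
    S/P >= T the Laplacian would contain -2T + 2Y, which has no usable sign; the refined bound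
    leaves -T + 2Y and thus Y <= 40Z + 24/e. Finally 40W + 24e <= 64, a convenient square. *)
Lemma max_principle_algebra (P S W e g : R) (X V D c u : 'I_3 -> R) : 0 < P -> 0 < e -> 0 < g ->
  \sum_i V i ^+ 2 = P -> \sum_i D i ^+ 2 = W -> 3 * (\sum_i X i ^+ 2) <= 2 * S * P -> W + e <= 1 ->
  (forall i, 2 * X i / P + 2 * ((0 - 2 * D i) / e) - 2 * (V i / g) = 0) ->
  \sum_i c i = 2 * S -> \sum_i u i = 0 ->
  \sum_i (c i / P - (2 * X i / P) ^+ 2 + 2 * ((0 - 2) / e - ((0 - 2 * D i) / e) ^+ 2) -
    2 * (u i / g - (V i / g) ^+ 2)) <= 0 ->
  P * e ^+ 2 <= 64 * g ^+ 2.
Proof.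
move=> P0 e0 g0 VP DW kato We crit Sc Su lap.
have P1 := lt0r_neq0 P0; have e1 := lt0r_neq0 e0; have g1 := lt0r_neq0 g0.
have E i : X i / P = V i / g + 2 * (D i / e).
  have -> : V i / g + 2 * (D i / e) = X i / P -
    2^-1 * (2 * X i / P + 2 * ((0 - 2 * D i) / e) - 2 * (V i / g)).
    by move: P1 e1 g1; clear; move: (X i) (V i) (D i) => x v d *; field; apply/and3P.
  by rewrite crit mulr0 subr0.
pose T := (\sum_i X i ^+ 2) / P ^+ 2; pose Y := P / g ^+ 2; pose Z := W / e ^+ 2.
have YE : Y = \sum_i (V i / g) ^+ 2.
  by rewrite /Y -VP mulr_suml; apply: eq_bigr => i _; rewrite exprMn exprVn.
have ZE : Z = \sum_i (D i / e) ^+ 2.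
  by rewrite /Z -DW mulr_suml; apply: eq_bigr => i _; rewrite exprMn exprVn.
have TE : T = \sum_i (X i / P) ^+ 2.
  by rewrite /T mulr_suml; apply: eq_bigr => i _; rewrite exprMn exprVn.
have hT : T <= 3 / 2 * Y + 12 * Z.
  rewrite TE YE ZE !mulr_sumr -big_split/=; apply: ler_sum => i _; rewrite E.
  move: (V i / g) (D i / e) => a d; have := sqr_ge0 (a - 4 * d); lra.
have hS : 3 * T <= 2 * S / P.
  rewrite /T mulrA ler_pdivrMr ?exprn_gt0//.
  by have -> : 2 * S / P * P ^+ 2 = 2 * S * P by move: P1; clear; move=> P1; field.
have lap' : 2 * S / P - 4 * T + 2 * (- 6 / e - 4 * Z) + 2 * Y <= 0.
  apply: le_trans lap; rewrite -Sc TE YE ZE; rewrite !sum3 in Su *.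
  have u2 : u 2%:R = - (u 0 + u 1) by move: Su; clear; lra.
  rewrite u2 -![2 * X _ / P]mulrA !sub0r !mulNr -![2 * D _ / e]mulrA.
  move: (X 0 / P) (X 1 / P) (X 2%:R / P) (V 0 / g) (V 1 / g) (V 2%:R / g) => x0 x1 x2 v0 v1 v2.
  move: (D 0 / e) (D 1 / e) (D 2%:R / e) (P^-1) (e^-1) (g^-1) => d0 d1 d2 p q r.
  by rewrite le_eqVlt; apply/orP; left; apply/eqP; ring.
have W0 : 0 <= W by rewrite -DW; apply: sumr_ge0 => i _; exact: sqr_ge0.
have hY : Y <= 40 * Z + 24 / e.
  move: lap' hS hT; clear; rewrite -!mulrA; move: (S / P) (e^-1) => a b; lra.
have : Y * e ^+ 2 <= 64.
  apply: le_trans (ler_wpM2r (sqr_ge0 e) hY) _.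
  have -> : (40 * Z + 24 / e) * e ^+ 2 = 40 * W + 24 * e.
    by rewrite /Z; move: e1; clear; move=> e1; field.
  by move: We W0 e0; clear; lra.
by rewrite /Y mulrAC ler_pdivrMr ?exprn_gt0.
Qed.

(* Maximum principle for [ln |grad g|^2 + 2 ln (s - |x|^2) - 2 ln g], where the refined
   Kato inequality bounds the Laplacian of the first term from below. *)
Lemma cheng_yau_inner g s : harmonic_on B g -> (forall y, B y -> 0 < g y) -> s < 1 ->
  forall x, dot x x <= s -> grad_sq g x * (s - dot x x) ^+ 2 <= 64 * g x ^+ 2.
Proof.
move=> Hg gp s1; pose G x := grad_sq g x * (s - dot x x) ^+ 2 / g x ^+ 2.
have ball x : dot x x <= s -> B x by move=> h; apply/unit_ballE; exact: le_lt_trans s1.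
have Hp j := harmonic_partial j (@open_ball R) Hg.
have cg x : B x -> {for x, continuous g} := C_on_continuous (@open_ball R) Hg.1.
have cP x : B x -> {for x, continuous (grad_sq g)}.
  move=> Bx; apply: continuous_sum => j; have := C_on_continuous (@open_ball R) (Hp j).1 Bx.
  by move=> c; apply: continuousM.
have ce x : {for x, continuous (fun y => s - dot y y)}.
  by apply: continuousB; [exact: cst_continuous|exact: continuous_dotxx].
have cG x : B x -> {for x, continuous G}.
  move=> Bx; apply: continuousM.
    by apply: continuousM; [exact: cP|apply: continuousM; exact: ce].
  apply: (@continuous_comp _ _ _ (fun y => g y ^+ 2) (fun t : R => t^-1)).
    by apply: continuousM; exact: cg.
  by apply: inv_continuous; rewrite gt_eqF// exprn_gt0// gp.
move=> x xs; have [Bx] := ball x xs.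
have cK := @compact_shell R 0 s (ltW s1).
have Kx : [set y : 'rV[R]_3 | 0 <= dot y y <= s] x by rewrite /= dot_ge0.
have [|y /andP[_ ys] Hy] := compact_argmax (u := G) cK (ex_intro _ x Kx).
  by move=> z /andP[_ zs]; apply: cG; exact: ball.
have By := ball y ys; have gy := gp y By.
suff main : G y <= 64.
  have := le_trans (Hy x Kx) main; rewrite /G ler_pdivrMr ?exprn_gt0 ?gp//; exact: ball.
have [//|Gy] := leP (G y) 0; first by move=> h; rewrite (le_trans h).
have e0 : 0 < s - dot y y.
  rewrite lt_neqAle subr_ge0 ys andbT; apply/eqP => e0.
  by move: Gy; rewrite /G -e0 expr0n/= mulr0 mul0r ltxx.
have P0 : 0 < grad_sq g y.
  rewrite lt_neqAle (_ : 0 <= grad_sq g y) ?andbT; last first.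
    by apply: sumr_ge0 => j _; exact: sqr_ge0.
  by apply/eqP => P0; move: Gy; rewrite /G -P0 !mul0r ltxx.
rewrite /G ler_pdivrMr ?exprn_gt0//.
have [c jP Sc] := jet_grad_sq (@open_ball R) Hg By.
have jg := C2_jet (@open_ball R) Hg.1 By.
have je := jetB (jet_cst s y) (jet_dot y).
have jF := jetB (jetD (jet_ln jP P0) (jetZ 2 (jet_ln je e0))) (jetZ 2 (jet_ln jg gy)).
have lmax : exists2 d : R, 0 < d & forall z, cube y d z ->
    ln (grad_sq g z) + 2 * ln (s - dot z z) - 2 * ln (g z) <=
    ln (grad_sq g y) + 2 * ln (s - dot y y) - 2 * ln (g y).
  have [d1 d10 H1] := continuous_pos (cP y By) P0.
  have [d2 d20 H2] := continuous_pos (ce y) e0.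
  have [d [d0 dd1 dd2]] := lt_two d10 d20; exists d => // z zy.
  have Pz := H1 z (cube_sub (ltW dd1) zy); have ez := H2 z (cube_sub (ltW dd2) zy).
  have zs : dot z z <= s by rewrite -subr_ge0 ltW.
  have gz := gp z (ball z zs).
  have lnG w : 0 < grad_sq g w -> 0 < s - dot w w -> 0 < g w ->
      ln (G w) = ln (grad_sq g w) + 2 * ln (s - dot w w) - 2 * ln (g w).
    move=> a b r; rewrite /G ln_div ?posrE ?mulr_gt0 ?exprn_gt0// lnM ?posrE ?exprn_gt0//.
    by rewrite !lnXn// !mulr_natl.
  rewrite -(lnG z Pz ez gz) -(lnG y P0 e0 gy) ler_ln ?posrE.
  - by apply: Hy; rewrite /= dot_ge0 zs.
  - by rewrite /G divr_gt0 ?mulr_gt0 ?exprn_gt0.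
  - exact: Gy.
have [crit lap] := jet_max_lap jF lmax.
pose A : 'M[R]_3 := \matrix_(i, j) partial i (partial j g) y.
have As : A^T = A by apply/matrixP => i j; rewrite !mxE (partialC i j (@open_ball R) Hg.1 By).
have tA : \tr A = 0 by rewrite -[RHS](Hg.2 y By); apply: eq_bigr => i _; rewrite mxE.
have kato := refined_kato (gradient g y) As tA.
apply: (@max_principle_algebra _ (sumsq A) (dot y y) _ _ (fun i => (gradient g y *m A) ord0 i)
   (fun i => partial i g y) (fun i => y ord0 i) c (fun i => partial i (partial i g) y)) => //.
- by move: kato; rewrite -grad_sqE.
- by rewrite addrC subrK ltW.
- exact: (Hg.2 y By).
Qed.

Lemma cheng_yau g x : harmonic_on B g -> (forall y, B y -> 0 < g y) -> B x ->
  enorm (gradient g x) * (1 - dot x x) <= 8 * g x.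
Proof.
move=> Hg gp Bx; set p := enorm _; set D := 1 - _.
have p0 : 0 <= p by exact: enorm_ge0.
have gx := gp x Bx; have D0 : 0 < D by rewrite subr_gt0; exact/unit_ballE.
rewrite leNgt; apply/negP => lt_g.
have p1 : 0 < p.
  rewrite lt_neqAle p0 andbT; apply/eqP => pz; move: lt_g; rewrite -pz mul0r.
  by move: gx; clear; move: (g x) => a; lra.
have q : 8 * g x / p < D by rewrite ltr_pdivrMr// [D * p]mulrC.
(* Any t strictly between 8 g x / p and 1 - |x|^2 makes [cheng_yau_inner] with s = |x|^2 + t < 1
   contradict the assumption. *)
pose t := (8 * g x / p + D) / 2.
have t0 : 0 <= t by rewrite /t divr_ge0// addr_ge0 ?(ltW D0)// divr_ge0// mulr_ge0// ltW.
have t1 : 8 * g x / p < t /\ t < D by rewrite /t; move: q; clear; move: (_ / _) D => a b; lra.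
have s1 : dot x x + t < 1 by move: t1.2; rewrite /D; clear; move: (dot x x) t => a b; lra.
have := @cheng_yau_inner g (dot x x + t) Hg gp s1 x; rewrite lerDl => /(_ t0).
rewrite grad_sqE -sqr_enorm -/p addrC addKr -exprMn => h.
have : p * t <= 8 * g x.
  have h8 : (p * t) ^+ 2 <= (8 * g x) ^+ 2.
    by rewrite [leRHS]exprMn (_ : (8 : R) ^+ 2 = 64)//; rewrite -natrX.
  have g8 : 0 <= 8 * g x by rewrite mulr_ge0// ltW.
  by move: h8; rewrite ler_pXn2r// ?nnegrE// mulr_ge0.
by move: t1.1; rewrite ltr_pdivrMr// [t * p]mulrC => h1 h2; move: (lt_le_trans h1 h2); rewrite ltxx.
Qed.

(** The unit vector nu depends on [x]: it is the direction of f x. Then 1 - <f, nu> equals 1 - |f x|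
    at [x], at most C1(1 - |x|^2), and the factor 1 - |x|^2 cancels in the gradient estimate. This
    bounds nu Df only, and bounded distortion extends the bound to the whole differential. *)
Lemma differential_bounded C f : qc_gradient C f ->
  exists2 M : R, 0 < M & forall x, B x -> sumsq (jacobian3 f x) <= M.
Proof.
move=> Q; have C0 := qg_pos Q; have [C1 C10 HC1] := boundary_decay Q.
exists (3 * C * (8 * C1) ^+ 2) => [|x Bx]; first by rewrite !mulr_gt0// exprn_gt0// mulr_gt0.
have [nu [nu1 nuf]] : exists nu, dot nu nu = 1 /\ dot (f x) nu = enorm (f x).
  have [f0|f0] := eqVneq (f x) 0.
    exists (basis_vec 0); rewrite f0 dot0l enormE dot0l sqrtr0; split => //.
    rewrite /dot (bigD1 0)//= big1 => [|j j0]; first by rewrite basis_vecE eqxx mulr1 addr0.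
    by rewrite basis_vecE (negbTE j0) mulr0.
  have e0 : 0 < enorm (f x) by rewrite enormE sqrtr_gt0 dot_gt0.
  exists ((enorm (f x))^-1 *: f x); rewrite !(dotZl, dotZr) -sqr_enorm.
  by move: (enorm _) e0 => e /gt_eqF e0; split; field; rewrite e0.
pose g y := 1 - \sum_j nu ord0 j * f y ord0 j.
have gE y : g y = 1 - dot (f y) nu.
  by rewrite /g /dot; congr (_ - _); apply: eq_bigr => j _; rewrite mulrC.
have Hs : harmonic_on B (fun y => \sum_j nu ord0 j * f y ord0 j).
  apply: harmonic_sum => [|j]; first exact: open_ball.
  by apply: harmonicZ; [exact: open_ball|exact: (qg_harmonic Q j)].
have Hg : harmonic_on B g by exact: harmonicB (@open_ball R) (harmonic_cst B 1) Hs.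
have gp y : B y -> 0 < g y.
  move=> By; rewrite gE subr_gt0; apply: le_lt_trans (dot_le_enorm _ _) _.
  have -> : enorm nu = 1 by rewrite enormE nu1 sqrtr1.
  by rewrite mulr1; exact: (qg_maps Q By).
have grad : gradient g x = - (nu *m jacobian3 f x).
  apply/rowP => i; rewrite !mxE.
  have df j : derivable (fun y => f y ord0 j) x (basis_vec i).
    exact: (C_on_derivable (qg_harmonic Q j).1 Bx).
  have dn j : derivable (fun y => nu ord0 j * f y ord0 j) x (basis_vec i).
    by apply: derivableM; [exact: derivable_cst|exact: df].
  have -> : partial i g x = - \sum_j partial i (fun y => nu ord0 j * f y ord0 j) x.
    rewrite -partial_bigsum//; have := C_on_derivable (i := i) Hs.1 Bx => ds.
    by rewrite /g (partialB (derivable_cst _ _ _) ds) partial_cst sub0r.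
  congr (- _); apply: eq_bigr => j _; rewrite (partialZ _ (df j)); congr (_ * _).
  by rewrite -(jacobian3_sym Q Bx) !mxE.
have D0 : 0 < 1 - dot x x by rewrite subr_gt0; exact/unit_ballE.
have h1 := cheng_yau Hg gp Bx.
have h2 : g x <= C1 * (1 - dot x x).
  apply: le_trans (HC1 x Bx); rewrite gE nuf -sqr_enorm lerD2l lerN2.
  have := enorm_ge0 (f x); have : enorm (f x) < 1 by exact: (qg_maps Q Bx).
  by rewrite expr2 => e1 e0; rewrite ler_piMl// ltW.
have h3 : enorm (nu *m jacobian3 f x) <= 8 * C1.
  rewrite -enormN -grad -(ler_pM2r D0); apply: (le_trans h1).
  by rewrite -mulrA ler_pM2l.
have := qc_lower nu Q Bx; rewrite nu1 mulr1 => h4; apply: (le_trans h4).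
rewrite ler_pM2l ?mulr_gt0// -sqr_enorm lerXn2r ?nnegrE ?enorm_ge0//.
by rewrite mulr_ge0// ltW.
Qed.

End DifferentialBound.

(** * Hopf's bound and the lower bound for the Jacobian determinant *)

Section LowerBounds.
Context {R : realType}.
Implicit Types (v w x y : 'rV[R]_3) (f : 'rV[R]_3 -> 'rV[R]_3) (C : R) (g : 'rV[R]_3 -> R).
Local Notation B := (unit_ball R 3).

Lemma compact_lower_pos (K : set 'rV[R]_3) g : compact K ->
  (forall x, K x -> {for x, continuous g}) -> (forall x, K x -> 0 < g x) ->
  exists2 m : R, 0 < m & forall x, K x -> m <= g x.
Proof.
move=> cK cg gp; have [[x Kx]|K0] := pselect (K !=set0); last first.
  by exists 1 => // x Kx; case: K0; exists x.
have [|y Ky Hy] := compact_argmax (u := fun x => - g x) cK (ex_intro _ x Kx).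
  by move=> z Kz; apply: continuousN; exact: cg.
by exists (g y) => [|z /Hy]; [exact: gp|rewrite lerN2].
Qed.

(* [rho + rho^2] with [rho = 1 - |x|^2] is subharmonic where [rho < 1/10]. *)
Lemma hopf_bound C f : qc_gradient C f -> exists2 c : R, 0 < c &
  forall x, B x -> c * (1 - dot x x) <= 1 - dot (f x) (f x).
Proof.
move=> Q; pose K0 := [set x : 'rV[R]_3 | 0 <= dot x x <= 9 / 10].
have q9 : 9 / 10 <= 1 :> R by lra.
have cK0 : compact K0 := compact_shell q9.
have K0B x : K0 x -> B x by move=> /andP[_ h]; apply/unit_ballE; move: h; clear; lra.
have cw x : B x -> {for x, continuous (fun y => 1 - dot (f y) (f y))}.
  by move=> Bx; apply: continuousB; [exact: cst_continuous|exact: (continuous_map Q Bx)].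
have wp x : B x -> 0 < 1 - dot (f x) (f x).
  by move=> Bx; rewrite subr_gt0; exact/unit_ballE/(qg_maps Q).
have [m m0 Hm] := compact_lower_pos cK0 (fun x Kx => cw x (K0B x Kx)) (fun x Kx => wp x (K0B x Kx)).
exists m => // x Bx; have x1 : 0 < 1 - dot x x by rewrite subr_gt0; exact/unit_ballE.
have [x9|x9] := leP (dot x x) (9 / 10).
  apply: le_trans (Hm x _); last by rewrite /K0 /= dot_ge0.
  by rewrite ger_pMr// gerBl dot_ge0.
pose Psi y := dot (f y) (f y) + m * ((1 - dot y y) + (1 - dot y y) ^+ 2).
suff h : Psi x <= 1.
  have h2 : 0 <= m * (1 - dot x x) ^+ 2 by rewrite mulr_ge0 ?sqr_ge0// ltW.
  by move: h h2; rewrite /Psi mulrDr; clear; move: (dot (f x) (f x)) (m * _) (m * _) => a b c; lra.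
rewrite leNgt; apply/negP => lt_x.
(* On the outer sphere |y|^2 = 1 - t the barrier m(t + t^2) is at most 2mt < Psi x - 1, so no
   maximum lies there. *)
have a0 : 0 < (Psi x - 1) / (2 * m) by rewrite divr_gt0 ?mulr_gt0// subr_gt0.
have [t [t0 t1 t2]] := lt_two a0 x1.
have q1 : 1 - t <= 1 by move: t0; clear; lra.
have cK := @compact_shell R (9 / 10) (1 - t) q1.
have ce y : {for y, continuous (fun z : 'rV[R]_3 => 1 - dot z z)}.
  by apply: continuousB; [exact: cst_continuous|exact: continuous_dotxx].
have KB y : 9 / 10 <= dot y y <= 1 - t -> B y.
  by move=> /andP[_ h]; apply/unit_ballE; move: h t0; clear; move: (dot y y) => a; lra.
have Kx : [set y : 'rV[R]_3 | 9 / 10 <= dot y y <= 1 - t] x.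
  by apply/andP; split; [exact: ltW|move: t2; clear; move: (dot x x) => a; lra].
have [|y Ky Hy] := compact_argmax (u := Psi) cK (ex_intro _ x Kx).
  move=> z Kz; apply: continuousD; first exact: (continuous_map Q (KB z Kz)).
  apply: continuousM; first exact: cst_continuous.
  apply: continuousD; first exact: ce.
  by apply: continuousM; exact: ce.
have Pxy := Hy x Kx; have By := KB y Ky; have /andP[y1 y2] := Ky; have wy := wp y By.
(* On the inner sphere rho + rho^2 = 11/100 and |f|^2 <= 1 - m, so [Psi] is below 1. *)
have y1' : 9 / 10 < dot y y.
  rewrite lt_neqAle y1 andbT; apply/eqP => y9.
  have := Hm y; rewrite /K0 /= -y9 => hm.
  have {}hm : m <= 1 - dot (f y) (f y) by apply: hm; apply/andP; split; clear; lra.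
  move: Pxy lt_x; rewrite {2}/Psi -y9; move: hm m0; clear.
  by move: (Psi x) (dot (f y) (f y)) => a b; lra.
have y2' : dot y y < 1 - t.
  rewrite lt_neqAle y2 andbT; apply/eqP => yt.
  move: Pxy; rewrite {2}/Psi yt (_ : 1 - (1 - t) = t); last by ring.
  have ht : 2 * m * t < Psi x - 1 by move: t1; rewrite ltr_pdivlMr ?mulr_gt0// mulrC.
  have t11 : t <= 1 by have := dot_ge0 y; rewrite yt; clear; lra.
  have ht2 : m * t ^+ 2 <= m * t by rewrite ler_wpM2l ?(ltW m0)// expr2 ler_piMr// ltW.
  rewrite mulrDr; move: ht ht2 wy; clear; rewrite -mulrA.
  by move: (Psi x) (dot (f y) (f y)) (m * t) (m * t ^+ 2) => a b c d; lra.
have [c jf Sc] := jet_dot_map Q By.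
have jr := jetB (jet_cst 1 y) (jet_dot y).
have jP := jetD jf (jetZ m (jetD jr (jet_sqr jr))).
have lmax : exists2 d : R, 0 < d & forall z, cube y d z -> Psi z <= Psi y.
  pose e := Num.min (dot y y - 9 / 10) (1 - t - dot y y).
  have e0 : 0 < e by rewrite lt_min !subr_gt0 y1' y2'.
  have [d d0 Hd] := (continuous_cube _ _).1 (continuous_dotxx (x := y)) e e0.
  exists d => // z zy; apply: Hy; have := Hd z zy.
  rewrite /e lt_min => /andP[/ltr_normlP[h1 h2] /ltr_normlP[h3 h4]].
  apply/andP; split; move: h1 h4; clear; move: (dot _ _) (dot _ _) => a b; lra.
have [_] := jet_max_lap jP lmax.
apply/negP; rewrite -ltNge big_split/= Sc.
(* The Laplacian of rho + rho^2 is 20|y|^2 - 18, which explains the threshold 9/10. *)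
have -> : \sum_i m * (0 - 2 + (2 * (1 - dot y y) * (0 - 2) + 2 * (0 - 2 * y ord0 i) ^+ 2)) =
    m * (- 18 + 20 * dot y y).
  by rewrite /dot !sum3; move: (y ord0 0) (y ord0 1) (y ord0 2%:R) => p q r; ring.
apply: ltr_wpDl; first by rewrite mulr_ge0// sumsq_ge0.
by rewrite mulr_gt0//; move: y1'; clear; move: (dot y y) => a; lra.
Qed.

(** [J] is the determinant, W = r - |f|^2, N = |f|^2, S = |Df|^2 and Xf = f Df. The term in ln J^2
    has the favourable sign; 2SW + 4X <= 2S(r + N) <= 4S controls the term in ln W, and 6 rho + 4(1
    - rho) >= 4 the term in ln rho. *)
Lemma min_principle_algebra (J r S N W X rho : R) (b c cf Xf Y : 'I_3 -> R) : J != 0 -> 0 < W -> 0 < rho ->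
  \sum_i cf i = 2 * S -> \sum_i Xf i ^+ 2 = X -> \sum_i Y i ^+ 2 = 1 - rho -> X <= S * N ->
  0 <= S -> 0 <= N -> r <= 1 -> W = r - N -> J * (\sum_i c i) <= \sum_i b i ^+ 2 ->
  \sum_i (- ((2 * J * c i + 2 * b i ^+ 2) / J ^+ 2 - (2 * J * b i / J ^+ 2) ^+ 2) +
     6 * ((0 - cf i) / W - ((0 - 2 * Xf i) / W) ^+ 2) -
     6 * ((0 - 2) / rho - ((0 - 2 * Y i) / rho) ^+ 2)) <= 0 ->
  W ^+ 2 <= S * rho ^+ 2.
Proof.
move=> J0 W0 rho0 Scf SX SY XS S0 N0 r1 WE sup lap.
have E : \sum_i (- ((2 * J * c i + 2 * b i ^+ 2) / J ^+ 2 - (2 * J * b i / J ^+ 2) ^+ 2) +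
     6 * ((0 - cf i) / W - ((0 - 2 * Xf i) / W) ^+ 2) -
     6 * ((0 - 2) / rho - ((0 - 2 * Y i) / rho) ^+ 2)) =
  2 * (\sum_i b i ^+ 2 - J * (\sum_i c i)) / J ^+ 2 - 6 * ((\sum_i cf i) / W + 4 * (\sum_i Xf i ^+ 2) / W ^+ 2) +
  6 * (6 / rho + 4 * (\sum_i Y i ^+ 2) / rho ^+ 2).
  rewrite !sum3; move: J0 (gt_eqF W0) (gt_eqF rho0) => J0 /negbT W1 /negbT rho1; field.
  by rewrite J0 W1 rho1.
move: lap; rewrite E Scf SX SY.
have h1 : 0 <= 2 * (\sum_i b i ^+ 2 - J * (\sum_i c i)) / J ^+ 2.
  by rewrite mulr_ge0 ?invr_ge0 ?sqr_ge0// mulr_ge0// subr_ge0.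
have h2 : 2 * S / W + 4 * X / W ^+ 2 <= 4 * S / W ^+ 2.
  have -> : 2 * S / W = 2 * S * W / W ^+ 2 by field; rewrite gt_eqF.
  rewrite -mulrDl ler_wpM2r ?invr_ge0 ?sqr_ge0//.
  have : 0 <= S * (1 - r) by rewrite mulr_ge0// subr_ge0.
  have : 0 <= S * (r - N) by rewrite -WE mulr_ge0// ltW.
  move: XS; rewrite WE; nra.
have h3 : 4 / rho ^+ 2 <= 6 / rho + 4 * (1 - rho) / rho ^+ 2.
  have -> : 6 / rho = 6 * rho / rho ^+ 2 by field; rewrite gt_eqF.
  rewrite -mulrDl ler_wpM2r ?invr_ge0 ?sqr_ge0//; move: rho0; clear; lra.
move=> h4; have : 4 / rho ^+ 2 <= 4 * S / W ^+ 2.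
  move: h1 h2 h3 h4; clear; move: (_ / J ^+ 2) (_ / W + _) (_ / rho + _) => p q s.
  by move: (4 / _) (4 * S / _) => u v; lra.
rewrite ler_pdivlMr ?exprn_gt0// mulrAC ler_pdivrMr ?exprn_gt0// -mulrA.
by rewrite ler_pM2l.
Qed.

(* Maximum principle for [6 ln (r - |f|^2) - ln (det Df)^2 - 6 ln (1 - |x|^2)]; the second
   term is subharmonic, and the others give [(r - |f|^2)^2 <= |Df|^2 (1 - |x|^2)^2] at the
   maximum. *)
Lemma schwarz_bound C f r : qc_gradient C f -> (forall x, B x -> hess_det (diff_map f) x != 0) ->
  r < 1 -> forall x, B x -> dot (f x) (f x) <= r ->
  (r - dot (f x) (f x)) ^+ 6 <= C * hess_det (diff_map f) x ^+ 2 * (1 - dot x x) ^+ 6.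
Proof.
have aux (p q s : R) : p *+ 6 - (q + s *+ 6) = - q + 6 * p - 6 * s by ring.
move=> Q nz r1; have C0 := qg_pos Q; set D := hess_det (diff_map f).
have D2 x : B x -> 0 < D x ^+ 2.
  by move=> Bx; rewrite lt_neqAle sqr_ge0 andbT eq_sym sqrf_eq0 nz.
have rp x : B x -> 0 < 1 - dot x x by move=> Bx; rewrite subr_gt0; exact/unit_ballE.
have cD x : B x -> {for x, continuous D} := hess_det_continuous (qg_hessian Q).
have ce y : {for y, continuous (fun z : 'rV[R]_3 => 1 - dot z z)}.
  by apply: continuousB; [exact: cst_continuous|exact: continuous_dotxx].
have cW y : B y -> {for y, continuous (fun z => r - dot (f z) (f z))}.
  by move=> By; apply: continuousB; [exact: cst_continuous|exact: (continuous_map Q By)].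
have cX (u : 'rV[R]_3 -> R) y k : {for y, continuous u} -> {for y, continuous (fun z => u z ^+ k)}.
  move=> cu; elim: k => [|k IH]; first exact: cst_continuous.
  have -> : (fun z => u z ^+ k.+1) = (fun z => u z * u z ^+ k) by apply/funext => z; rewrite exprS.
  exact: continuousM.
pose G y := (r - dot (f y) (f y)) ^+ 6 / (D y ^+ 2 * (1 - dot y y) ^+ 6).
have den y : B y -> 0 < D y ^+ 2 * (1 - dot y y) ^+ 6.
  by move=> By; rewrite mulr_gt0 ?D2// exprn_gt0// rp.
move=> x Bx xr; suff: G x <= C by rewrite /G ler_pdivrMr ?den// mulrA.
have cK := compact_pre_shell (a := 0) Q r1.
have Kx : (B `&` [set y | 0 <= dot (f y) (f y) <= r]) x by split => //=; rewrite dot_ge0.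
have [|y [By /andP[_ yr]] Hy] := compact_argmax (u := G) cK (ex_intro _ x Kx).
  move=> z [Bz _]; apply: continuousM; first by apply: cX; exact: cW.
  apply: (@continuous_comp _ _ _ (fun y => D y ^+ 2 * (1 - dot y y) ^+ 6) (fun t : R => t^-1)).
    by apply: continuousM; apply: cX; [exact: cD|exact: ce].
  by apply: inv_continuous; rewrite gt_eqF// den.
apply: le_trans (Hy x Kx) _.
have [Gy|Gy] := leP (G y) 0; first by rewrite (le_trans Gy)// ltW.
have W0 : 0 < r - dot (f y) (f y).
  rewrite lt_neqAle subr_ge0 yr andbT; apply/eqP => w0.
  by move: Gy; rewrite /G -w0 expr0n/= mul0r ltxx.
have [b [c [jD sup]]] := hess_det_superharmonic (qg_hessian Q) By.
have [cf jf Scf] := jet_dot_map Q By.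
have jW := jetB (jet_cst r y) jf.
have jr := jetB (jet_cst 1 y) (jet_dot y).
have jF := jetB (jetD (jetN (jet_ln (jet_sqr jD) (D2 y By))) (jetZ 6 (jet_ln jW W0)))
  (jetZ 6 (jet_ln jr (rp y By))).
have lmax : exists2 d : R, 0 < d & forall z, cube y d z ->
    - ln (D z ^+ 2) + 6 * ln (r - dot (f z) (f z)) - 6 * ln (1 - dot z z) <=
    - ln (D y ^+ 2) + 6 * ln (r - dot (f y) (f y)) - 6 * ln (1 - dot y y).
  have [d1 d10 H1] := continuous_pos (cW y By) W0.
  have [d2 d20 H2] := open_cube (@open_ball R) By.
  have [d [d0 dd1 dd2]] := lt_two d10 d20; exists d => // z zy.
  have Wz := H1 z (cube_sub (ltW dd1) zy); have Bz := H2 z (cube_sub (ltW dd2) zy).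
  have lnG w : B w -> 0 < r - dot (f w) (f w) ->
      ln (G w) = - ln (D w ^+ 2) + 6 * ln (r - dot (f w) (f w)) - 6 * ln (1 - dot w w).
    move=> Bw Ww; rewrite /G ln_div ?posrE ?den ?exprn_gt0//.
    have dw := D2 w Bw; have rw := rp w Bw.
    have mul (p q : R) : 0 < p -> 0 < q -> ln (p * q) = ln p + ln q by move=> p0 q0; rewrite lnM.
    rewrite (mul _ _ dw (exprn_gt0 6 rw)) (lnXn 6 rw) (lnXn 6 Ww).
    exact: aux.
  rewrite -(lnG z Bz Wz) -(lnG y By W0) ler_ln ?posrE.
  - by apply: Hy; split => //=; rewrite dot_ge0 -subr_ge0 ltW.
  - by rewrite /G divr_gt0 ?den// exprn_gt0.
  - exact: Gy.
have [_ lap] := jet_max_lap jF lmax.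
have XS := dot_mulmx_le (jacobian3 f y) (f y).
have key : (r - dot (f y) (f y)) ^+ 2 <= sumsq (jacobian3 f y) * (1 - dot y y) ^+ 2.
  apply: (@min_principle_algebra (D y) r _ (dot (f y) (f y)) _
    (dot (f y *m jacobian3 f y) (f y *m jacobian3 f y)) _ b c cf
    (fun i => (f y *m jacobian3 f y) ord0 i) (fun i => y ord0 i)) => //.
  - exact: nz.
  - exact: rp.
  - by rewrite opprB addrC subrK.
  - exact: sumsq_ge0.
  - exact: dot_ge0.
  - exact: ltW.
rewrite /G ler_pdivrMr ?den// mulrA.
have dist := qg_distortion Q By; rewrite diff_mapE in dist.
(* The cube of [key] has |Df|^6 on the right, which is what bounded distortion compares with the
   squared determinant. *)
apply: (@le_trans _ _ (sumsq (jacobian3 f y) ^+ 3 * (1 - dot y y) ^+ 6)); last first.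
  by rewrite ler_wpM2r// exprn_ge0// ltW// rp.
have -> : sumsq (jacobian3 f y) ^+ 3 * (1 - dot y y) ^+ 6 =
   (sumsq (jacobian3 f y) * (1 - dot y y) ^+ 2) ^+ 3 by rewrite [RHS]exprMn -exprM.
have -> : (r - dot (f y) (f y)) ^+ 6 = ((r - dot (f y) (f y)) ^+ 2) ^+ 3 by rewrite -exprM.
by rewrite lerXn2r ?nnegrE ?sqr_ge0// mulr_ge0 ?sqr_ge0 ?sumsq_ge0.
Qed.

Lemma jacobian_lower_bound C f : qc_gradient C f ->
  (forall x, B x -> hess_det (diff_map f) x != 0) ->
  exists2 m : R, 0 < m & forall x, B x -> m <= \det (jacobian3 f x) ^+ 2.
Proof.
move=> Q nz; have C0 := qg_pos Q; have [c c0 Hc] := hopf_bound Q.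
exists ((c / 2) ^+ 6 / C) => [|x Bx]; first by rewrite divr_gt0// exprn_gt0// divr_gt0.
have r0 : 0 < 1 - dot x x by rewrite subr_gt0; exact/unit_ballE.
have w1 := Hc x Bx; set w := 1 - dot (f x) (f x) in w1.
have w0 : 0 < w by apply: lt_le_trans w1; rewrite mulr_gt0.
(* Midway between |f x|^2 and 1, so that r - |f x|^2 = w/2 is still bounded below by a multiple of 1
   - |x|^2. *)
pose r := 1 - w / 2; have r1 : r < 1 by rewrite /r; move: w0; clear; lra.
have fr : r - dot (f x) (f x) = w / 2 by rewrite /r /w; field.
have fr' : dot (f x) (f x) <= r by rewrite -subr_ge0 fr divr_ge0// ltW.
have := schwarz_bound Q nz r1 Bx fr'; rewrite fr.
have -> : hess_det (diff_map f) x = \det (jacobian3 f x) by [].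
move=> h; rewrite ler_pdivrMr// mulrC -(ler_pM2r (exprn_gt0 6 r0)).
rewrite [_ * C]mulrC in h *; apply: le_trans h.
rewrite -exprMn lerXn2r ?nnegrE ?mulr_ge0 ?(ltW c0) ?(ltW r0) ?(ltW w0)//.
by rewrite -mulrA mulrC ler_pM2r.
Qed.

End LowerBounds.

(** * The bi-Lipschitz property *)

Section BiLipschitz.
Context {R : realType}.
Implicit Types (v w x y z p q : 'rV[R]_3) (f : 'rV[R]_3 -> 'rV[R]_3) (C : R).
Local Notation B := (unit_ball R 3).

Lemma ball_segment x y (t : R) : B x -> B y -> 0 <= t <= 1 -> B (x + t *: (y - x)).
Proof.
move=> Bx By /andP[t0 t1]; rewrite /unit_ball /=.
have -> : x + t *: (y - x) = (1 - t) *: x + t *: y.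
  by rewrite scalerBr scalerBl scale1r addrCA addrC.
apply: le_lt_trans (enormD _ _) _; rewrite !enormZ (ger0_norm t0) ger0_norm ?subr_ge0//.
have hx : enorm x < 1 := Bx; have hy : enorm y < 1 := By.
have [->|tn] := eqVneq t 0; first by rewrite subr0 mul1r mul0r addr0.
have h1 : (1 - t) * enorm x <= 1 - t by rewrite ler_piMr ?subr_ge0// ltW.
have h2 : t * enorm y < t by rewrite gtr_pMr// lt_neqAle eq_sym tn.
by move: h1 h2; move: (_ * enorm x) (_ * enorm y) => a b; lra.
Qed.

(** The mean value theorem is applied to the scalar function <w, f> with w = f x - f y, whose
    increment is |w|^2; one factor |w| then cancels. *)
Lemma map_lipschitz C f (M : R) x y : qc_gradient C f ->
  (forall z, B z -> sumsq (jacobian3 f z) <= M) -> B x -> B y ->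
  enorm (f x - f y) <= Num.sqrt M * enorm (x - y).
Proof.
move=> Q HM Bx By; pose w := f x - f y; pose v := x - y.
pose g z := \sum_j w ord0 j * f z ord0 j.
have gE z : g z = dot w (f z) by [].
have Hg : harmonic_on B g.
  apply: harmonic_sum => [|j]; first exact: open_ball.
  by apply: harmonicZ; [exact: open_ball|exact: (qg_harmonic Q j)].
have seg (t : R) : 0 <= t <= 1 -> B (y + t *: v) by exact: ball_segment.
have [t t01|c /andP[c0 c1] E] := @mvt_pos _ (fun t => g (y + t *: v))
    (fun t => \sum_i v ord0 i * partial i g (y + t *: v)) 1 ltr01.
  exact: line_derive (@open_ball R) Hg (seg t t01).
have Bz : B (y + c *: v) by apply: seg; rewrite !ltW.
set z := y + c *: v in E Bz.
have dE : \sum_i v ord0 i * partial i g z = dot (v *m jacobian3 f z) w.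
  have pg i : partial i g z = \sum_j w ord0 j * jacobian3 f z i j.
    have df j : derivable (fun y => f y ord0 j) z (basis_vec i).
      exact: (C_on_derivable (qg_harmonic Q j).1 Bz).
    rewrite /g partial_bigsum => [|j]; last by apply: derivableM; [exact: derivable_cst|exact: df].
    by apply: eq_bigr => j _; rewrite (partialZ _ (df j)) [jacobian3 _ _ _ _]mxE.
  under eq_bigr do rewrite pg mulr_sumr.
  rewrite exchange_big /dot; apply: eq_bigr => j _.
  by rewrite [in RHS]mxE mulr_suml; apply: eq_bigr => i _; ring.
have {}E : dot w w = dot (v *m jacobian3 f z) w.
  have E1 : y + 1 *: v = x by rewrite scale1r /v addrC subrK.
  move: E; rewrite E1 scale0r addr0 dE mulr1 !gE => <-.
  by rewrite [dot w (f x)]dotC [dot w (f y)]dotC -mulN1r -dotZl -dotDl scaleN1r.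
have M0 : 0 <= M by exact: le_trans (sumsq_ge0 _) (HM y By).
have h : enorm (v *m jacobian3 f z) <= Num.sqrt M * enorm v.
  rewrite !enormE -sqrtrM// ler_wsqrtr//; apply: le_trans (dot_mulmx_le _ _) _.
  by rewrite ler_wpM2r ?dot_ge0//; exact: HM.
have [w0|w0] := eqVneq (enorm w) 0.
  by rewrite -/w w0 mulr_ge0 ?sqrtr_ge0 ?enorm_ge0.
have wp : 0 < enorm w by rewrite lt_neqAle eq_sym w0 enorm_ge0.
rewrite -/w -/v; apply: le_trans h; rewrite -(ler_pM2r wp) -expr2 sqr_enorm E.
exact: dot_le_enorm.
Qed.

(** The differential at [x] expands lengths by at least 1/L, by [det_dot_le]; close to [x] the
    linearization error costs at most a factor 2. *)
Lemma local_expansion C f (M m : R) x : qc_gradient C f -> 0 < M -> 0 < m ->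
  (forall z, B z -> sumsq (jacobian3 f z) <= M) ->
  (forall z, B z -> m <= \det (jacobian3 f z) ^+ 2) -> B x ->
  exists2 d : R, 0 < d & forall y, cube x d y ->
    enorm (y - x) <= 2 * Num.sqrt (3 * M ^+ 2 / m) * enorm (f y - f x).
Proof.
move=> Q M0 m0 HM Hm Bx; set L := Num.sqrt _.
have L0 : 0 < L by rewrite sqrtr_gt0 divr_gt0// mulr_gt0// exprn_gt0.
have lower v : enorm v <= L * enorm (v *m jacobian3 f x).
  rewrite !enormE /L -sqrtrM; last by rewrite divr_ge0 ?mulr_ge0 ?sqr_ge0// ltW.
  rewrite ler_wsqrtr// mulrAC ler_pdivlMr// mulrC.
  apply: (@le_trans _ _ (\det (jacobian3 f x) ^+ 2 * dot v v)).
    by rewrite ler_wpM2r ?dot_ge0// Hm.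
  apply: le_trans (det_dot_le _ _) _; rewrite ler_wpM2r ?dot_ge0// ler_pM2l//.
  by rewrite lerXn2r ?nnegrE ?sumsq_ge0 ?(ltW M0)// HM.
(* Three coordinates of f, each with an error bounded through three coordinates of y - x, give
   9/(18L); multiplied by L this is the 1/2 that is absorbed. *)
have a0 : 0 < (18 * L)^-1 by rewrite invr_gt0 mulr_gt0.
have [|d d0 Hd] := @cube_forall _ _ x (fun j y =>
    `|f y ord0 j - f x ord0 j - ((y - x) *m jacobian3 f x) ord0 j| <= (18 * L)^-1 * (3 * enorm (y - x))).
  move=> j; have [d d0 Hd] := strict_diff (@open_ball R) (C_onS (@open_ball R) (qg_harmonic Q j).1) Bx a0.
  exists d => // y xy; have := Hd x y (cube_center x d0) xy.
  have -> : ((y - x) *m jacobian3 f x) ord0 j =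
      \sum_i partial i (fun y => f y ord0 j) x * (y ord0 i - x ord0 i).
    by rewrite mxE; apply: eq_bigr => i _; rewrite !mxE mulrC.
  move=> /le_trans; apply; rewrite ler_pM2l// sum3.
  have h i : `|y ord0 i - x ord0 i| <= enorm (y - x) by have := coord_le_enorm (y - x) i; rewrite !mxE.
  by have := (h 0, h 1, h 2%:R) => -[[]]; move: (enorm _) => e; lra.
exists d => // y xy; set v := y - x; set w := f y - f x.
have h1 : enorm (w - v *m jacobian3 f x) <= 3 * ((18 * L)^-1 * (3 * enorm v)).
  by apply: enorm_le_coords => j; have := Hd j y xy; rewrite /w !mxE.
have h2 : enorm (v *m jacobian3 f x) <= enorm w + 3 * ((18 * L)^-1 * (3 * enorm v)).
  have -> : v *m jacobian3 f x = w + - (w - v *m jacobian3 f x) by rewrite opprB addrC subrK.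
  by apply: le_trans (enormD _ _) _; rewrite enormN lerD2l.
have h3 := lower v; have h4 := ler_wpM2l (ltW L0) h2.
have E : L * (enorm w + 3 * ((18 * L)^-1 * (3 * enorm v))) = L * enorm w + enorm v / 2.
  by field; rewrite gt_eqF.
rewrite E in h4; move: (le_trans h3 h4); rewrite -mulrA.
by move: (L * _) (enorm v) => a b; lra.
Qed.

(** The radius [d] depends on t, so a continuity argument replaces a subdivision: the supremum of
    the t with u t - u 0 <= Lt belongs to this set, and it can be increased unless it is 1. *)
Lemma local_lipschitz_itv (u : R -> R) (L : R) : 0 <= L ->
  (forall t, 0 <= t <= 1 -> exists2 d : R, 0 < d &
    forall s, 0 <= s <= 1 -> `|s - t| < d -> `|u s - u t| <= L * `|s - t|) ->
  u 1 - u 0 <= L.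
Proof.
move=> L0 H; pose A := [set t | 0 <= t <= 1 /\ u t - u 0 <= L * t].
have A0 : A 0 by split; rewrite ?lexx ?ler01// subrr mulr0.
have Aub : ubound A 1 by move=> t [/andP[_ t1] _].
have sA : has_sup A by split; [exists 0|exists 1].
pose c := sup A; have c0 : 0 <= c by exact: (sup_upper_bound sA).
have c1 : c <= 1 by exact: ge_sup (ex_intro _ 0 A0) Aub.
have [d d0 Hd] := H c (introT andP (conj c0 c1)).
have Ac : u c - u 0 <= L * c.
  have [t At tc] := sup_adherent d0 sA; have [/andP[t0 t1] ut] := At.
  have tle : t <= c by exact: (sup_upper_bound sA).
  have := Hd t; rewrite t0 t1 distrC ger0_norm ?subr_ge0//.
  rewrite -/c in tc; have -> : c - t < d by move: tc; clear; lra.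
  move=> /(_ isT isT) /ler_normlP[h1 h2].
  by move: h1 ut; rewrite mulrBr; clear; move: (L * c) (L * t) (u t) (u c) (u 0) => *; lra.
have [c11|cn1] := eqVneq c 1; first by move: Ac; rewrite c11 mulr1.
have {}c1 : c < 1 by rewrite lt_neqAle cn1.
have c10 : 0 < 1 - c by rewrite subr_gt0.
have [e [e0 ed e1]] := lt_two d0 c10.
have As : A (c + e).
  have s1 : c + e <= 1 by move: e1; clear; lra.
  have s0 : 0 <= c + e by rewrite addr_ge0// ltW.
  split; first by rewrite s0 s1.
  have := Hd (c + e); rewrite s0 s1 addrAC subrr add0r (gtr0_norm e0) => /(_ isT ed) /ler_normlP[_ h].
  by rewrite mulrDr; move: h Ac; clear; move: (L * c) (L * e) (u (c + e)) (u c) (u 0) => *; lra.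
have : c + e <= c by exact: (sup_upper_bound sA).
by move: e0; clear; lra.
Qed.

(** The segment joins f y to f x in the image ball. Its preimage under the continuous inverse [g]
    satisfies the estimate of [local_expansion] at each point, and [local_lipschitz_itv] chains
    these estimates. *)
Lemma map_colipschitz C f (M m : R) : qc_gradient C f -> 0 < M -> 0 < m ->
  (forall z, B z -> sumsq (jacobian3 f z) <= M) ->
  (forall z, B z -> m <= \det (jacobian3 f z) ^+ 2) ->
  homeomorphism_onto B B f -> forall x y, B x -> B y ->
  enorm (x - y) <= 2 * Num.sqrt (3 * M ^+ 2 / m) * enorm (f x - f y).
Proof.
move=> Q M0 m0 HM Hm [[fB finj fsurj] _ [g [fg cg]]] x y Bx By; set L := 2 * _.
have L0 : 0 <= L by rewrite mulr_ge0// sqrtr_ge0.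
have gf p : B p -> f (g p) = p /\ B (g p).
  by move=> /fsurj[z Bz <-]; rewrite fg ?inE.
have cgp p : B p -> {for p, continuous g}.
  by move=> Bp; move: cg; rewrite (continuous_open_subspace _ (@open_ball R)); apply; rewrite inE.
pose p := f y; pose q := f x; have Bp : B p by exact: fB. have Bq : B q by exact: fB.
pose z (t : R) := p + t *: (q - p).
have Bz t : 0 <= t <= 1 -> B (z t) by exact: ball_segment.
pose u t := enorm (g (z t) - g p).
have := @local_lipschitz_itv u (L * enorm (q - p)) (mulr_ge0 L0 (enorm_ge0 _)).
have u0 : u 0 = 0 by rewrite /u /z scale0r addr0 subrr enormE dot0l sqrtr0.
have u1 : u 1 = enorm (x - y).
  by rewrite /u /z scale1r [p + _]addrC subrK /p /q !fg ?inE.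
rewrite u0 u1 subr0; apply => t t01.
have Bzt := Bz t t01; have [fgz Bgz] := gf _ Bzt.
have [d d0 Hd] := local_expansion Q M0 m0 HM Hm Bgz.
have /nbhs_cube[k k0 Hk] : nbhs (z t) (g @^-1` cube (g (z t)) d).
  by apply: (cgp _ Bzt); apply/nbhs_cube; exists d.
have N0 : 0 < 1 + enorm (q - p) by rewrite ltr_pwDl// enorm_ge0.
exists (k / (1 + enorm (q - p))); first exact: divr_gt0.
move=> s s01 st; have [fgs Bgs] := gf _ (Bz s s01).
have zE : z s - z t = (s - t) *: (q - p).
  by rewrite /z opprD addrACA subrr add0r scalerBl.
have zst : cube (z t) k (z s).
  move=> i; have -> : z s ord0 i - z t ord0 i = (z s - z t) ord0 i by rewrite !mxE.
  apply: le_lt_trans (coord_le_enorm _ _) _; rewrite zE enormZ.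
  move: st; rewrite ltr_pdivlMr// => st; apply: le_lt_trans st.
  by rewrite ler_wpM2l// lerDr.
have h : enorm (g (z s) - g (z t)) <= L * enorm (q - p) * `|s - t|.
  have := Hd _ (Hk _ zst); rewrite fgs fgz zE enormZ -/L => h; apply: (le_trans h).
  by rewrite -mulrA [_ * enorm _]mulrC.
apply: le_trans h; rewrite /u; apply/ler_normlP; split.
  rewrite opprB lerBlDr; have -> : g (z t) - g p = - (g (z s) - g (z t)) + (g (z s) - g p).
    by rewrite opprB addrA subrK.
  by apply: le_trans (enormD _ _) _; rewrite enormN.
rewrite lerBlDr; have -> : g (z s) - g p = (g (z s) - g (z t)) + (g (z t) - g p).
  by rewrite addrA subrK.
exact: enormD.
Qed.

Lemma gradient_hessian f (u : 'rV[R]_3 -> R) : harmonic_map_on B f -> harmonic_on B u ->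
  (forall x, B x -> f x = gradient u x) -> harmonic_hessian B (diff_map f).
Proof.
move=> Hf Hu fu; have oB := @open_ball R.
have E j : {in B, (fun x => f x ord0 j) =1 partial j u}.
  by move=> x; rewrite inE => Bx; rewrite fu// mxE.
have dE i j x : B x -> diff_map f i j x = partial i (partial j u) x.
  by move=> Bx; exact: (partial_eq i oB (E j) Bx).2.
split.
- exact: oB.
- by move=> i j; exact: harmonic_partial oB (Hf j).
- by move=> i j x Bx; rewrite (dE i j x Bx) (dE j i x Bx); exact: (partialC _ _ oB Hu.1 Bx).
- by move=> x Bx; rewrite -[RHS](Hu.2 x Bx); apply: eq_bigr => i _; exact: dE.
- by move=> i j k x Bx; exact: (partialC _ _ oB (Hf j).1 Bx).
Qed.

(** If Df vanished near [z], then f would be constant on a segment parallel to an axis, against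
    injectivity. *)
Lemma differential_not_locally_zero f z : harmonic_map_on B f ->
  {in B &, injective f} -> B z -> forall d : R, 0 < d ->
  exists i j y, cube z d y /\ diff_map f i j y != 0.
Proof.
move=> Hf finj Bz d d0; apply: contrapT => none.
have zero i j y : cube z d y -> diff_map f i j y = 0.
  by move=> zy; apply/eqP; apply: contraT => ne; case: none; exists i, j, y.
have [d' d'0 Hd'] := open_cube (@open_ball R) Bz.
have [t [t0 td td']] := lt_two d0 d'0.
have sub' (s : R) : `|s| <= `|t| -> cube z d (z + s *: basis_vec 0) /\ B (z + s *: basis_vec 0).
  rewrite (gtr0_norm t0) => st.
  by split; [|apply: Hd']; apply: cube_shift; exact: le_lt_trans st _.
have zt : f (z + t *: basis_vec 0) = f z.
  apply/rowP => j; apply/eqP; rewrite -subr_eq0; apply/eqP.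
  have [s st|c ct ->] := @mvt_line _ _ (fun y => f y ord0 j) z 0 t.
    exact: (C_on_derivable (Hf j).1 (sub' s st).2).
  by have := zero 0 j _ (sub' c ct).1; rewrite /diff_map => ->; rewrite mul0r.
have := finj _ _ _ _ zt; rewrite !inE => /(_ (sub' t (lexx _)).2 Bz) /rowP/(_ 0).
by rewrite shiftE eqxx mulr1 => /eqP; rewrite -subr_eq0 addrAC subrr add0r (gt_eqF t0).
Qed.

End BiLipschitz.

Unset Implicit Arguments.

Theorem theorem1p1 (R : realType) (f : 'rV[R]_3 -> 'rV[R]_3) :
  harmonic_map_on (unit_ball R 3) f ->
  quasiconformal (unit_ball R 3) (unit_ball R 3) f ->
  (exists2 u : 'rV[R]_3 -> R, harmonic_on (unit_ball R 3) u &
     forall x, unit_ball R 3 x -> f x = gradient u x) ->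
  bi_lipschitz_on (unit_ball R 3) f.
Proof.
move=> Hf [_ _ homeo [Df wDf [K aeK]]] [u Hu fu].
have [[fB finj fsurj] _ [g [fg cg]]] := homeo.
have oB := @open_ball R; have Hh := gradient_hessian Hf Hu fu.
pose C := 27 * K ^+ 2 + 1.
have C0 : 0 < C by rewrite ltr_wpDl// mulr_ge0// sqr_ge0.
have dist : bounded_distortion C (unit_ball R 3) (diff_map f).
  move=> x Bx; apply: (jacobian_inequality oB _ wDf aeK Bx) => j.
  exact: C_onS oB (Hf j).1.
(* Properness: the preimage of a compact subset of the ball is its image under the continuous
   inverse [g]. *)
have Q : qc_gradient C f.
  split => // S cS SB.
  have -> : unit_ball R 3 `&` f @^-1` S = g @` S.
    apply/seteqP; split=> [x [Bx Sx]|_ [y Sy <-]].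
      by exists (f x) => //; rewrite fg ?inE.
    have [x Bx fx] := fsurj y (SB y Sy).
    by rewrite -fx fg ?inE//; split => //; rewrite /preimage /= fx.
  apply: continuous_compact cS; exact: continuous_subspaceW SB cg.
have nz x : unit_ball R 3 x -> hess_det (diff_map f) x != 0.
  move=> Bx; apply: (lewy Hh dist Bx) => d d0.
  exact: differential_not_locally_zero Hf finj Bx d d0.
have [M M0 HM] := differential_bounded Q.
have [m m0 Hm] := jacobian_lower_bound Q nz.
set L1 := Num.sqrt M; set L2 := 2 * Num.sqrt (3 * M ^+ 2 / m).
have L10 : 0 <= L1 by exact: sqrtr_ge0.
have L20 : 0 <= L2 by rewrite mulr_ge0// sqrtr_ge0.
exists (1 + L1 + L2) => [|x y Bx By]; first by rewrite -addrA lerDl addr_ge0.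
have L0 : 0 < 1 + L1 + L2 by rewrite ltr_pwDl// ltr_pwDl.
apply/andP; split.
  rewrite mulrC ler_pdivrMr// mulrC.
  apply: le_trans (map_colipschitz Q M0 m0 HM Hm homeo Bx By) _.
  by rewrite ler_wpM2r ?enorm_ge0// lerDr addr_ge0.
apply: le_trans (map_lipschitz Q HM Bx By) _.
by rewrite ler_wpM2r ?enorm_ge0// -/L1 addrAC lerDr addr_ge0.
Qed.
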